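(* Let $A\in\mathbb{R}^{n\times n}$ be symmetric with smallest and largest eigenvalues $\lambda_{\min}$ and $\lambda_{\max}$, let $f:\mathbb{R}\to\mathbb{R}$, let the eigenvalues of $A$ be ordered so that $|f(\lambda_1)|\ge\cdots\ge|f(\lambda_n)|$, and let $\Lambda_{n\setminus k}=\mathrm{diag}(\lambda_{k+1},\dots,\lambda_n)$. Let $\ell\ge k$, let $\Omega\in\mathbb{R}^{n\times\ell}$ be a standard Gaussian matrix, and let $\mathrm{ALG}_k(s,r;f)$ be the output of the Krylov-aware low-rank approximation algorithm with starting block $\Omega$ (see context). With $\mathcal{E}(s;f)$ as defined in the context: (i) for any $\delta\in(0,1)$, with probability at least $1-\delta$, $$\|f(A)-\mathrm{ALG}_k(s,r;f)\|_F\le 4\sqrt{\ell s}\inf_{p\in\mathbb{P}_{2r+1}}\|f(x)-p(x)\|_{L^\infty([\lambda_{\min},\lambda_{\max}])}+\sqrt{\|f(\Lambda_{n\setminus k})\|_F^2+5C_{\delta,k,\ell}\,\mathcal{E}(s;f)},$$ where $C_{\delta,k,\ell}=2e\,(2\log(2/\delta)+1)\left(\frac{2\sqrt{\pi k}}{\delta}\right)^{\frac{2}{\ell-k+1}}\frac{k}{\ell-k+1}$; (ii) if $\ell-k\ge 2$, then $$\mathbb{E}\|f(A)-\mathrm{ALG}_k(s,r;f)\|_F\le 4\sqrt{\ell s}\inf_{p\in\mathbb{P}_{2r+1}}\|f(x)-p(x)\|_{L^\infty([\lambda_{\min},\lambda_{\max}])}+\sqrt{\|f(\Lambda_{n\setminus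 k})\|_F^2+\frac{5k}{\ell-k-1}\,\mathcal{E}(s;f)}.$$
   Context: $\|\cdot\|_F$ is the Frobenius norm; $\|g\|_{L^\infty(I)}=\sup_{x\in I}|g(x)|$; $\mathbb{P}_m$ is the set of real scalar polynomials of degree at most $m$. If $A=U\Lambda U^T$ is an eigendecomposition with $\Lambda=\mathrm{diag}(\lambda_1,\dots,\lambda_n)$, then $f(A)=U\,\mathrm{diag}(f(\lambda_1),\dots,f(\lambda_n))\,U^T$. A standard Gaussian matrix has i.i.d. $N(0,1)$ entries. $[\![B]\!]_k$ denotes a best rank-(at most)-$k$ approximation of $B$ obtained by truncating the SVD. Here $s\ge1$, $r\ge0$, $k\ge1$ are integers. Krylov subspace: $\mathcal{K}_i(A,\Omega)=\mathrm{range}([\Omega\ A\Omega\ \cdots\ A^{i-1}\Omega])$ and $d_{i,\ell}=\dim\mathcal{K}_i(A,\Omega)$. Block-Lanczos (exact arithmetic): applied to $A$ with starting block $\Omega$ for $q$ iterations it produces matrices $V_0,\dots,V_{q-1}$ (possibly with fewer than $\ell$, even zero, columns) such that for every $1\le i\le q$ the matrix $Q_i=[V_0\ \cdots\ V_{i-1}]$ has orthonormal columns forming a basis of $\mathcal{K}_i(A,\Omega)$, and the block tridiagonal matrix $T_q=Q_q^TAQ_q$. Krylov-aware low-rank approximation: with $q=s+r$, run block-Lanczos for $q$ iterations with starting block $\Omega$, set $X=f(T_q)_{1:d_{s,\ell},\,1:d_{s,\ell}}$ (the leading principal $d_{s,\ell}\times d_{s,\ell}$ submatrix of $f(T_q)$),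 and output $\mathrm{ALG}_k(s,r;f)=Q_s[\![X]\!]_kQ_s^T$. Definition: $$\mathcal{E}(s;f)=\min_{p\in\mathbb{P}_{s-1}}\left[\|p(\Lambda_{n\setminus k})\|_F^2\max_{i=1,\dots,k}\left|\frac{f(\lambda_i)}{p(\lambda_i)}\right|^2\right],$$ where the bracket is taken to be $+\infty$ if $p(\lambda_i)=0$ for some $i\le k$ (and the minimum is read as an infimum if not attained). *)

(* Defs.v *)
From HB Require Import structures.
From mathcomp Require Import all_boot all_order all_algebra.
From mathcomp Require Import all_classical all_reals all_analysis.

Set Implicit Arguments.
Unset Strict Implicit.
Unset Printing Implicit Defensive.

Import Order.TTheory GRing.Theory Num.Theory.
Import numFieldNormedType.Exports.

Local Open Scope classical_set_scope.
Local Open Scope ring_scope.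

Definition frobenius (R : realType) (m n : nat) (M : 'M[R]_(m, n)) : R :=
  Num.sqrt (\sum_i \sum_j M i j ^+ 2).

(* Real orthogonal matrix; for a rectangular M, orthonormal columns. *)
Definition orthonormal_cols (R : realType) (m n : nat) (M : 'M[R]_(m, n)) :
  Prop := M^T *m M = 1%:M.

Definition eigendecomposition (R : realType) (n : nat)
    (M U : 'M[R]_n) (lam : 'rV[R]_n) : Prop :=
  orthonormal_cols U /\ M = U *m diag_mx lam *m U^T.

(* f(M), for M with eigendecomposition M = U diag(lam) U^T. *)
Definition matfun (R : realType) (n : nat)
    (f : R -> R) (U : 'M[R]_n) (lam : 'rV[R]_n) : 'M[R]_n :=
  U *m diag_mx (map_mx f lam) *m U^T.

Definition smallest_eigenvalue (R : realType) (n : nat) (M : 'M[R]_n) (a : R) :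
  Prop := eigenvalue M a /\ forall b, eigenvalue M b -> a <= b.

Definition largest_eigenvalue (R : realType) (n : nat) (M : 'M[R]_n) (a : R) :
  Prop := eigenvalue M a /\ forall b, eigenvalue M b -> b <= a.

Definition svd (R : realType) (d : nat)
    (B U : 'M[R]_d) (sigma : 'rV[R]_d) (V : 'M[R]_d) : Prop :=
  [/\ orthonormal_cols U, orthonormal_cols V,
      forall i, 0 <= sigma 0 i,
      forall i j : 'I_d, (i <= j)%N -> sigma 0 j <= sigma 0 i
    & B = U *m diag_mx sigma *m V^T].

(* C is a truncation to rank at most k of some SVD of B; C need not be unique
   when the k-th and (k+1)-st singular values of B coincide. *)
Definition svd_truncation (R : realType) (d : nat) (k : nat) (B C : 'M[R]_d) :
  Prop :=
  exists U sigma V, svd B U sigma V /\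
    C = U *m diag_mx (\row_i (if (i < k)%N then sigma 0 i else 0)) *m V^T.

Definition krylov_mx (R : realType) (n l : nat)
    (A : 'M[R]_n) (Om : 'M[R]_(n, l)) (i : nat) :
    'M[R]_(n, \sum_(j < i) l) :=
  \mxrow_(j < i) (A ^+ j *m Om).

Definition lanczos_basis (R : realType) (n : nat)
    (w : nat -> nat) (V : forall j, 'M[R]_(n, w j)) (i : nat) :
    'M[R]_(n, \sum_(j < i) w j) :=
  \mxrow_(j < i) V j.

(* The blocks V 0, ..., V (q - 1), of respective widths w 0, ..., w (q - 1),
   are an output of q iterations of block-Lanczos (the other blocks are
   irrelevant).  Column spaces are compared as row spaces of the transposes;
   in particular \sum_(j < i) w j = dim K_i(A, Om) for 1 <= i <= q. *)
Definition block_lanczos (R : realType) (n l : nat)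
    (A : 'M[R]_n) (Om : 'M[R]_(n, l)) (q : nat)
    (w : nat -> nat) (V : forall j, 'M[R]_(n, w j)) : Prop :=
  forall i, (1 <= i <= q)%N ->
    orthonormal_cols (lanczos_basis V i) /\
    ((lanczos_basis V i)^T == (krylov_mx A Om i)^T)%MS.

Lemma leq_sum_widths (w : nat -> nat) (s r : nat) :
  (\sum_(j < s) w j <= \sum_(j < s + r) w j)%N.
Proof. by rewrite [leqRHS]big_split_ord /= leq_addr. Qed.

Definition leading_submx (R : realType) (d q : nat) (le_dq : (d <= q)%N)
    (M : 'M[R]_q) : 'M[R]_d :=
  mxsub (widen_ord le_dq) (widen_ord le_dq) M.

(* B is a possible value of ALG_k(s, r; f): the choices left open are the
   block-Lanczos bases, the eigendecomposition used to evaluate f(T_q) and the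
   SVD that is truncated. *)
Definition alg_output (R : realType) (n l : nat)
    (A : 'M[R]_n) (f : R -> R) (s r k : nat) (Om : 'M[R]_(n, l))
    (B : 'M[R]_n) : Prop :=
  exists (w : nat -> nat) (V : forall j, 'M[R]_(n, w j)),
    block_lanczos A Om (s + r) V /\
    let Qs := lanczos_basis V s in
    let Qq := lanczos_basis V (s + r) in
    let Tq := Qq^T *m A *m Qq in
    exists W mu, eigendecomposition Tq W mu /\
      exists Y, svd_truncation k
          (leading_submx (leq_sum_widths w s r) (matfun f W mu)) Y /\
        B = Qs *m Y *m Qs^T.

(* Real polynomials of degree at most m. *)
Definition polys (R : realType) (m : nat) : set {poly R} :=
  [set p | (size p <= m.+1)%N].

Definition sup_norm (R : realType) (a b : R) (g : R -> R) : \bar R :=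
  ereal_sup [set `|g x|%:E | x in `[a, b]].

Definition poly_approx_error (R : realType) (m : nat) (f : R -> R) (a b : R) :
    \bar R :=
  ereal_inf [set sup_norm a b (fun x => f x - p.[x]) | p in @polys R m].

(* (lambda_1, ..., lambda_k) and (lambda_(k+1), ..., lambda_n). *)
Definition eigs_head (R : realType) (n k : nat) (le_kn : (k <= n)%N)
    (lam : 'rV[R]_n) : 'rV[R]_k :=
  \row_(i < k) lam 0 (widen_ord le_kn i).

Definition eigs_tail (R : realType) (n k : nat) (le_kn : (k <= n)%N)
    (lam : 'rV[R]_n) : 'rV[R]_(n - k) :=
  \row_(j < n - k) lam 0 (cast_ord (subnKC le_kn) (rshift k j)).

(* || g(Lambda_{n \ k}) ||_F *)
Definition tail_norm (R : realType) (n k : nat) (le_kn : (k <= n)%N)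
    (lam : 'rV[R]_n) (g : R -> R) : R :=
  frobenius (diag_mx (map_mx g (eigs_tail le_kn lam))).

Definition energy_at (R : realType) (n k : nat) (le_kn : (k <= n)%N)
    (lam : 'rV[R]_n) (f : R -> R) (p : {poly R}) : \bar R :=
  let mu := eigs_head le_kn lam in
  if [exists i, p.[mu 0 i] == 0] then +oo%E
  else (tail_norm le_kn lam (horner p) ^+ 2 *
        \big[Num.max/0]_(i < k) `|f (mu 0 i) / p.[mu 0 i]| ^+ 2)%:E.

(* E(s; f), for s >= 1. *)
Definition energy (R : realType) (n k : nat) (le_kn : (k <= n)%N)
    (lam : 'rV[R]_n) (f : R -> R) (s : nat) : \bar R :=
  ereal_inf [set energy_at le_kn lam f p | p in @polys R s.-1].

Definition Cdelta (R : realType) (delta : R) (k l : nat) : R :=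
  2 * expR 1 * (2 * ln (2 / delta) + 1)
  * ((2 * Num.sqrt (pi * k%:R) / delta) `^ (2 / (l%:R - k%:R + 1)))
  * (k%:R / (l%:R - k%:R + 1)).

Definition mutually_independent (d : measure_display) (T : measurableType d)
    (R : realType) (P : probability T R) (I : finType)
    (X : I -> {RV P >-> R}) : Prop :=
  forall (J : {set I}) (B : I -> set R), (forall i, measurable (B i)) ->
    P (\bigcap_(i in [set` J]) (X i @^-1` B i))
    = (\prod_(i in J) P (X i @^-1` B i))%E.

Definition std_gaussian_entries (d : measure_display) (T : measurableType d)
    (R : realType) (P : probability T R) (n l : nat)
    (G : 'I_n * 'I_l -> {RV P >-> R}) : Prop :=
  mutually_independent G /\
  forall ij (B : set R), measurable B ->
    distribution P (G ij) B = normal_prob 0 1 B.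

Definition random_mx (d : measure_display) (T : measurableType d)
    (R : realType) (P : probability T R) (n l : nat)
    (G : 'I_n * 'I_l -> {RV P >-> R}) (t : T) : 'M[R]_(n, l) :=
  \matrix_(i, j) G (i, j) t.

(* "S holds with probability at least a": S contains a measurable event of
   probability at least a; for a measurable S this is a <= P S. *)
Definition holds_with_prob (d : measure_display) (T : measurableType d)
    (R : realType) (P : probability T R) (a : R) (S : set T) : Prop :=
  exists E : set T, [/\ measurable E, (a%:E <= P E)%E & E `<=` S].

(* Main.v *)
(* Write Omega1, Omega2 for the first k and the last n - k rows of U^T Omega.  For
   every polynomial g of degree < s without zero among lam_1, ..., lam_k, the range
   of g(A) Omega Omega1^+ lies in the Krylov space K_s, and comparison with the
   projection onto that range (Eckart-Young, applied to the compression of f(A))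
   bounds the error by
     4 sqrt(l s) |f - p|_oo
       + sqrt(|f(L2)|^2 + 5 |g(L2) Omega2 Omega1^+|^2 max |f / g|^2),
   L2 = diag(lam_(k+1), ..., lam_n); the first term appears because the
   leading block of f(T_q) is the compression of f(A) only for polynomials of degree
   <= 2 r + 1, and is replaced by that of p in general.

   U^T Omega is again Gaussian (Givens rotations preserve a Gaussian family), so
   Omega1 and Omega2 are independent.  Given Omega1, the squared norm divided by
   |g(L2)|^2 |Omega1^+|^2 is a convex combination of chi-square variables: its mean
   is at most 1 and, by Jensen, its exponential moment at 3/8 is at most 2.  Moreover
   |Omega1^+|^2 is the trace of (Omega1 Omega1^T)^-1, whose diagonal entries are
   inverse chi-squares with m = l - k + 1 degrees of freedom: an entry is at most
   1 / |w|^2, with w the component of a row of Omega1 orthogonal to the others.  This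
   bounds its mean by k / (m - 2).  Its tail is obtained by counting: if the entries
   Z_i satisfy sum Z_i >= k x, then sum (Z_i / x)^m >= k by Bernoulli's inequality.

   The infimum over g is reached along a sequence: for the probability bound the
   event is the limsup of the corresponding good events. *)
Require Import Defs.
From HB Require Import structures.
From mathcomp Require Import all_boot all_order all_algebra.
From mathcomp Require Import all_classical all_reals all_analysis.
From mathcomp Require Import measurable_realfun.
From mathcomp Require Import ring lra zify.
Import Order.TTheory GRing.Theory Num.Theory.
Import numFieldNormedType.Exports.
Set Implicit Arguments.
Unset Strict Implicit.
Unset Printing Implicit Defensive.
Local Open Scope classical_set_scope.
Local Open Scope ring_scope.

(** * Frobenius norm and the structural bound *)

(** The output [ALG] depends on arbitrary choices made for each sample and cannot be expected to be
    measurable. Hence the expectation is compared through integrals of nonnegative functions, the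
    probability bound exhibits a measurable event, and the random quantities that are really
    integrated are built from the entries of Omega by determinants and adjugates. The distributional
    facts come from the Laplace transform of one squared Gaussian, (1 + 2 th)^(-1/2), and from
    one-dimensional substitutions. Chernoff gives the tails, and 1 / q = int exp(- q x) dx the
    inverse moment; no chi-square or Wishart density appears. The 4 is a product of two 2s: f - p is
    paid on A and on T_q, and truncating the leading block instead of the compression of f(A)
    doubles this. Counting replaces the factor k of a union bound by 2 sqrt k, the origin of sqrt k
    in C_delta. Of delta, the part delta / sqrt pi is spent on |Omega1^+| and the rest on the
    conditional deviation. *)

Definition sqfrob (R : realType) (m n : nat) (M : 'M[R]_(m, n)) : R :=
  \tr (M^T *m M).

Section Frobenius.
Variable R : realType.
Implicit Types m n p : nat.

Lemma sqfrobE m n (M : 'M[R]_(m, n)) : sqfrob M = \sum_i \sum_j M i j ^+ 2.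
Proof.
rewrite /sqfrob /mxtrace exchange_big; apply: eq_bigr => j _; rewrite mxE.
by apply: eq_bigr => i _; rewrite !mxE expr2.
Qed.

Lemma sqfrob_ge0 m n (M : 'M[R]_(m, n)) : 0 <= sqfrob M.
Proof. by rewrite sqfrobE !sumr_ge0// => i _; rewrite sumr_ge0// => j _; rewrite sqr_ge0. Qed.

Lemma frobeniusE m n (M : 'M[R]_(m, n)) : frobenius M = Num.sqrt (sqfrob M).
Proof. by rewrite sqfrobE. Qed.

Lemma frobenius_ge0 m n (M : 'M[R]_(m, n)) : 0 <= frobenius M.
Proof. exact: sqrtr_ge0. Qed.

Lemma frobenius_sqr m n (M : 'M[R]_(m, n)) : frobenius M ^+ 2 = sqfrob M.
Proof. by rewrite frobeniusE sqr_sqrtr ?sqfrob_ge0. Qed.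

Lemma sqfrobT m n (M : 'M[R]_(m, n)) : sqfrob M^T = sqfrob M.
Proof. by rewrite /sqfrob trmxK mxtrace_mulC. Qed.

Lemma sqfrobN m n (M : 'M[R]_(m, n)) : sqfrob (- M) = sqfrob M.
Proof. by rewrite /sqfrob [(- M)^T]linearN /= mulNmx mulmxN opprK. Qed.

Lemma mxtrace_tmulC m n (M N : 'M[R]_(m, n)) : \tr (M^T *m N) = \tr (N^T *m M).
Proof. by rewrite -mxtrace_tr trmx_mul trmxK. Qed.

Lemma sqfrobD m n (M N : 'M[R]_(m, n)) :
  sqfrob (M + N) = sqfrob M + 2 * \tr (M^T *m N) + sqfrob N.
Proof.
rewrite /sqfrob [(M + N)^T]linearD /= mulmxDl !mulmxDr !linearD /= (mxtrace_tmulC N M); ring.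
Qed.

Lemma sqfrobZ m n (a : R) (M : 'M[R]_(m, n)) : sqfrob (a *: M) = a ^+ 2 * sqfrob M.
Proof. by rewrite /sqfrob [(a *: M)^T]linearZ /= -scalemxAl -scalemxAr !linearZ /= mulrA expr2. Qed.

Lemma sqfrobD_orth m n (M N : 'M[R]_(m, n)) : \tr (M^T *m N) = 0 ->
  sqfrob (M + N) = sqfrob M + sqfrob N.
Proof. by rewrite sqfrobD => ->; rewrite mulr0 addr0. Qed.

Lemma sqfrobD_le2 m n (M N : 'M[R]_(m, n)) :
  sqfrob (M + N) <= 2 * sqfrob M + 2 * sqfrob N.
Proof.
have := sqfrob_ge0 (M - N); rewrite sqfrobD sqfrobN mulmxN [\tr (- _)]linearN /=.
by rewrite sqfrobD; lra.
Qed.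

Lemma sqfrob_eq0 m n (M : 'M[R]_(m, n)) : sqfrob M = 0 -> M = 0.
Proof.
rewrite sqfrobE => /eqP; rewrite psumr_eq0; last first.
  by move=> i _; apply: sumr_ge0 => j _; exact: sqr_ge0.
move=> /allP h; apply/matrixP => i j; rewrite mxE.
have := h i; rewrite mem_index_enum => /(_ isT) /=.
rewrite psumr_eq0; last by move=> ? _; exact: sqr_ge0.
by move=> /allP /(_ j); rewrite mem_index_enum => /(_ isT) /=; rewrite sqrf_eq0 => /eqP.
Qed.

Lemma mxtrace_CauchySchwarz m n (M N : 'M[R]_(m, n)) :
  \tr (M^T *m N) ^+ 2 <= sqfrob M * sqfrob N.
Proof.
have [/eqP N0|N0] := eqVneq (sqfrob N) 0.
  by move/eqP/sqfrob_eq0 : N0 => ->; rewrite mulmx0 mxtrace0 expr0n /= mulr_ge0// sqfrob_ge0.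
have Np : 0 < sqfrob N by rewrite lt_neqAle eq_sym N0 sqfrob_ge0.
have := sqfrob_ge0 (M + (- (\tr (M^T *m N) / sqfrob N)) *: N).
rewrite sqfrobD sqfrobZ -scalemxAr [\tr (_ *: _)]linearZ /=.
set t := \tr _; set a := sqfrob N in N0 Np *; set b := sqfrob M => h.
have : b + 2 * (- (t / a) * t) + (- (t / a)) ^+ 2 * a = b - t ^+ 2 / a by field.
move=> e; rewrite e subr_ge0 ler_pdivrMr // in h.
Qed.

Lemma mxtrace_le_frobenius m n (M N : 'M[R]_(m, n)) :
  \tr (M^T *m N) <= frobenius M * frobenius N.
Proof.
rewrite !frobeniusE -sqrtrM ?sqfrob_ge0//; apply: (le_trans (ler_norm _)).
by rewrite -sqrtr_sqr ler_wsqrtr// mxtrace_CauchySchwarz.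
Qed.

Lemma frobeniusD m n (M N : 'M[R]_(m, n)) :
  frobenius (M + N) <= frobenius M + frobenius N.
Proof.
rewrite -(@ler_pXn2r _ 2)// ?nnegrE ?addr_ge0 ?frobenius_ge0//.
rewrite sqrrD !frobenius_sqr sqfrobD.
by have := mxtrace_le_frobenius M N; rewrite mulr2n; lra.
Qed.

Lemma frobeniusN m n (M : 'M[R]_(m, n)) : frobenius (- M) = frobenius M.
Proof. by rewrite !frobeniusE sqfrobN. Qed.

Lemma frobenius_le m n p q (M : 'M[R]_(m, n)) (N : 'M[R]_(p, q)) :
  sqfrob M <= sqfrob N -> frobenius M <= frobenius N.
Proof. by move=> h; rewrite !frobeniusE ler_wsqrtr. Qed.

Lemma sqfrob_isoL m n p (Q : 'M[R]_(m, n)) (M : 'M[R]_(n, p)) :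
  orthonormal_cols Q -> sqfrob (Q *m M) = sqfrob M.
Proof. by move=> oQ; rewrite /sqfrob trmx_mul -mulmxA (mulmxA Q^T) oQ mul1mx. Qed.

Lemma sqfrob_projD m p (P : 'M[R]_m) (M : 'M[R]_(m, p)) : P^T = P -> P *m P = P ->
  sqfrob M = sqfrob (P *m M) + sqfrob ((1%:M - P) *m M).
Proof.
move=> Ps Pi; rewrite -sqfrobD_orth; first by rewrite -mulmxDl addrC subrK mul1mx.
by rewrite trmx_mul Ps mulmxBl mul1mx mulmxBr -!mulmxA (mulmxA P P) Pi subrr mxtrace0.
Qed.

Lemma sqfrob_proj_le m p (P : 'M[R]_m) (M : 'M[R]_(m, p)) : P^T = P -> P *m P = P ->
  sqfrob (P *m M) <= sqfrob M.
Proof. by move=> Ps Pi; rewrite [leRHS](sqfrob_projD _ Ps Pi) lerDl sqfrob_ge0. Qed.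

Lemma proj_compl m (P : 'M[R]_m) : P^T = P -> P *m P = P ->
  (1%:M - P)^T = 1%:M - P /\ (1%:M - P) *m (1%:M - P) = 1%:M - P.
Proof.
move=> Ps Pi; rewrite linearB /= trmx1 Ps; split=> //.
by rewrite mulmxBl mul1mx mulmxBr mulmx1 Pi subrr subr0.
Qed.

Lemma sqfrob_coisoL m n p (Q : 'M[R]_(m, n)) (M : 'M[R]_(m, p)) :
  orthonormal_cols Q -> sqfrob (Q^T *m M) <= sqfrob M.
Proof.
move=> oQ; rewrite -(sqfrob_isoL (Q^T *m M) oQ) mulmxA; apply: sqfrob_proj_le.
  by rewrite trmx_mul trmxK.
by rewrite mulmxA -(mulmxA Q) oQ mulmx1.
Qed.

Lemma sqfrob_isoR m n p (Q : 'M[R]_(m, n)) (M : 'M[R]_(p, n)) :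
  orthonormal_cols Q -> sqfrob (M *m Q^T) = sqfrob M.
Proof. by move=> oQ; rewrite -sqfrobT trmx_mul trmxK sqfrob_isoL ?sqfrobT. Qed.

Lemma sqfrob_projR_le m p (P : 'M[R]_m) (M : 'M[R]_(p, m)) : P^T = P -> P *m P = P ->
  sqfrob (M *m P) <= sqfrob M.
Proof. by move=> Ps Pi; rewrite -sqfrobT trmx_mul Ps -(sqfrobT M) sqfrob_proj_le. Qed.

Lemma sqfrob_diag_mulL m n (a : 'rV[R]_m) (M : 'M[R]_(m, n)) (c : R) :
  (forall i, a 0 i ^+ 2 <= c) -> sqfrob (diag_mx a *m M) <= c * sqfrob M.
Proof.
move=> h; rewrite !sqfrobE mulr_sumr; apply: ler_sum => i _.
rewrite mulr_sumr; apply: ler_sum => j _; rewrite mul_diag_mx mxE exprMn.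
by rewrite ler_wpM2r// sqr_ge0.
Qed.

(** Entry [F i j] is weighted by [b j]-type weights of its row on one side and by weights of its
    column on the other, so after a transposition the comparison is entrywise. *)
Lemma sqfrob_diag_cmp k m (F : 'M[R]_(m, k)) (a : 'rV[R]_k) (b : 'rV[R]_m) :
  (forall i j, `|b 0 j| <= `|a 0 i|) ->
  sqfrob (F^T *m diag_mx b) <= sqfrob (F *m diag_mx a).
Proof.
move=> ba; rewrite -(sqfrobT (F^T *m _)) trmx_mul tr_diag_mx trmxK !sqfrobE.
apply: ler_sum => i _; apply: ler_sum => j _.
rewrite mul_diag_mx mul_mx_diag !mxE !exprMn mulrC ler_wpM2l ?sqr_ge0//.
by rewrite -(real_normK (num_real (b 0 i))) -(real_normK (num_real (a 0 j))) ler_pXn2r// nnegrE.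
Qed.

Lemma sqfrob_orthonormal m n (Q : 'M[R]_(m, n)) : orthonormal_cols Q -> sqfrob Q = n%:R.
Proof. by rewrite /sqfrob => ->; rewrite mxtrace1. Qed.

End Frobenius.

Section GramProjection.
Variable R : realType.
Variables (n k : nat) (N : 'M[R]_(n, k)).
Hypothesis N_gram : N^T *m N \in unitmx.

(** The orthogonal projection onto the column space of [N]. Its trace [k] stands for the rank in
    [eckart_young]. *)
Definition gram_proj : 'M[R]_n := N *m invmx (N^T *m N) *m N^T.

Lemma gram_projT : gram_proj^T = gram_proj.
Proof. by rewrite /gram_proj !trmx_mul trmxK trmx_inv trmx_mul trmxK mulmxA. Qed.

Lemma gram_proj_id : gram_proj *m gram_proj = gram_proj.
Proof. by rewrite /gram_proj !mulmxA -(mulmxA (_ *m _) N^T) mulmxKV. Qed.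

Lemma gram_projK : gram_proj *m N = N.
Proof. by rewrite /gram_proj -mulmxA mulmxKV. Qed.

Lemma gram_proj_tr : \tr gram_proj = k%:R.
Proof. by rewrite /gram_proj mxtrace_mulC mulmxA mulmxV// mxtrace1. Qed.

End GramProjection.

Section Structural.
Variable R : realType.
Variables (n k m : nat) (U1 : 'M[R]_(n, k)) (U2 : 'M[R]_(n, m)).
Variables (a : 'rV[R]_k) (b : 'rV[R]_m) (N : 'M[R]_(n, k)).
Hypotheses (U1o : orthonormal_cols U1) (U2o : orthonormal_cols U2).
Hypothesis U12 : U1^T *m U2 = 0.
Hypothesis U12c : U1 *m U1^T + U2 *m U2^T = 1%:M.
Hypothesis ba : forall i j, `|b 0 j| <= `|a 0 i|.
Hypothesis U1N : U1^T *m N = 1%:M.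

Let F := U2^T *m N.
Let L1 := diag_mx a.
Let L2 := diag_mx b.

(** The head component of [N] is normalized to the identity: its range is the graph of [F] over the
    head eigenspace, and [F] measures how far it leans towards the tail. *)
Lemma structural_N : N = U1 + U2 *m F.
Proof. by rewrite /F -[LHS]mul1mx -U12c mulmxDl -!mulmxA U1N mulmx1. Qed.

Lemma structural_gram : N^T *m N = 1%:M + F^T *m F.
Proof.
have U21 : U2^T *m U1 = 0 by rewrite -[RHS]trmx0 -U12 trmx_mul trmxK.
rewrite {1 2}structural_N [(_ + _)^T]linearD /= trmx_mul mulmxDl !mulmxDr U1o.
by rewrite mulmxA U12 mul0mx addr0 -mulmxA U21 mulmx0 add0r -(mulmxA F^T) (mulmxA U2^T) U2o mul1mx.
Qed.

Lemma structural_unit : N^T *m N \in unitmx.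
Proof.
rewrite -row_free_unit -kermx_eq0; apply/eqP/row_matrixP => i; rewrite row0.
have : row i (kermx (N^T *m N)) *m (N^T *m N) = 0.
  by rewrite -row_mul mulmx_ker row0.
move: (row i _) => v h.
apply/sqfrob_eq0/eqP; rewrite -sqfrobT eq_le sqfrob_ge0 andbT.
have : \tr (v *m (N^T *m N) *m v^T) = 0 by rewrite h mul0mx mxtrace0.
rewrite structural_gram mulmxDr mulmx1 mulmxDl linearD /= => e.
have -> : sqfrob v^T = - \tr (v *m (F^T *m F) *m v^T).
  by rewrite /sqfrob trmxK; apply/eqP; rewrite -addr_eq0 e.
rewrite oppr_le0 !mulmxA; have := sqfrob_ge0 (F *m v^T).
by rewrite /sqfrob trmx_mul trmxK !mulmxA.
Qed.

Let P := gram_proj N.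
Let C := 1%:M - P.
Let B := U1 *m L1 *m U1^T + U2 *m L2 *m U2^T.

(** Write P U2 L2 = N c. Idempotency of P gives |N c|^2 = <F^T L2, c>, and |c| <= |N c| since N^T N
    = 1 + F^T F. Cauchy-Schwarz then yields |N c| <= |F^T L2|, and every weight in L2 is at most
    every weight in L1. *)
Lemma tail_proj_bound : sqfrob (P *m U2 *m L2) <= sqfrob (F *m L1).
Proof.
have gu := structural_unit.
have Ps : P^T = P := gram_projT N.
have Pi : P *m P = P := gram_proj_id gu.
have [c cE] : exists c, c = invmx (N^T *m N) *m N^T *m U2 *m L2 by eexists.
have Pc : P *m U2 *m L2 = N *m c by rewrite /P /gram_proj cE !mulmxA.
have cle : sqfrob c <= sqfrob (N *m c).
  rewrite /sqfrob trmx_mul -mulmxA (mulmxA N^T) structural_gram mulmxDl mul1mx mulmxDr linearD /=.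
  by rewrite lerDl; have := sqfrob_ge0 (F *m c); rewrite /sqfrob trmx_mul -!mulmxA.
have e1 : sqfrob (N *m c) = \tr ((F^T *m L2)^T *m c).
  rewrite -Pc /sqfrob -[P *m U2 *m L2]mulmxA trmx_mul Ps -mulmxA (mulmxA P P) Pi.
  rewrite /P /gram_proj cE /F !trmx_mul !trmxK !mulmxA; done.
have CS := mxtrace_CauchySchwarz (F^T *m L2) c.
rewrite -e1 in CS.
have step : sqfrob (N *m c) <= sqfrob (F^T *m L2).
  have [z|nz] := eqVneq (sqfrob (N *m c)) 0; first by rewrite z sqfrob_ge0.
  have pos : 0 < sqfrob (N *m c) by rewrite lt_neqAle eq_sym nz sqfrob_ge0.
  rewrite -(ler_pM2r pos) -expr2 (le_trans CS)// ler_wpM2l ?sqfrob_ge0//.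
rewrite Pc; apply: (le_trans step).
exact: sqfrob_diag_cmp.
Qed.

(** The parts C B and P B C of the error are orthogonal. Since C N = 0, C U1 = - C U2 F, so |C U1
    L1| <= |F L1|. The tail part of C B is |L2|^2 - |P U2 L2|^2, and |P B C|^2 is at most 2 |C U1
    L1|^2 + 2 |P U2 L2|^2. The sum is |L2|^2 + 3 |C U1 L1|^2 + |P U2 L2|^2, where the last two norms
    are bounded by |F L1|. *)
Lemma structural_bound :
  sqfrob (B - P *m B *m P) <= sqfrob L2 + 5 * sqfrob (F *m L1).
Proof.
have gu := structural_unit.
have Ps : P^T = P := gram_projT N.
have Pi : P *m P = P := gram_proj_id gu.
have [Cs Ci] : C^T = C /\ C *m C = C := proj_compl Ps Pi.
have CN : C *m N = 0 by rewrite mulmxBl mul1mx gram_projK ?subrr.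
have split : B - P *m B *m P = C *m B + P *m B *m C.
  by rewrite /C mulmxBl mul1mx mulmxBr mulmx1 addrA subrK.
have CP : C *m P = 0 by rewrite mulmxBl mul1mx Pi subrr.
rewrite split sqfrobD_orth; last first.
  have e : C *m (P *m B *m C) = 0 by rewrite mulmxA (mulmxA C P B) CP !mul0mx.
  by rewrite trmx_mul Cs -(mulmxA B^T) e mulmx0 mxtrace0.
have CB : sqfrob (C *m B) = sqfrob (C *m U1 *m L1) + sqfrob (C *m U2 *m L2).
  rewrite /B mulmxDr sqfrobD_orth; last first.
    rewrite !trmx_mul trmxK !mulmxA mxtrace_mulC !mulmxA.
    have -> : U2^T *m U1 = 0 by rewrite -[RHS]trmx0 -U12 trmx_mul trmxK.
    by rewrite !mul0mx mxtrace0.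
  by rewrite !mulmxA !sqfrob_isoR.
have phi : sqfrob (C *m U1 *m L1) <= sqfrob (F *m L1).
  have -> : C *m U1 = - (C *m U2 *m F).
    by apply/eqP; rewrite -addr_eq0 -mulmxA -mulmxDr -structural_N CN.
  rewrite mulNmx sqfrobN -!mulmxA; apply: (le_trans (sqfrob_proj_le _ Cs Ci)).
  by rewrite sqfrob_isoL.
have beta : sqfrob L2 = sqfrob (P *m U2 *m L2) + sqfrob (C *m U2 *m L2).
  by rewrite -(sqfrob_isoL L2 U2o) (sqfrob_projD _ Ps Pi) !mulmxA.
have PBC : sqfrob (P *m B *m C) <=
    2 * sqfrob (C *m U1 *m L1) + 2 * sqfrob (P *m U2 *m L2).
  rewrite /B mulmxDr mulmxDl; apply: (le_trans (sqfrobD_le2 _ _)).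
  apply: lerD; rewrite ler_pM2l//.
    rewrite -(mulmxA P) (le_trans (sqfrob_proj_le _ Ps Pi))//.
    rewrite -!mulmxA sqfrob_isoL//.
    by rewrite -sqfrobT !trmx_mul Cs tr_diag_mx trmxK mulmxA.
  apply: (le_trans (sqfrob_projR_le _ Cs Ci)).
  by rewrite !mulmxA sqfrob_isoR.
have := tail_proj_bound; have := sqfrob_ge0 (F *m L1).
rewrite CB; move: PBC beta phi; rewrite -/L2; lra.
Qed.

End Structural.

(** * Low-rank truncation *)

Section EckartYoung.
Variable R : realType.

(* Since s is nonincreasing, moving the weights c onto the first k indices
   (comparison with the threshold value s_k) can only increase the sum. *)
Lemma sum_weights_le_head (d k : nat) (s c : 'I_d -> R) :
  (forall i, 0 <= s i) -> (forall i j : 'I_d, (i <= j)%N -> s j <= s i) ->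
  (forall i, 0 <= c i <= 1) -> \sum_i c i <= k%:R ->
  \sum_i s i * c i <= \sum_(i < d | (i < k)%N) s i.
Proof.
move=> s0 sd c01 ck; rewrite [leRHS]big_mkcond /=.
have [kd|dk] := ltnP k d; last first.
  apply: ler_sum => i _; rewrite (leq_trans (ltn_ord i) dk).
  by rewrite ler_piMr//; case/andP: (c01 i).
pose t := s (Ordinal kd).
have step i : s i * c i - (if (i < k)%N then s i else 0) <=
    t * (c i - (if (i < k)%N then 1 else 0)).
  have /andP[c0 c1] := c01 i.
  case: ifP => ik.
    have : t <= s i by apply: sd => /=; exact: ltnW.
    by move=> h; have := mulr_ge0 (_ : 0 <= s i - t) (_ : 0 <= 1 - c i); nra.
  have : s i <= t by apply: sd; rewrite leqNgt /= ik.
  by move=> h; rewrite !subr0 ler_wpM2r.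
rewrite -subr_le0 -sumrB; apply: (le_trans (ler_sum _ (fun i _ => step i))).
rewrite -mulr_sumr mulr_ge0_le0 ?s0// sumrB subr_le0 -big_mkcond /=.
by rewrite -(big_ord_widen d (fun=> 1) (ltnW kd)) sumr_const card_ord.
Qed.

(** As Z = P Z, the error |X - Z| is at least |(1 - P) X|. Moreover |P X|^2 is the sum of s_i^2 c_i
    with c_i = (U^T P U)_ii in [0, 1] of total at most k, which is largest when the weights sit on
    the first k singular values. The projection replaces a rank condition on [Z]. *)
Lemma eckart_young (d k : nat) (X Y P Z : 'M[R]_d) : svd_truncation k X Y ->
  P^T = P -> P *m P = P -> \tr P <= k%:R -> P *m Z = Z ->
  sqfrob (X - Y) <= sqfrob (X - Z).
Proof.
move=> [U [sg [V [[oU oV sg0 sgd XE] YE]]]] Ps Pi Ptr PZ.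
have oU' : U *m U^T = 1%:M by apply: mulmx1C.
have [Cs Ci] := proj_compl Ps Pi.
have -> : sqfrob (X - Y) = sqfrob X - \sum_(i < d | (i < k)%N) sg 0 i ^+ 2.
  rewrite XE YE -mulmxBl -mulmxBr !sqfrob_isoR// !sqfrob_isoL//.
  have diagE (a : 'rV[R]_d) : sqfrob (diag_mx a) = \sum_i a 0 i ^+ 2.
    rewrite sqfrobE; apply: eq_bigr => i _; rewrite (bigD1 i)//= big1 ?addr0 ?mxE ?eqxx//.
    by move=> j ji; rewrite mxE eq_sym (negbTE ji) mulr0n expr0n.
  rewrite -linearB /= !diagE.
  rewrite [\sum_(i < d | (i < k)%N) _]big_mkcond -sumrB; apply: eq_bigr => i _; rewrite !mxE.
  by case: ifP => _; rewrite ?subrr ?subr0 // expr0n.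
apply: (@le_trans _ _ (sqfrob ((1%:M - P) *m X))); last first.
  rewrite (_ : (1%:M - P) *m X = (1%:M - P) *m (X - Z)) ?sqfrob_proj_le//.
  by rewrite [RHS]mulmxBr (mulmxBl _ _ Z) mul1mx PZ subrr subr0.
rewrite [X in X - _ <= _](sqfrob_projD X Ps Pi) addrAC gerDr subr_le0.
pose c i := (U^T *m P *m U) i i.
have colE2 (M : 'M[R]_d) i : sqfrob (col i M) = (M^T *m M) i i.
  rewrite sqfrobE exchange_big big_ord1 mxE; apply: eq_bigr => j _.
  by rewrite !mxE expr2.
have cE i : c i = sqfrob (col i (P *m U)).
  by rewrite colE2 trmx_mul Ps mulmxA -(mulmxA U^T P) Pi.
have -> : sqfrob (P *m X) = \sum_i sg 0 i ^+ 2 * c i.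
  rewrite XE !mulmxA sqfrob_isoR// -sqfrobT trmx_mul tr_diag_mx sqfrobE.
  apply: eq_bigr => i _; rewrite cE sqfrobE exchange_big big_ord1 mulr_sumr.
  by apply: eq_bigr => j _; rewrite mul_diag_mx !mxE exprMn.
apply: sum_weights_le_head => [i|i j ij|i|]; first exact: sqr_ge0.
- by rewrite ler_pXn2r ?nnegrE// sgd.
- rewrite cE sqfrob_ge0 /= colE -mulmxA -colE (le_trans (sqfrob_proj_le _ Ps Pi))//.
  by rewrite colE2 oU mxE eqxx.
- by rewrite -[X in X <= _]/(\tr (U^T *m P *m U)) mxtrace_mulC mulmxA oU' mul1mx.
Qed.

(** By Pythagoras, |B - Q W Q^T|^2 is a constant plus |C - W|^2. [Y] is optimal for [X], not for the
    compression [C], and passing from one to the other and back costs |C - X| twice. This cost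
    leaves the hypotenuse with factor 1, because |C - Z| is at most |B - Q Z Q^T|. *)
Lemma truncation_error (n d k : nat) (B : 'M[R]_n) (Q : 'M[R]_(n, d))
    (X Y P Z : 'M[R]_d) : orthonormal_cols Q -> svd_truncation k X Y ->
  P^T = P -> P *m P = P -> \tr P <= k%:R -> P *m Z = Z ->
  frobenius (B - Q *m Y *m Q^T) <=
    2 * frobenius (Q^T *m B *m Q - X) + frobenius (B - Q *m Z *m Q^T).
Proof.
move=> oQ XY Ps Pi Ptr PZ; set C := Q^T *m B *m Q.
have pyth W : sqfrob (B - Q *m W *m Q^T) =
    sqfrob (B - Q *m C *m Q^T) + sqfrob (C - W).
  rewrite -(sqfrob_isoL (C - W) oQ) -(sqfrob_isoR (Q *m (C - W)) oQ).
  rewrite -sqfrobD_orth; last first.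
    have e : Q^T *m (B - Q *m C *m Q^T) *m Q = 0.
      by rewrite mulmxBr mulmxBl -/C !mulmxA oQ mul1mx -mulmxA oQ mulmx1 subrr.
    rewrite mulmxA mxtrace_mulC; set M := B - _ in e *.
    have -> : Q^T *m (M^T *m (Q *m (C - W))) = (Q^T *m M *m Q)^T *m (C - W).
      by rewrite !trmx_mul trmxK !mulmxA.
    by rewrite e trmx0 mul0mx mxtrace0.
  by rewrite mulmxBr mulmxBl addrA subrK.
have CY : frobenius (C - Y) <= 2 * frobenius (C - X) + frobenius (C - Z).
  have -> : C - Y = (C - X) + (X - Y) by rewrite addrA subrK.
  apply: (le_trans (frobeniusD _ _)); rewrite mulr_natl mulr2n -addrA lerD2l.
  apply: (le_trans (frobenius_le (eckart_young XY Ps Pi Ptr PZ))).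
  have -> : X - Z = - (C - X) + (C - Z) by rewrite opprB addrA subrK.
  by apply: (le_trans (frobeniusD _ _)); rewrite frobeniusN.
have Z0 := frobenius_ge0 (B - Q *m Z *m Q^T).
have CX0 := frobenius_ge0 (C - X).
rewrite -(@ler_pXn2r _ 2)// ?nnegrE ?frobenius_ge0 ?addr_ge0 ?mulr_ge0//.
have CZ : frobenius (C - Z) <= frobenius (B - Q *m Z *m Q^T).
  by apply: frobenius_le; rewrite pyth lerDr sqfrob_ge0.
rewrite sqrrD !frobenius_sqr (pyth Y) (pyth Z) exprMn.
have : sqfrob (C - Y) <= (2 * frobenius (C - X) + frobenius (C - Z)) ^+ 2.
  by rewrite -frobenius_sqr ler_pXn2r ?nnegrE ?frobenius_ge0 ?addr_ge0 ?mulr_ge0 ?frobenius_ge0.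
rewrite sqrrD exprMn -(frobenius_sqr (C - Z)) !mulr2n.
have := ler_wpM2l CX0 CZ; lra.
Qed.

End EckartYoung.

(** * Matrix functions and block-Lanczos *)

Section MatrixFunction.
Variable R : realType.

Lemma eigen_exp n (A U : 'M[R]_n) (lam : 'rV[R]_n) j : eigendecomposition A U lam ->
  A ^+ j = U *m diag_mx (map_mx (fun x => x ^+ j) lam) *m U^T.
Proof.
move=> [oU AE]; have oU' : U *m U^T = 1%:M by apply: mulmx1C.
elim: j => [|j IH].
  rewrite expr0 (_ : map_mx _ _ = const_mx 1) ?diag_const_mx ?mulmx1 ?oU'//.
  by apply/rowP => i; rewrite !mxE expr0.
rewrite exprS IH {1}AE -mulmxE !mulmxA -(mulmxA _ U^T U) oU mulmx1.
congr (_ *m _); rewrite -!mulmxA; congr (_ *m _); apply/matrixP => a b.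
by rewrite mul_diag_mx !mxE mulrnAr exprS.
Qed.

Lemma matfun_horner n (A U : 'M[R]_n) (lam : 'rV[R]_n) (p : {poly R}) :
  eigendecomposition A U lam ->
  matfun (horner p) U lam = \sum_(i < size p) p`_i *: A ^+ i.
Proof.
move=> AE; rewrite /matfun.
under eq_bigr do rewrite (eigen_exp _ AE) scalemxAl scalemxAr.
rewrite -mulmx_suml -mulmx_sumr; congr (_ *m _ *m _).
apply/matrixP => a b; rewrite summxE !mxE horner_coef.
under [RHS]eq_bigr do rewrite !mxE.
case: eqP => [->|_]; last by rewrite mulr0n big1 // => i _; rewrite mulr0n mulr0.
by apply: eq_bigr => i _; rewrite !mulr1n.
Qed.

Lemma matfunB n (U : 'M[R]_n) (lam : 'rV[R]_n) (f g : R -> R) :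
  matfun f U lam - matfun g U lam = matfun (fun x => f x - g x) U lam.
Proof.
rewrite /matfun -mulmxBl -mulmxBr -linearB /=; congr (_ *m diag_mx _ *m _).
by apply/rowP => i; rewrite !mxE.
Qed.

(** Only the left [Q^T] is dropped; the right [Q] is kept and contributes its Frobenius norm sqrt d.
    This is the origin of sqrt (l s). *)
Lemma frobenius_compress_matfun n d (Q : 'M[R]_(n, d)) (U : 'M[R]_n)
    (lam : 'rV[R]_n) (g : R -> R) (e : R) :
  orthonormal_cols Q -> orthonormal_cols U -> 0 <= e ->
  (forall i, `|g (lam 0 i)| <= e) ->
  frobenius (Q^T *m matfun g U lam *m Q) <= Num.sqrt d%:R * e.
Proof.
move=> oQ oU e0 ge.
have oU' : U *m U^T = 1%:M by apply: mulmx1C.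
rewrite -(ger0_norm e0) -sqrtr_sqr -sqrtrM ?ler0n// frobeniusE ler_wsqrtr//.
rewrite -mulmxA; apply: (le_trans (sqfrob_coisoL _ oQ)).
rewrite /matfun -!mulmxA sqfrob_isoL//.
apply: (le_trans (@sqfrob_diag_mulL _ _ _ _ _ (e ^+ 2) _)) => [i|].
  by rewrite mxE -(real_normK (num_real (g _))) ler_pXn2r// nnegrE.
by rewrite mulrC ler_wpM2r ?sqr_ge0// (le_trans (sqfrob_coisoL _ oU))// sqfrob_orthonormal.
Qed.

Lemma eigendecomposition_eigenvalue n (A U : 'M[R]_n) (lam : 'rV[R]_n) i :
  eigendecomposition A U lam -> eigenvalue A (lam 0 i).
Proof.
move=> [oU AE]; apply/eigenvalueP; exists (row i U^T).
  rewrite AE -!row_mul !mulmxA oU mul1mx; apply/rowP => j.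
  by rewrite mxE mul_diag_mx !mxE.
apply/eqP => /rowP h.
have : (U^T *m U) i i = 0.
  by rewrite mxE big1 // => j _; have := h j; rewrite !mxE => ->; rewrite mul0r.
by rewrite oU mxE eqxx => /eqP; rewrite oner_eq0.
Qed.

(* Rayleigh quotients of A, evaluated at the columns of Q W. *)
Lemma compressed_eigenvalue n d (A U : 'M[R]_n) (lam : 'rV[R]_n)
    (Q : 'M[R]_(n, d)) (W : 'M[R]_d) (mu : 'rV[R]_d) (a b : R) :
  eigendecomposition A U lam -> orthonormal_cols Q ->
  eigendecomposition (Q^T *m A *m Q) W mu ->
  (forall i, a <= lam 0 i <= b) -> forall i, a <= mu 0 i <= b.
Proof.
move=> [oU AE] oQ [oW TE] lab i.
have oU' : U *m U^T = 1%:M by apply: mulmx1C.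
pose x := U^T *m Q *m W.
have xx : x^T *m x = 1%:M.
  rewrite /x !trmx_mul trmxK !mulmxA -(mulmxA _ U) oU' mulmx1.
  by rewrite -(mulmxA _ Q^T) oQ mulmx1.
have xAx : x^T *m diag_mx lam *m x = diag_mx mu.
  have : W^T *m (Q^T *m A *m Q) *m W = diag_mx mu.
    by rewrite TE !mulmxA oW mul1mx -mulmxA oW mulmx1.
  by move=> <-; rewrite /x AE !trmx_mul trmxK !mulmxA.
have muE : mu 0 i = \sum_j x j i ^+ 2 * lam 0 j.
  have := congr1 (fun M : 'M[R]_d => M i i) xAx; rewrite !mxE eqxx mulr1n => <-.
  by apply: eq_bigr => j _; rewrite mul_mx_diag !mxE expr2; ring.
have sum1 : \sum_j x j i ^+ 2 = 1.
  have := congr1 (fun M : 'M[R]_d => M i i) xx; rewrite !mxE eqxx mulr1n => <-.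
  by apply: eq_bigr => j _; rewrite !mxE expr2.
rewrite muE -[a]mul1r -[b]mul1r -sum1 !mulr_suml; apply/andP.
by split; apply: ler_sum => j _; rewrite ler_wpM2l ?sqr_ge0//; case/andP: (lab j).
Qed.

End MatrixFunction.

(** * Krylov spaces and the exactness of block-Lanczos *)

Section Krylov.
Variable R : realType.

Lemma range_proj n d p (Q : 'M[R]_(n, d)) (M : 'M[R]_(n, p)) :
  orthonormal_cols Q -> (M^T <= Q^T)%MS -> Q *m (Q^T *m M) = M.
Proof.
move=> oQ /submxP[D MD]; have -> : M = Q *m D^T.
  by rewrite -[M]trmxK MD trmx_mul trmxK.
by rewrite (mulmxA Q^T) oQ mul1mx.
Qed.

Lemma krylov_sub n l (A : 'M[R]_n) (Om : 'M[R]_(n, l)) i j : (j < i)%N ->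
  ((A ^+ j *m Om)^T <= (krylov_mx A Om i)^T)%MS.
Proof.
move=> ji; rewrite /krylov_mx tr_mxrow eqmx_col.
by rewrite (sumsmx_sup (Ordinal ji))// genmxE.
Qed.

Lemma krylov_sub_gen n l p (A : 'M[R]_n) (Om : 'M[R]_(n, l)) i (X : 'M[R]_(p, n)) :
  (forall j, (j < i)%N -> ((A ^+ j *m Om)^T <= X)%MS) ->
  ((krylov_mx A Om i)^T <= X)%MS.
Proof.
move=> h; rewrite /krylov_mx tr_mxrow eqmx_col; apply/sumsmx_subP => j _.
by rewrite genmxE h.
Qed.

Lemma krylov_shift n l p (A : 'M[R]_n) (Om : 'M[R]_(n, l)) i j (M : 'M[R]_(n, p)) :
  (M^T <= (krylov_mx A Om i)^T)%MS ->
  ((A ^+ j *m M)^T <= (krylov_mx A Om (i + j))^T)%MS.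
Proof.
move=> h; rewrite trmx_mul.
apply: (submx_trans (submxMr _ h)).
rewrite -trmx_mul /krylov_mx mul_mxrow tr_mxrow eqmx_col.
apply/sumsmx_subP => a _; rewrite genmxE mulmxA mulmxE -exprD (addnC j).
by apply: krylov_sub; rewrite ltn_add2r.
Qed.

End Krylov.

Section Lanczos.
Variable R : realType.
Variables (n l s r : nat) (A : 'M[R]_n) (Om : 'M[R]_(n, l)).
Variables (w : nat -> nat) (V : forall j, 'M[R]_(n, w j)).
Hypothesis s_ge1 : (1 <= s)%N.
Hypothesis lanczos : block_lanczos A Om (s + r) V.

Let Qs := lanczos_basis V s.
Let Qq := lanczos_basis V (s + r).
Let T := Qq^T *m A *m Qq.
Let E : 'M[R]_(_, _) := mxsub id (widen_ord (leq_sum_widths w s r)) 1%:M.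

(** The blocks coincide; what has to be matched is the flattened index of a column of block i,
    computed in a sum of s widths and in a sum of s + r widths. *)
Lemma lanczos_basis_prefix : Qs = Qq *m E.
Proof.
rewrite /E mulmx_colsub mulmx1; apply/mxrowP => i; rewrite mxrowK.
apply/matrixP => a b; rewrite /submxrow mxE [RHS]mxE.
have -> : widen_ord (leq_sum_widths w s r) (tagnat.Rank i b) =
  @tagnat.Rank _ (fun j : 'I_(s + r) => w j) (lshift r i) b.
  apply/val_inj; apply: (etrans (tagnat.RankEsum b)).
  apply/esym; apply: (etrans (@tagnat.RankEsum _ (fun j : 'I_(s + r) => w j) _ _)).
  congr (_ + _)%N; apply/esym.
  rewrite -(big_ord_widen _ w) ?(ltnW (ltn_ord i))//.
  by rewrite -(big_ord_widen _ w) // ltnW// (leq_trans (ltn_ord i)) ?leq_addr.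
have := mxrowK (fun j : 'I_(s + r) => V j) (lshift r i).
by move/matrixP/(_ a b) => <-; rewrite /submxrow mxE.
Qed.

Let s_range : (1 <= s <= s + r)%N.
Proof. by rewrite s_ge1 leq_addr. Qed.
Let q_range : (1 <= s + r <= s + r)%N.
Proof. by rewrite leqnn andbT addn_gt0 s_ge1. Qed.

Lemma lanczos_Qs_orth : orthonormal_cols Qs.
Proof. by case: (lanczos s_range). Qed.

Lemma lanczos_Qq_orth : orthonormal_cols Qq.
Proof. by case: (lanczos q_range). Qed.

Lemma lanczos_prefix_orth : orthonormal_cols E.
Proof.
have := lanczos_Qs_orth; rewrite lanczos_basis_prefix /orthonormal_cols trmx_mul.
by rewrite -mulmxA (mulmxA Qq^T) lanczos_Qq_orth mul1mx.
Qed.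

Lemma leading_submxE (M : 'M[R]_(\sum_(j < s + r) w j)) :
  leading_submx (leq_sum_widths w s r) M = E^T *m M *m E.
Proof.
by rewrite /E mulmx_colsub mulmx1 trmx_mxsub trmx1 mul_rowsub_mx mul1mx; apply/matrixP => i j; rewrite !mxE.
Qed.

Lemma lanczos_range (p : nat) (M : 'M[R]_(n, p)) :
  (M^T <= (krylov_mx A Om s)^T)%MS -> Qs *m (Qs^T *m M) = M.
Proof.
move=> h; apply: range_proj; first exact: lanczos_Qs_orth.
by case: (lanczos s_range) => _ /eqmxP eq; rewrite eq.
Qed.

(** Orthonormal columns are as many as their rank, which is that of the Krylov matrix with its l s
    columns. *)
Lemma lanczos_width : (\sum_(j < s) w j <= l * s)%N.
Proof.
have [oQ /eqmxP eq] := lanczos s_range.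
have : \rank Qs^T = (\sum_(j < s) w j)%N.
  apply/eqP; rewrite eqn_leq rank_leq_row -{1}(mxrank1 R (\sum_(j < s) w j)).
  by rewrite -oQ mxrankM_maxl.
rewrite eq => <-; apply: (leq_trans (rank_leq_row _)).
by rewrite sum_nat_const card_ord mulnC.
Qed.

(** For j <= r the range of A^j Qs stays in K_(s+r), where Qq Qq^T acts as the identity; it can
    therefore be inserted after every factor A, which turns A into T. *)
Lemma lanczos_pow j : (j <= r)%N -> A ^+ j *m Qs = Qq *m (T ^+ j *m E).
Proof.
elim: j => [|j IH] jr; first by rewrite !expr0 !mul1mx lanczos_basis_prefix.
have sub : (((A ^+ j.+1) *m Qs)^T <= Qq^T)%MS.
  case: (lanczos q_range) => _ /eqmxP ->.
  have h : (Qs^T <= (krylov_mx A Om s)^T)%MS.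
    by case: (lanczos s_range) => _ /eqmxP ->.
  apply: (submx_trans (krylov_shift j.+1 h)); apply: krylov_sub_gen => a aj.
  by apply: krylov_sub; rewrite (leq_trans aj)// leq_add2l.
rewrite -(range_proj lanczos_Qq_orth sub); congr (_ *m _).
by rewrite exprS -mulmxE -!mulmxA IH ?(ltnW jr)// exprS -mulmxE /T !mulmxA.
Qed.

Hypothesis A_sym : A^T = A.

(** A power j >= 1 is split as a + 1 + b with a, b <= r. The outer powers are transported by
    [lanczos_pow], one of them through symmetry, and the middle A, between Qq^T and Qq, is T by
    definition: this gains the 1 in 2 r + 1. *)
Lemma lanczos_moment j : (j <= 2 * r + 1)%N ->
  Qs^T *m A ^+ j *m Qs = E^T *m T ^+ j *m E.
Proof.
have AjT i : (A ^+ i)^T = A ^+ i.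
  elim: i => [|i IH]; first by rewrite expr0 trmx1.
  by rewrite [in LHS]exprS -mulmxE trmx_mul IH A_sym mulmxE -exprSr.
have TjT i : (T ^+ i)^T = T ^+ i.
  have TT : T^T = T by rewrite /T !trmx_mul trmxK A_sym mulmxA.
  elim: i => [|i IH]; first by rewrite expr0 trmx1.
  by rewrite [in LHS]exprS -mulmxE trmx_mul IH TT mulmxE -exprSr.
have half i : (i <= r)%N -> Qs^T *m A ^+ i = E^T *m T ^+ i *m Qq^T.
  move=> ir; rewrite -[LHS]trmxK trmx_mul trmxK AjT lanczos_pow//.
  by rewrite !trmx_mul TjT.
case: j => [_|j jr].
  rewrite !expr0 !mulmx1 lanczos_Qs_orth lanczos_prefix_orth//.
have j2 : (j./2 <= r)%N.
  by rewrite -(doubleK r) half_leq// -mul2n; move: jr; rewrite addn1 ltnS.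
have jh : j = (j./2 + (odd j + j./2))%N.
  by rewrite addnCA addnn odd_double_half.
have j2' : (odd j + j./2 <= r)%N.
  by move: jr (odd_double_half j); rewrite -mul2n; case: (odd j) => /=; rewrite ?add1n ?add0n; lia.
have -> : j.+1 = (j./2 + 1 + (odd j + j./2))%N by rewrite addnAC -jh addn1.
clear jh.
move: (odd j + j./2)%N j2' => b br.
rewrite !exprD !expr1 -!mulmxE -!mulmxA lanczos_pow// (mulmxA Qs^T) half//.
by rewrite /T !mulmxA.
Qed.

End Lanczos.

(** * The deterministic error bound *)

Section HeadTail.
Variable R : realType.
Variables (n k : nat) (le_kn : (k <= n)%N).

Definition tail_ord (j : 'I_(n - k)) : 'I_n := cast_ord (subnKC le_kn) (rshift k j).

Definition head_cols m (U : 'M[R]_(m, n)) : 'M[R]_(m, k) := mxsub id (widen_ord le_kn) U.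
Definition tail_cols m (U : 'M[R]_(m, n)) : 'M[R]_(m, n - k) := mxsub id tail_ord U.

Lemma sum_head_tail (F : 'I_n -> R) :
  \sum_i F i = \sum_(i < k) F (widen_ord le_kn i) + \sum_(j < n - k) F (tail_ord j).
Proof.
rewrite (reindex (cast_ord (subnKC le_kn))) /=; last first.
  by apply: onW_bij; exists (cast_ord (esym (subnKC le_kn))) => x; rewrite ?cast_ordK ?cast_ordKV.
rewrite big_split_ord /=; congr (_ + _); apply: eq_bigr => i _.
by congr F; apply/val_inj.
Qed.

Variables (U : 'M[R]_n) (lam : 'rV[R]_n).
Hypothesis U_orth : orthonormal_cols U.

Lemma matfun_head_tail (g : R -> R) : matfun g U lam =
  head_cols U *m diag_mx (map_mx g (eigs_head le_kn lam)) *m (head_cols U)^T +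
  tail_cols U *m diag_mx (map_mx g (eigs_tail le_kn lam)) *m (tail_cols U)^T.
Proof.
apply/matrixP => i j; rewrite /matfun !mxE sum_head_tail.
by congr (_ + _); apply: eq_bigr => a _; rewrite !mul_mx_diag !mxE.
Qed.

Lemma head_orth : orthonormal_cols (head_cols U).
Proof.
apply/matrixP => i j; rewrite /head_cols trmx_mxsub -mxsub_mul U_orth !mxE.
by congr (_ %:R); congr nat_of_bool; apply/eqP/eqP => [|->//] /(congr1 val) /= h; apply/val_inj.
Qed.

Lemma tail_orth : orthonormal_cols (tail_cols U).
Proof.
apply/matrixP => i j; rewrite /tail_cols trmx_mxsub -mxsub_mul U_orth !mxE.
congr (_ %:R); congr nat_of_bool; apply/eqP/eqP => [|->//] /(congr1 val) /= h; apply/val_inj.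
exact: addnI h.
Qed.

Lemma head_tail_orth : (head_cols U)^T *m tail_cols U = 0.
Proof.
apply/matrixP => i j; rewrite /tail_cols /head_cols trmx_mxsub -mxsub_mul U_orth !mxE.
rewrite (_ : (_ == _) = false)//; apply/eqP => /(congr1 val) /= h.
by have := ltn_ord i; rewrite h ltnNge leq_addr.
Qed.

Lemma head_tail_complete :
  head_cols U *m (head_cols U)^T + tail_cols U *m (tail_cols U)^T = 1%:M.
Proof.
rewrite -(mulmx1C U_orth); apply/matrixP => i j; rewrite !mxE sum_head_tail.
by congr (_ + _); apply: eq_bigr => a _; rewrite !mxE.
Qed.

Lemma head_matfun (g : R -> R) : (head_cols U)^T *m matfun g U lam =
  diag_mx (map_mx g (eigs_head le_kn lam)) *m (head_cols U)^T.
Proof.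
by rewrite matfun_head_tail mulmxDr !mulmxA head_orth head_tail_orth mul1mx !mul0mx addr0.
Qed.

Lemma tail_matfun (g : R -> R) : (tail_cols U)^T *m matfun g U lam =
  diag_mx (map_mx g (eigs_tail le_kn lam)) *m (tail_cols U)^T.
Proof.
have e : (tail_cols U)^T *m head_cols U = 0.
  by rewrite -[LHS]trmxK trmx_mul trmxK head_tail_orth trmx0.
by rewrite matfun_head_tail mulmxDr !mulmxA tail_orth e mul1mx !mul0mx add0r.
Qed.

End HeadTail.

Section Deterministic.
Variable R : realType.
Variables (n k l s r : nat) (le_kn : (k <= n)%N) (s_ge1 : (1 <= s)%N).
Variables (A : 'M[R]_n) (A_sym : A^T = A) (f : R -> R).
Variables (U : 'M[R]_n) (lam : 'rV[R]_n) (A_eig : eigendecomposition A U lam).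
Hypothesis lam_sorted : forall i j : 'I_n,
     (i <= j)%N -> `|f (lam 0 j)| <= `|f (lam 0 i)|.
Variables (Om : 'M[R]_(n, l)).

Let Om1 := (head_cols le_kn U)^T *m Om.
Let Om2 := (tail_cols le_kn U)^T *m Om.

(* The Moore-Penrose inverse when M has independent rows. *)
Definition right_pinv m p (M : 'M[R]_(m, p)) : 'M[R]_(p, m) :=
  M^T *m invmx (M *m M^T).

Definition sketch_error (g : R -> R) : R :=
  sqfrob (diag_mx (map_mx g (eigs_tail le_kn lam)) *m Om2 *m right_pinv Om1).

Definition head_ratio (g : {poly R}) : R :=
  \big[Num.max/0]_(i < k)
    `|f (eigs_head le_kn lam 0 i) / g.[eigs_head le_kn lam 0 i]| ^+ 2.

Lemma tail_normE (g : R -> R) :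
  tail_norm le_kn lam g ^+ 2 = sqfrob (diag_mx (map_mx g (eigs_tail le_kn lam))).
Proof. by rewrite /tail_norm frobenius_sqr. Qed.

(** The contributions of [p] on both sides cancel by [lanczos_moment]. What remains is f - p on A
    and on T, whose eigenvalues lie in the same interval; each costs sqrt (l s) e. *)
Lemma compression_error (e : R) (p : {poly R}) (w : nat -> nat)
    (V : forall j, 'M[R]_(n, w j)) W mu (a b : R) :
  block_lanczos A Om (s + r) V ->
  let Qs := lanczos_basis V s in
  let Qq := lanczos_basis V (s + r) in
  eigendecomposition (Qq^T *m A *m Qq) W mu ->
  (size p <= (2 * r + 1).+1)%N -> 0 <= e ->
  (forall i, a <= lam 0 i <= b) ->
  (forall x, a <= x <= b -> `|f x - p.[x]| <= e) ->
  frobenius (Qs^T *m matfun f U lam *m Qs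
             - leading_submx (leq_sum_widths w s r) (matfun f W mu)) <=
  2 * Num.sqrt (l * s)%:R * e.
Proof.
move=> lan Qs Qq Teig sp e0 lamab fp; set lead := leading_submx _.
have oQs := lanczos_Qs_orth s_ge1 lan; have oQq := lanczos_Qq_orth s_ge1 lan.
have oE := lanczos_prefix_orth s_ge1 lan.
have leadE := leading_submxE.
have hp : Qs^T *m matfun (horner p) U lam *m Qs = lead (matfun (horner p) W mu).
  rewrite /lead leadE (matfun_horner _ A_eig) (matfun_horner _ Teig).
  rewrite !mulmx_sumr !mulmx_suml; apply: eq_bigr => i _.
  rewrite -!scalemxAr -!scalemxAl; congr (_ *: _).
  apply: (lanczos_moment s_ge1 lan A_sym); rewrite -ltnS.
  exact: leq_trans (ltn_ord i) sp.
have -> : Qs^T *m matfun f U lam *m Qs - lead (matfun f W mu) =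
   Qs^T *m matfun (fun x => f x - p.[x]) U lam *m Qs
   - lead (matfun (fun x => f x - p.[x]) W mu).
  rewrite -!matfunB /lead !leadE !mulmxBr !mulmxBl -!leadE -/lead hp.
  by rewrite opprB addrA subrK.
apply: (le_trans (frobeniusD _ _)); rewrite frobeniusN -mulrA mulr_natl mulr2n.
have wle : Num.sqrt (\sum_(j < s) w j)%:R * e <= Num.sqrt (l * s)%:R * e.
  by rewrite ler_wpM2r// ler_wsqrtr// ler_nat (lanczos_width s_ge1 lan).
apply: lerD; apply: le_trans wle.
  by apply: frobenius_compress_matfun => // [|i]; [exact: (proj1 A_eig)|exact: fp].
rewrite /lead leadE; apply: frobenius_compress_matfun => // [|i]; first exact: (proj1 Teig).
by apply: fp; apply: (compressed_eigenvalue A_eig oQq Teig lamab).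
Qed.

Lemma head_ratio_ge (g : {poly R}) i :
  (f (eigs_head le_kn lam 0 i) / g.[eigs_head le_kn lam 0 i]) ^+ 2 <= head_ratio g.
Proof.
rewrite -(real_normK (num_real (_ / _))) /head_ratio.
by rewrite (le_bigmax_cond _ (fun i => `|f (eigs_head le_kn lam 0 i) / g.[eigs_head le_kn lam 0 i]| ^+ 2)).
Qed.

Lemma deterministic_bound (B : 'M[R]_n) (e : R) (p g : {poly R}) (a b : R) :
  alg_output A f s r k Om B ->
  (size p <= (2 * r + 1).+1)%N -> 0 <= e ->
  (forall i, a <= lam 0 i <= b) ->
  (forall x, a <= x <= b -> `|f x - p.[x]| <= e) ->
  (size g <= s)%N -> (forall i, g.[eigs_head le_kn lam 0 i] != 0) ->
  Om1 *m Om1^T \in unitmx ->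
  frobenius (matfun f U lam - B) <=
    4 * Num.sqrt (l * s)%:R * e +
    Num.sqrt (tail_norm le_kn lam f ^+ 2 + 5 * (sketch_error (horner g) * head_ratio g)).
Proof.
move=> [w [V [lan [W [mu [Teig [Y [svdY ->]]]]]]]] sp e0 lamab fp sg g0 Wu.
set Qs := lanczos_basis V s in svdY *.
have oQs : orthonormal_cols Qs := lanczos_Qs_orth s_ge1 lan.
have oU : orthonormal_cols U := proj1 A_eig.
set U1 := head_cols le_kn U; set U2 := tail_cols le_kn U.
pose Lg := \row_i (g.[eigs_head le_kn lam 0 i])^-1.
pose D1 := diag_mx (map_mx (horner g) (eigs_head le_kn lam)).
pose D2 := diag_mx (map_mx (horner g) (eigs_tail le_kn lam)).
have [FG FGE] : exists FG, FG = matfun (horner g) U lam by eexists.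
have FG1 : U1^T *m FG = D1 *m U1^T by rewrite FGE head_matfun.
have FG2 : U2^T *m FG = D2 *m U2^T by rewrite FGE tail_matfun.
have [X XE] : exists X, X = right_pinv Om1 by eexists.
have O1X : U1^T *m Om *m X = 1%:M by rewrite XE /right_pinv mulmxA mulmxV.
(* Dividing by the values of [g] on the right makes the head component of [N] the identity, as
   [structural_bound] requires, and does not enlarge its range. *)
have [N NE] : exists N, N = FG *m Om *m X *m diag_mx Lg by eexists.
have ggV : D1 *m diag_mx Lg = 1%:M.
  apply/matrixP => i j; rewrite mul_diag_mx !mxE.
  by case: eqP => [->|_]; rewrite ?mulr0// !mulr1n mulfV//; have := g0 j; rewrite mxE.
have U1N : U1^T *m N = 1%:M.
  by rewrite NE !mulmxA FG1 -!mulmxA (mulmxA Om) (mulmxA U1^T) (mulmxA U1^T) O1X mul1mx ggV.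
have FL : U2^T *m N *m diag_mx (map_mx f (eigs_head le_kn lam)) =
   (D2 *m Om2 *m right_pinv Om1)
    *m diag_mx (\row_i (f (eigs_head le_kn lam 0 i) / g.[eigs_head le_kn lam 0 i])).
  rewrite -XE NE !mulmxA FG2 -(mulmxA D2) -/Om2 -[LHS]mulmxA; congr (_ *m _).
  apply/matrixP => i j; rewrite mul_diag_mx !mxE.
  by case: eqP => [->|_]; rewrite ?mulr0// !mulr1n mulrC.
have Nrange : Qs *m (Qs^T *m N) = N.
  apply: (lanczos_range s_ge1 lan); rewrite NE FGE (matfun_horner _ A_eig).
  rewrite -!mulmxA (mulmxA _ Om) trmx_mul; apply: (submx_trans (submxMl _ _)).
  rewrite mulmx_suml raddf_sum /=; apply: summx_sub => i _.
  rewrite -scalemxAl linearZ /=; apply: scalemx_sub; apply: krylov_sub.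
  exact: leq_trans (ltn_ord i) sg.
have sorted i j : `|map_mx f (eigs_tail le_kn lam) 0 j| <= `|map_mx f (eigs_head le_kn lam) 0 i|.
  rewrite !mxE; apply: lam_sorted => /=.
  by rewrite (leq_trans (ltnW (ltn_ord i)))// leq_addr.
have NNu : N^T *m N \in unitmx.
  by apply: (structural_unit (head_orth _ oU) (tail_orth _ oU) (head_tail_orth _ oU) (head_tail_complete _ oU)).
have sb := structural_bound (head_orth _ oU) (tail_orth _ oU) (head_tail_orth _ oU)
  (head_tail_complete _ oU) sorted U1N.
rewrite -matfun_head_tail FL in sb.
(* The competitor of the truncated SVD must be written in the coordinates of [Qs]: [N'] holds those
   of [N], and the projection onto the range of [N] is Qs P' Qs^T. *)
pose N' := Qs^T *m N.
have NN' : N'^T *m N' = N^T *m N.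
  by rewrite /N' trmx_mul trmxK -mulmxA Nrange.
have NNu' : N'^T *m N' \in unitmx by rewrite NN'.
pose P' := gram_proj N'.
have PE : gram_proj N = Qs *m P' *m Qs^T.
  by rewrite /P' /gram_proj NN' -{1 4}Nrange -/N' trmx_mul !mulmxA.
pose Z := P' *m (Qs^T *m matfun f U lam *m Qs) *m P'.
have trunc := truncation_error (matfun f U lam) oQs svdY (gram_projT N')
  (gram_proj_id NNu') (_ : \tr _ <= k%:R) (_ : P' *m Z = Z).
have := trunc _ _; rewrite (gram_proj_tr NNu') lexx => /(_ isT) {}trunc.
apply: (le_trans (trunc _)).
  by rewrite /Z 2!(mulmxA P') (gram_proj_id NNu' : P' *m P' = P').
have ce := compression_error lan Teig sp e0 lamab fp.
apply: lerD.
  (* One 2 comes from [truncation_error], the other from [compression_error]. *)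
  by rewrite (_ : 4 = 2 * 2) ?[in RHS]mulrA -?mulrA ?ler_pM2l ?mulrA// -natrM.
rewrite frobeniusE ler_wsqrtr// tail_normE.
have -> : Qs *m Z *m Qs^T = gram_proj N *m matfun f U lam *m gram_proj N.
  by rewrite PE /Z !mulmxA.
apply: (le_trans sb); rewrite lerD2l ler_pM2l// -sqfrobT trmx_mul tr_diag_mx.
rewrite /sketch_error -(sqfrobT (_ *m right_pinv _)) mulrC; apply: sqfrob_diag_mulL => i.
by rewrite mxE head_ratio_ge.
Qed.

End Deterministic.

(** * Gaussian integrals *)

Section IntegralTools.
Local Open Scope ereal_scope.

Definition image_measure d d' (T : measurableType d) (T' : measurableType d')
    (R : realType) (mu : {measure set T -> \bar R}) (phi : T -> T')
    (mphi : measurable_fun setT phi) : {measure set T' -> \bar R} :=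
  measure_function_pushforward__canonical__measure_function_Measure mu mphi.

Lemma ge0_integral_image d d' (T : measurableType d) (T' : measurableType d')
    (R : realType) (mu : {measure set T -> \bar R}) (phi : T -> T')
    (mphi : measurable_fun setT phi) (f : T' -> \bar R) :
  measurable_fun setT f -> (forall x, 0 <= f x) ->
  \int[image_measure mu mphi]_x f x = \int[mu]_x f (phi x).
Proof.
by move=> mf f0; rewrite (@ge0_integral_pushforward _ _ _ _ _ _ mphi mu setT f).
Qed.

(* No measurability: the integral of a nonnegative function is a supremum over
   the simple functions below it. *)
Lemma ge0_le_lower_integral d (T : measurableType d) (R : realType)
    (mu : {measure set T -> \bar R}) (f g : T -> \bar R) :
  (forall x, 0 <= f x) -> (forall x, f x <= g x) ->
  \int[mu]_x f x <= \int[mu]_x g x.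
Proof.
move=> f0 fg; have g0 x : 0 <= g x := le_trans (f0 x) (fg x).
rewrite !ge0_integralTE//; apply: ge_ereal_sup => _ [h /= hf <-].
by apply: ereal_sup_ubound; exists h => //= x; exact: le_trans (hf x) (fg x).
Qed.

Lemma probability_integral_cst d (T : measurableType d) (R : realType)
    (P : probability T R) (c : \bar R) : \int[P]_x c = c.
Proof. by rewrite integral_cst// [X in _ * X]probability_setT mule1. Qed.

Lemma measurable_prod_pred d (T : measurableType d) (R : realType) (I : finType)
    (A : {pred I}) (h : I -> T -> R) :
  (forall i, measurable_fun setT (h i)) ->
  measurable_fun setT (fun x => \prod_(i in A) h i x)%R.
Proof.
move=> mh; have -> : (fun x => \prod_(i in A) h i x)%R =
    (fun x => \prod_(i <- [seq i <- index_enum I | i \in A]) h i x)%R.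
  by apply/funext => x; rewrite big_filter.
by apply: measurable_prod => i _.
Qed.

Lemma ge0_integral_le_cst d (T : measurableType d) (R : realType)
    (P : probability T R) (f : T -> \bar R) (c : \bar R) :
  (forall x, 0 <= f x) -> (forall x, f x <= c) -> \int[P]_x f x <= c.
Proof.
move=> f0 fc; apply: (le_trans (ge0_le_lower_integral P f0 fc)).
by rewrite probability_integral_cst.
Qed.

Import HBNNSimple.

(** The measure is given by integrating its density over sets, which is the claim for indicators;
    simple functions follow by linearity and the rest by monotone convergence. *)
Lemma integral_normal_probE (R : realType) (f : measurableTypeR R -> \bar R) :
  measurable_fun setT f -> (forall x, 0 <= f x) ->
  \int[normal_prob 0%R 1%R]_x f x =
  \int[lebesgue_measure]_x (f x * (normal_pdf 0%R 1%R x)%:E).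
Proof.
move=> mf f0.
pose ph x := (normal_pdf 0%R 1%R x : R)%:E.
have mph : measurable_fun setT ph by apply/measurable_EFinP; exact: measurable_normal_pdf.
have ph0 x : 0 <= ph x by rewrite lee_fin normal_pdf_ge0.
have ind E : measurable E -> \int[normal_prob 0%R 1%R]_x (\1_E x)%:E =
    \int[lebesgue_measure]_x ((\1_E x)%:E * ph x).
  move=> mE; rewrite integral_indic// setIT -[LHS]/(normal_prob 0%R 1%R E) /normal_prob [LHS]integral_mkcond.
  apply: eq_integral => x _; rewrite patchE indicE /ph.
  by case: ifP => _; rewrite ?mul1e ?mul0e.
pose h := nnsfun_approx measurableT mf.
have simple n : \int[normal_prob 0%R 1%R]_x (h n x)%:E =
    \int[lebesgue_measure]_x ((h n x)%:E * ph x).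
  transitivity (\sum_(k \in range (h n)) k%:E * \int[normal_prob 0%R 1%R]_x (\1_(h n @^-1` [set k]) x)%:E).
    under eq_integral do rewrite fimfunE -fsumEFin//.
    rewrite ge0_integral_fsum//.
    - by apply: eq_fsbigr => k _; rewrite integralZl_indic_nnsfun.
    - by move=> k; apply/measurable_EFinP/measurable_funM.
    - by move=> k x _; rewrite nnfun_muleindic_ge0.
  transitivity (\sum_(k \in range (h n)) \int[lebesgue_measure]_x (k%:E * (\1_(h n @^-1` [set k]) x)%:E * ph x)).
    apply: eq_fsbigr => k; rewrite inE => -[y _ <-]; rewrite ind//.
    rewrite -ge0_integralZl//; first by apply: eq_integral => x _; rewrite muleA.
    - by apply: emeasurable_funM => //; exact/measurable_EFinP/measurable_indic.
    - by move=> x _; rewrite mule_ge0// lee_fin.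
    - by rewrite lee_fin.
  rewrite -ge0_integral_fsum//.
  - apply: eq_integral => x _; rewrite fimfunE -fsumEFin// ge0_mule_fsuml//.
    by move=> k; rewrite nnfun_muleindic_ge0.
  - move=> k; apply: emeasurable_funM => //.
    by apply/measurable_EFinP/measurable_funM.
  - by move=> k x _; rewrite mule_ge0// nnfun_muleindic_ge0.
transitivity (limn (fun n => \int[normal_prob 0%R 1%R]_x (h n x)%:E)).
  rewrite -monotone_convergence//.
  - by apply: eq_integral => x _; apply/esym/cvg_lim => //; exact: cvg_nnsfun_approx.
  - by move=> n; exact/measurable_EFinP.
  - by move=> n x _; rewrite lee_fin.
  - by move=> x _ a b ab; rewrite lee_fin; exact/lefP/nd_nnsfun_approx.
under eq_fun do rewrite simple.
rewrite -monotone_convergence//.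
- apply: eq_integral => x _; rewrite -/(ph x).
  apply/cvg_lim => //; apply: cvgeZr => //; exact: cvg_nnsfun_approx.
- by move=> n; apply: emeasurable_funM => //; exact/measurable_EFinP.
- by move=> n x _; rewrite mule_ge0// lee_fin.
- by move=> x _ a b ab; apply: lee_wpmul2r => //; rewrite lee_fin; exact/lefP/nd_nnsfun_approx.
Qed.

End IntegralTools.

(** * Affine substitutions and plane rotations of the Gaussian density *)

Section LebesgueAffine.
Local Open Scope ereal_scope.
Variable R : realType.
Local Notation mu := (@lebesgue_measure R).

(** The right-hand side is a measure in A that gives half-open intervals their length, and this
    characterizes Lebesgue measure. *)
Lemma lebesgue_measure_affine (a b : R) (A : set (measurableTypeR R)) : a != 0%R -> measurable A ->
  mu A = `|a|%:E * mu ((fun x => a * x + b)%R @^-1` A).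
Proof.
move=> a0 mA.
have mf : measurable_fun setT (fun x : measurableTypeR R => (a * x + b)%R : measurableTypeR R).
  by apply: measurable_funD => //; exact: measurable_funM.
pose m : {measure set (measurableTypeR R) -> \bar R} := mscale (NngNum (normr_ge0 a)) (image_measure mu mf).
transitivity (m A); last by [].
apply: (@lebesgue_measure_unique R m) => //= _ [[c d]] _ <-.
rewrite /m /mscale /pushforward /= lebesgue_measure_itv /=.
have [a_gt0|a_lt0|/eqP] := ltgtP a 0%R; last by rewrite (negbTE a0).
(* This is the case of a negative [a]: the preimage of ]c, d] is reversed and closed at its left
   end. *)
- rewrite [X in _ = _ * lebesgue_measure X](_ : _ = [set` `[(d - b) / a, (c - b) / a[]%R); last first.
    apply/seteqP; split => x /=; rewrite !in_itv /= => /andP[h1 h2]; apply/andP; split.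
    + by rewrite ler_ndivrMr// lerBrDr mulrC.
    + by rewrite ltr_ndivlMr// ltrBlDr mulrC.
    + by move: h2; rewrite ltr_ndivlMr// ltrBlDr mulrC.
    + by move: h1; rewrite ler_ndivrMr// lerBrDr mulrC.
  rewrite lebesgue_measure_itv /= !lte_fin ltr_nM2r ?invr_lt0// ltrD2r.
  case: ifP => _; last by rewrite mule0.
  by rewrite -!EFinB -EFinM ltr0_norm//; congr EFin; field.
- rewrite [X in _ = _ * lebesgue_measure X](_ : _ = [set` `](c - b) / a, (d - b) / a]]%R); last first.
    apply/seteqP; split => x /=; rewrite !in_itv /= => /andP[h1 h2]; apply/andP; split.
    + by rewrite ltr_pdivrMr// ltrBlDr mulrC.
    + by rewrite ler_pdivlMr// lerBrDr mulrC.
    + by move: h1; rewrite ltr_pdivrMr// ltrBlDr mulrC.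
    + by move: h2; rewrite ler_pdivlMr// lerBrDr mulrC.
  rewrite lebesgue_measure_itv /= !lte_fin ltr_pM2r ?invr_gt0// ltrD2r.
  case: ifP => _; last by rewrite mule0.
  by rewrite -!EFinB -EFinM gtr0_norm//; congr EFin; field.
Qed.

Lemma ge0_integral_affine (a b : R) (f : measurableTypeR R -> \bar R) : a != 0%R ->
  measurable_fun setT f -> (forall x, 0 <= f x) ->
  \int[mu]_x f x = `|a|%:E * \int[mu]_x f (a * x + b)%R.
Proof.
move=> a0 mf f0.
have mg : measurable_fun setT (fun x : measurableTypeR R => (a * x + b)%R : measurableTypeR R).
  by apply: measurable_funD => //; exact: measurable_funM.
pose m : {measure set (measurableTypeR R) -> \bar R} := mscale (NngNum (normr_ge0 a)) (image_measure mu mg).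
transitivity (\int[m]_x f x).
  by apply: eq_measure_integral => A mA _; exact: lebesgue_measure_affine.
rewrite /m ge0_integral_mscale//; congr (_ * _).
by rewrite ge0_integral_image.
Qed.

End LebesgueAffine.

Section DensityRotation.
Local Open Scope ereal_scope.
Variable R : realType.
Local Notation mu := (@lebesgue_measure R).
Variables (Phi : measurableTypeR R -> \bar R) (c s : R).
Hypotheses (mP : measurable_fun setT Phi) (P0 : forall x, 0 <= Phi x).
Hypotheses (s0 : s != 0%R) (cs : (c ^+ 2 + s ^+ 2 = 1)%R).
Hypothesis Prot : forall x u : R,
  Phi x * Phi (s^-1 * u + - (c * x / s))%R = Phi u * Phi (- s^-1 * x + c * u / s)%R.

(** With x fixed, substitute u = c x + s y for y; exchange the integrals; with u fixed, substitute v
    = (c u - x) / s for x. The factor 1 / |s| of the first substitution is consumed by the second.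
    [Prot] states that the product density is the same at (x, y) and at (u, v). *)
Lemma density_rotation (f g : measurableTypeR R -> \bar R) :
  measurable_fun setT f -> measurable_fun setT g ->
  (forall x, 0 <= f x) -> (forall x, 0 <= g x) ->
  \int[mu]_x ((\int[mu]_y (f (c * x + s * y)%R * g (- s * x + c * y)%R * Phi y)) * Phi x) =
  (\int[mu]_x (f x * Phi x)) * (\int[mu]_y (g y * Phi y)).
Proof.
move=> mf mg f0 g0.
pose H (p : measurableTypeR R * measurableTypeR R) :=
  f p.2 * (g (- s^-1 * p.1 + c * p.2 / s)%R * (Phi p.2 * Phi (- s^-1 * p.1 + c * p.2 / s)%R)).
have mlin (a b d : R) : measurable_fun setT
    (fun p : measurableTypeR R * measurableTypeR R => (a * p.1 + b * p.2 / d)%R : measurableTypeR R).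
  apply: measurable_funD; first by apply: measurable_funM.
  by apply: measurable_funM => //; apply: measurable_funM.
have maff (a b : R) : measurable_fun setT (fun u : measurableTypeR R => (a * u + b)%R : measurableTypeR R).
  by apply: measurable_funD => //; apply: measurable_funM.
have mv := mlin (- s^-1)%R c s.
have mH : measurable_fun setT H.
  apply: emeasurable_funM; first exact: (measurableT_comp mf measurable_snd).
  apply: emeasurable_funM; first exact: (measurableT_comp mg mv).
  apply: emeasurable_funM; first exact: (measurableT_comp mP measurable_snd).
  exact: (measurableT_comp mP mv).
have H0 p : 0 <= H p by rewrite !mule_ge0 ?P0.
have mfg : measurable_fun setT (fun p : measurableTypeR R * measurableTypeR R =>
    f (c * p.1 + s * p.2)%R * g (- s * p.1 + c * p.2)%R).
  have h1 (a b : R) : measurable_fun setT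
      (fun p : measurableTypeR R * measurableTypeR R => (a * p.1 + b * p.2)%R : measurableTypeR R).
    by apply: measurable_funD; apply: measurable_funM.
  by apply: emeasurable_funM; [exact: (measurableT_comp mf (h1 c s))|exact: (measurableT_comp mg (h1 (- s)%R c))].
have fg0 (p : measurableTypeR R * measurableTypeR R) :
  0 <= f (c * p.1 + s * p.2)%R * g (- s * p.1 + c * p.2)%R by rewrite mule_ge0.
pose K := \int[mu]_v (g v * Phi v).
have step1 x : (\int[mu]_y (f (c * x + s * y)%R * g (- s * x + c * y)%R * Phi y)) * Phi x =
    `|s^-1|%:E * \int[mu]_u H (x, u).
  have mx : measurable_fun setT (fun y : measurableTypeR R => f (c * x + s * y)%R * g (- s * x + c * y)%R).
    exact: (measurableT_comp mfg (pair1_measurable x)).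
  rewrite (@ge0_integral_affine R s^-1 (- (c * x / s))%R)//; last 3 first.
  - by rewrite invr_eq0.
  - exact: emeasurable_funM.
  - by move=> y; rewrite mule_ge0 ?P0//; exact: (fg0 (x, y)).
  rewrite -muleA; congr (_ * _); rewrite muleC -ge0_integralZl//; last 2 first.
  - have h := measurableT_comp (emeasurable_funM mx mP) (maff s^-1%R (- (c * x / s))%R).
    exact: h.
  - by move=> y _; rewrite mule_ge0 ?P0//; exact: (fg0 (x, (s^-1 * y + - (c * x / s))%R)).
  apply: eq_integral => u _; rewrite /H /= -(Prot x u).
  have -> : (c * x + s * (s^-1 * u + - (c * x / s)) = u)%R by field.
  have -> : (- s * x + c * (s^-1 * u + - (c * x / s)) = - s^-1 * x + c * u / s)%R.
    apply: (mulfI s0).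
    have -> : (s * (- s * x + c * (s^-1 * u + - (c * x / s))) =
      c * u - (c ^+ 2 + s ^+ 2) * x)%R by field.
    by rewrite cs; field.
  by rewrite -!muleA [LHS]muleCA; congr (_ * _); rewrite [LHS]muleCA.

have mF := measurable_fun_fubini_tonelli_F (m2 := mu) H mH H0.
under eq_integral do rewrite step1.
rewrite ge0_integralZl//; last first.
  by move=> x _; apply: integral_ge0 => y _; exact: H0.
have sw : \int[mu]_x \int[mu]_u H (x, u) = \int[mu]_u \int[mu]_x H (x, u).
  exact: (fubini_tonelli (m1 := mu) (m2 := mu) H mH H0).
transitivity (`|s^-1|%:E * \int[mu]_u \int[mu]_x H (x, u)).
  apply: (congr1 (fun z => `|s^-1|%:E * z)); exact: sw.
have mG : measurable_fun setT (fun u => \int[mu]_x H (x, u)).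
  exact: (measurable_fun_fubini_tonelli_G (m1 := mu) H mH H0).
have G0 u : 0 <= \int[mu]_x H (x, u) by apply: integral_ge0 => x _; exact: H0.
have a0 : 0 <= `|s^-1|%:E by rewrite lee_fin.
have ZG : \int[mu]_u (`|s^-1|%:E * \int[mu]_x H (x, u)) = `|s^-1|%:E * \int[mu]_u \int[mu]_x H (x, u).
  by rewrite ge0_integralZl.
rewrite -ZG {ZG}.
have step3 u : `|s^-1|%:E * \int[mu]_x H (x, u) = f u * Phi u * K.
  rewrite /K (@ge0_integral_affine R (- s^-1)%R (c * u / s)%R (fun v => g v * Phi v)); last 3 first.
  - by rewrite oppr_eq0 invr_eq0.
  - exact: emeasurable_funM.
  - by move=> y; rewrite mule_ge0 ?P0.
  pose G1 (x : measurableTypeR R) := g (- s^-1 * x + c * u / s)%R * Phi (- s^-1 * x + c * u / s)%R.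
  have mgv : measurable_fun setT G1.
    exact: (measurableT_comp (emeasurable_funM mg mP) (maff (- s^-1)%R (c * u / s)%R)).
  have G10 x : 0 <= G1 x by rewrite mule_ge0.
  have z1 : 0 <= f u * Phi u by rewrite mule_ge0.
  have Zv : \int[mu]_x (f u * Phi u * G1 x) = f u * Phi u * \int[mu]_x G1 x.
    by rewrite ge0_integralZl.
  rewrite normrN muleCA -Zv; congr (_ * _).
  apply: eq_integral => x _; rewrite /H /G1 /=.
  by rewrite -!muleA; congr (_ * _); rewrite [LHS]muleCA.
pose G2 (u : measurableTypeR R) := f u * Phi u.
have mG2 : measurable_fun setT G2 by exact: emeasurable_funM.
have G20 u : 0 <= G2 u by rewrite mule_ge0.
have K0 : 0 <= K by apply: integral_ge0 => v _; rewrite mule_ge0.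
transitivity (\int[mu]_u (G2 u * K)); first by apply: eq_integral => u _; exact: step3.
by rewrite ge0_integralZr.
Qed.

End DensityRotation.

Section GaussianRotation.
Local Open Scope ereal_scope.
Variable R : realType.
Local Notation mu := (@lebesgue_measure R).
Local Notation gauss := (@normal_prob R 0%R 1%R).
Let Phi := (fun x : measurableTypeR R => (normal_pdf 0%R 1%R x : R)%:E).

Lemma Phi_rotation (c s x u : R) : s != 0%R -> (c ^+ 2 + s ^+ 2 = 1)%R ->
  Phi x * Phi (s^-1 * u + - (c * x / s))%R = Phi u * Phi (- s^-1 * x + c * u / s)%R.
Proof.
move=> s0 cs; rewrite -!EFinM; congr EFin.
rewrite !normal_pdfE ?oner_neq0// /normal_fun.
rewrite [LHS]mulrACA [RHS]mulrACA; congr (_ * _)%R.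
rewrite -!expRD; congr expR; rewrite !subr0 expr1n !mulr2n.
have cE : (c ^+ 2 = 1 - s ^+ 2)%R by rewrite -cs addrK.
suff : (x ^+ 2 + (s^-1 * u + - (c * x / s)) ^+ 2 = u ^+ 2 + (- s^-1 * x + c * u / s) ^+ 2)%R.
  by move=> h; rewrite -!mulrDl -!opprD h.
apply: (@mulfI _ (s ^+ 2)); first by rewrite sqrf_eq0.
have -> : (s ^+ 2 * (x ^+ 2 + (s^-1 * u + - (c * x / s)) ^+ 2) =
  s ^+ 2 * x ^+ 2 + u ^+ 2 - 2 * c * x * u + c ^+ 2 * x ^+ 2)%R by field.
have -> : (s ^+ 2 * (u ^+ 2 + (- s^-1 * x + c * u / s) ^+ 2) =
  s ^+ 2 * u ^+ 2 + x ^+ 2 - 2 * c * x * u + c ^+ 2 * u ^+ 2)%R by field.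
by rewrite cE; ring.
Qed.

Lemma gauss_rotation (c s : R) (f g : measurableTypeR R -> \bar R) :
  s != 0%R -> (c ^+ 2 + s ^+ 2 = 1)%R ->
  measurable_fun setT f -> measurable_fun setT g ->
  (forall x, 0 <= f x) -> (forall x, 0 <= g x) ->
  \int[gauss]_x \int[gauss]_y (f (c * x + s * y)%R * g (- s * x + c * y)%R) =
  (\int[gauss]_x f x) * (\int[gauss]_y g y).
Proof.
move=> s0 cs mf mg f0 g0.
have mP : measurable_fun setT Phi by apply/measurable_EFinP; exact: measurable_normal_pdf.
have P0 x : 0 <= Phi x by rewrite lee_fin normal_pdf_ge0.
have h1 (a b : R) : measurable_fun setT
    (fun p : measurableTypeR R * measurableTypeR R => (a * p.1 + b * p.2)%R : measurableTypeR R).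
  by apply: measurable_funD; apply: measurable_funM.
have mfg : measurable_fun setT (fun p : measurableTypeR R * measurableTypeR R =>
    f (c * p.1 + s * p.2)%R * g (- s * p.1 + c * p.2)%R).
  by apply: emeasurable_funM; [exact: (measurableT_comp mf (h1 c s))|exact: (measurableT_comp mg (h1 (- s)%R c))].
have fg0 (p : measurableTypeR R * measurableTypeR R) :
  0 <= f (c * p.1 + s * p.2)%R * g (- s * p.1 + c * p.2)%R by rewrite mule_ge0.
have mF2 := measurable_fun_fubini_tonelli_F (m2 := gauss) _ mfg fg0.
rewrite [LHS](integral_normal_probE mF2); last first.
  by move=> x; apply: integral_ge0 => y _; exact: (fg0 (x, y)).
rewrite !integral_normal_probE//.
rewrite -(density_rotation mP P0 s0 cs (fun x u => Phi_rotation x u s0 cs))//.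
apply: eq_integral => x _; congr (_ * _).
by rewrite /fubini_F integral_normal_probE//; exact: (measurableT_comp mfg (pair1_measurable x)).
Qed.

End GaussianRotation.

(** * Independence and Gaussian families *)

Section Coordinates.
Variables (R : realType) (I : finType).

Definition cylinders : set (set (I -> R)) :=
  [set C | exists B : I -> set R, (forall i, measurable (B i)) /\
           C = [set x | forall i, B i (x i)]].

(** The product sigma-algebra on R^I. Boxes generate it and are closed under intersection, so a
    finite measure on it is determined by its values on boxes. *)
Definition coord_type := g_sigma_algebraType cylinders.

Lemma cylinders_measurable C : cylinders C -> measurable (C : set coord_type).
Proof. exact: sub_sigma_algebra. Qed.

Lemma measurable_coord i : measurable_fun setT (fun x : coord_type => x i : measurableTypeR R).
Proof.
move=> _ B mB; rewrite setTI; apply: cylinders_measurable.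
exists (fun j => if j == i then B else setT); split=> [j|].
  by case: eqP.
apply/seteqP; split=> [x Bx j|x /(_ i)] /=; last by rewrite eqxx.
by case: eqP => [->|].
Qed.

Lemma measurable_to_coord d (T : measurableType d) (X : T -> coord_type) :
  (forall i, measurable_fun setT (fun t => X t i : measurableTypeR R)) -> measurable_fun setT X.
Proof.
move=> mX; apply: (@measurability _ _ T coord_type setT X cylinders) => // _ [_ [B [mB ->]] <-].
rewrite setTI (_ : _ @^-1` _ = \bigcap_(i in [set: I]) ((fun t => X t i) @^-1` B i)); last first.
  by apply/seteqP; split => t /= h i; [move=> _|]; exact: h.
apply: fin_bigcap_measurable => // i _.
by have := mX i measurableT _ (mB i); rewrite setTI.
Qed.

Lemma cylinders_setI : setI_closed cylinders.
Proof.
move=> _ _ [B [mB ->]] [C [mC ->]]; exists (fun i => B i `&` C i); split.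
  by move=> i; exact: measurableI.
apply/seteqP; split => [x /= [h1 h2] i|x /= h]; first by split.
by split => i; case: (h i).
Qed.

Lemma cylinders_setT : cylinders setT.
Proof. by exists (fun=> setT); split => //; apply/seteqP; split. Qed.

Lemma coord_measure_unique (m1 m2 : {measure set coord_type -> \bar R}) :
  (m1 setT < +oo)%E ->
  (forall B : I -> set R, (forall i, measurable (B i)) ->
     m1 [set x | forall i, B i (x i)] = m2 [set x | forall i, B i (x i)]) ->
  forall A, measurable A -> m1 A = m2 A.
Proof.
move=> fin m12 A mA.
apply: (@measure_unique _ R coord_type cylinders (fun=> setT)) => //.
- exact: cylinders_setI.
- by move=> _; exact: cylinders_setT.
- by rewrite bigcup_const.

- by move=> _ [B [mB ->]]; exact: m12.
Qed.

Definition mix (J : {set I}) (x y : coord_type) : coord_type :=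
  fun i => if i \in J then x i else y i.

Lemma measurable_mix J : measurable_fun setT (fun p : coord_type * coord_type => mix J p.1 p.2).
Proof.
apply: measurable_to_coord => i; rewrite /mix.
case: (i \in J).
  exact: (measurableT_comp (measurable_coord i) measurable_fst).
exact: (measurableT_comp (measurable_coord i) measurable_snd).
Qed.

End Coordinates.

(** * Independence as resampling of a block of coordinates *)

Section Decoupling.
Local Open Scope ereal_scope.
Context d (T : measurableType d) (R : realType) (P : probability T R) (I : finType).
Variable X : I -> {RV P >-> R}.

Definition joint (t : T) : coord_type R I := fun i => X i t.

Lemma measurable_joint : measurable_fun setT joint.
Proof. by apply: measurable_to_coord => i; exact: (measurable_funPT (X i)). Qed.

Hypothesis indepX : mutually_independent X.

Lemma indep_box (J : {set I}) (B : I -> set R) : (forall i, measurable (B i)) ->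
  P [set t | forall i, i \in J -> B i (X i t)] = \prod_(i in J) P (X i @^-1` B i).
Proof.
by move=> mB; rewrite -indepX.
Qed.

Lemma measurable_box (J : {set I}) (B : I -> set R) : (forall i, measurable (B i)) ->
  measurable [set t | forall i, i \in J -> B i (X i t)].
Proof.
move=> mB; rewrite (_ : mkset _ = \bigcap_(i in [set` J]) (X i @^-1` B i)); last first.
  by apply/seteqP; split => t /= h i /h.
by apply: fin_bigcap_measurable => // i _; exact: measurable_funPTI.
Qed.

(** On boxes, the laws of [joint t] and of [mix J (joint t) (joint u)] are the same product of
    marginals, hence they agree. This is the form in which conditioning is used: the block [J] is
    frozen at [t] while the other coordinates are redrawn from [u]. *)
Lemma decoupling (J : {set I}) (F : coord_type R I -> \bar R) :
  measurable_fun setT F -> (forall x, 0 <= F x) ->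
  \int[P]_t F (joint t) = \int[P]_t \int[P]_u F (mix J (joint t) (joint u)).
Proof.
move=> mF F0.
pose Psi (p : T * T) := mix J (joint p.1) (joint p.2).
have mPsi : measurable_fun setT Psi.
  have h : measurable_fun setT (fun p : T * T => (joint p.1, joint p.2)).
    apply/measurable_fun_pairP; split => /=.
      exact: (measurableT_comp measurable_joint measurable_fst).
    exact: (measurableT_comp measurable_joint measurable_snd).
  exact: (measurableT_comp (measurable_mix J) h).
rewrite -(ge0_integral_image P measurable_joint mF F0).
transitivity (\int[P \x P]_p F (Psi p)); last first.
  rewrite fubini_tonelli1//; exact: (measurableT_comp mF mPsi).
rewrite -(ge0_integral_image (P \x P) mPsi mF F0).
apply: eq_measure_integral => A mA _.
apply: coord_measure_unique => //.
  by rewrite /= /pushforward preimage_setT [X in X < _]probability_setT ltry.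
move=> B mB; rewrite /= /pushforward.
have -> : joint @^-1` [set x | forall i, B i (x i)] =
    [set t | forall i, i \in [set: I]%SET -> B i (X i t)].
  by apply/seteqP; split => t /= h i *; apply: h; rewrite ?inE.
rewrite indep_box//.
have -> : Psi @^-1` [set x | forall i, B i (x i)] =
    [set t | forall i, i \in J -> B i (X i t)] `*`
    [set t | forall i, i \in (~: J)%SET -> B i (X i t)].
  apply/seteqP; split => [[t u] /= h|[t u] /= [h1 h2] i].
    split => /= i iJ; have := h i; rewrite /Psi /mix /= ?iJ//.
    by move: iJ; rewrite inE => /negbTE ->.
  rewrite /Psi /mix /=; case: ifPn => iJ; first exact: h1.
  by apply: h2; rewrite inE.
rewrite product_measure1E//; [|exact: measurable_box..].
rewrite [X in _ = X * _](indep_box J mB) [X in _ = _ * X](indep_box (~: J)%SET mB).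
rewrite (bigID (mem J))/=.
by congr (_ * _); apply: eq_bigl => i; rewrite !inE.
Qed.

Lemma ge0_decoupling_le (J : {set I}) (F : coord_type R I -> \bar R) (c : \bar R) :
  measurable_fun setT F -> (forall x, 0 <= F x) ->
  (forall t, \int[P]_u F (mix J (joint t) (joint u)) <= c) ->
  \int[P]_t F (joint t) <= c.
Proof.
move=> mF F0 h; rewrite (decoupling J mF F0); apply: ge0_integral_le_cst => // t.
exact: integral_ge0.
Qed.

End Decoupling.

(** * Families of independent standard Gaussians *)

Section GaussianFamilies.
Local Open Scope ereal_scope.
Context d (T : measurableType d) (R : realType) (P : probability T R).
Local Notation gauss := (@normal_prob R 0%R 1%R).

Definition gaussian_family (I : finType) (X : I -> {RV P >-> R}) : Prop :=
  mutually_independent X /\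
  forall i (B : set R), measurable B -> distribution P (X i) B = gauss B.

Definition mkRV (f : T -> R) (mf : measurable_fun setT f) : {RV P >-> R} :=
  HB.pack f (isMeasurableFun.Build _ _ _ _ _ mf).

Section Family.
Variable I : finType.
Implicit Types X : I -> {RV P >-> R}.

Lemma independence_full_box X :
  (forall B : I -> set R, (forall i, measurable (B i)) ->
    P [set t | forall i, B i (X i t)] = \prod_i P (X i @^-1` B i)) ->
  mutually_independent X.
Proof.
move=> h J B mB.
rewrite (_ : \bigcap_(i in _) _ = [set t | forall i, (if i \in J then B i else setT) (X i t)]); last first.
  apply/seteqP; split => t /= Ht i.
    by case: ifPn => // iJ; exact: Ht.
  by move=> iJ; have := Ht i; rewrite (iJ : i \in J).
rewrite (h (fun i => if i \in J then B i else setT)); last by move=> i; case: ifP.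
rewrite [RHS]big_mkcond; apply: eq_bigr => i _; case: ifP => // _.
by rewrite preimage_setT probability_setT.
Qed.

Lemma gaussian_integral X (f : measurableTypeR R -> \bar R) i : gaussian_family X ->
  measurable_fun setT f -> (forall x, 0 <= f x) ->
  \int[P]_t f (X i t) = \int[gauss]_x f x.
Proof.
move=> [_ gX] mf f0.
have mXi : measurable_fun setT (X i : T -> measurableTypeR R) by exact: (measurable_funPT (X i)).
rewrite -(ge0_integral_image P mXi mf f0).
by apply: eq_measure_integral => A mA _; exact: gX.
Qed.

Lemma gaussian_preimage X i (B : set R) : gaussian_family X -> measurable B ->
  P (X i @^-1` B) = gauss B.
Proof. by move=> [_ gX] mB; exact: gX. Qed.

Lemma gauss_prob_indic (B : set R) : measurable B ->
  \int[gauss]_x (\1_B x)%:E = gauss B.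
Proof. by move=> mB; rewrite integral_indic// setIT. Qed.

Lemma gaussian_family_box X : gaussian_family X ->
  forall B : I -> set R, (forall i, measurable (B i)) ->
  P [set t | forall i, B i (X i t)] = \prod_i gauss (B i).
Proof.
move=> gX B mB; have [iX _] := gX.
rewrite (_ : mkset _ = [set t | forall i, i \in [set: I]%SET -> B i (X i t)]); last first.
  by apply/seteqP; split => t /= h i *; apply: h; rewrite ?inE.
rewrite indep_box// (eq_bigl predT); last by move=> i; rewrite inE.
by apply: eq_bigr => i _; exact: gaussian_preimage.
Qed.

Lemma gaussian_family_of_box X :
  (forall B : I -> set R, (forall i, measurable (B i)) ->
    P [set t | forall i, B i (X i t)] = \prod_i gauss (B i)) -> gaussian_family X.
Proof.
move=> h.
have marg i (B : set R) : measurable B -> P (X i @^-1` B) = gauss B.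
  move=> mB; have := h (fun j => if j == i then B else setT) _.
  rewrite (_ : mkset _ = X i @^-1` B).
    move=> ->; last by move=> j; case: ifP.
    rewrite (bigD1 i)//= eqxx big1 ?mule1// => j /negbTE ->.
    exact: (@probability_setT _ _ _ gauss).
  apply/seteqP; split => t /= H; first by have := H i; rewrite eqxx.
  by move=> j; case: eqP => [->|].
split; last by move=> i B mB; exact: marg.
apply: independence_full_box => B mB; rewrite h//.
by apply: eq_bigr => i _; rewrite marg.
Qed.

End Family.

Lemma gaussian_family_inj (I I' : finType) (phi : I' -> I) (X : I -> {RV P >-> R}) :
  injective phi -> gaussian_family X -> gaussian_family (X \o phi).
Proof.
move=> inj gX; have [iX _] := gX; apply: gaussian_family_of_box => B mB.
(* A box for the subfamily is padded with [setT] outside the image of [phi]. *)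
pose B' i := if [pick j | phi j == i] is Some j then B j else setT.
have B'phi j : B' (phi j) = B j.
  by rewrite /B'; case: pickP => [j' /eqP/inj ->//|/(_ j)]; rewrite eqxx.
have mB' i : measurable (B' i) by rewrite /B'; case: pickP.
rewrite (_ : mkset _ = [set t | forall i, i \in phi @: [set: I']%SET -> B' i (X i t)]); last first.
  apply/seteqP; split => t /= h j; first by move=> /imsetP[j' _ ->]; rewrite B'phi; exact: h.
  by rewrite -B'phi; apply: h; apply: imset_f; rewrite inE.
rewrite indep_box// big_imset/=; last by move=> ? ? _ _; exact: inj.
rewrite (eq_bigl predT); last by move=> i; rewrite inE.
by apply: eq_bigr => j _; rewrite B'phi (gaussian_preimage _ gX).
Qed.

Lemma gauss_opp (B : set R) : measurable B -> gauss (-%R @^-1` B) = gauss B.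
Proof.
move=> mB.
have mN : measurable_fun setT (-%R : measurableTypeR R -> measurableTypeR R).
  exact: oppr_measurable.
have mNB : measurable (-%R @^-1` B : set (measurableTypeR R)).
  by have := mN measurableT _ mB; rewrite setTI.
have mP : measurable_fun setT (fun x : measurableTypeR R => (normal_pdf 0%R 1%R x : R)%:E).
  by apply/measurable_EFinP; exact: measurable_normal_pdf.
pose h (x : measurableTypeR R) := (\1_B x : R)%:E * (normal_pdf 0%R 1%R x : R)%:E.
have mh : measurable_fun setT h.
  by apply: emeasurable_funM => //; apply/measurable_EFinP; exact: measurable_indic.
have h0 x : 0 <= h x by rewrite mule_ge0// lee_fin// normal_pdf_ge0.
have ind (C : set (measurableTypeR R)) : measurable C ->
    gauss C = \int[lebesgue_measure]_x ((\1_C x : R)%:E * (normal_pdf 0%R 1%R x : R)%:E).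
  move=> mC; rewrite -gauss_prob_indic// integral_normal_probE//.
  by apply/measurable_EFinP; exact: measurable_indic.
rewrite !ind//.
rewrite [RHS](@ge0_integral_affine R (-1) 0 h)//.
rewrite normrN1 mul1e; apply: eq_integral => x _; rewrite /h addr0 mulN1r.
by rewrite normal_pdfE ?oner_neq0// /normal_fun !subr0 sqrrN.
Qed.

End GaussianFamilies.

Section GaussianExpectations.
Local Open Scope ereal_scope.
Context d (T : measurableType d) (R : realType) (P : probability T R).
Local Notation gauss := (@normal_prob R 0%R 1%R).

(** Times the density, the integrand is sg times the centred normal density of standard deviation sg
    = (1 + 2 th)^(-1/2). Negative [th] is allowed down to -1/2, for exponential moments. *)
Lemma gauss_integral_exp_sqr (th : R) : (0 < 1 + 2 * th)%R ->
  \int[gauss]_x (expR (- (th * x ^+ 2)))%:E = ((Num.sqrt (1 + 2 * th))^-1)%:E.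
Proof.
move=> th0.
pose f (x : measurableTypeR R) := (expR (- (th * x ^+ 2)))%:E.
have mf : measurable_fun setT f.
  apply/measurable_EFinP; apply: measurableT_comp => //.
  apply: measurableT_comp => //; apply: measurable_funM => //.
rewrite (integral_normal_probE mf); last by move=> x; rewrite lee_fin expR_ge0.
pose sg := (Num.sqrt (1 + 2 * th))^-1%R.
have sq0 : (0 < Num.sqrt (1 + 2 * th))%R by rewrite sqrtr_gt0.
have sg0 : (0 < sg)%R by rewrite invr_gt0.
have sg2 : (sg ^+ 2 = (1 + 2 * th)^-1)%R by rewrite exprVn sqr_sqrtr// ltW.
pose g (x : measurableTypeR R) := (normal_pdf 0%R sg x : R)%:E.
have mg : measurable_fun setT g by apply/measurable_EFinP; exact: measurable_normal_pdf.
have g0 x : 0 <= g x by rewrite lee_fin normal_pdf_ge0.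
transitivity (\int[lebesgue_measure]_x (sg%:E * g x)); last first.
  rewrite ge0_integralZl//; last by rewrite lee_fin ltW.
  by rewrite integral_normal_pdf mule1.
apply: eq_integral => x _; rewrite /f /g -!EFinM; congr EFin.
rewrite !normal_pdfE ?oner_neq0 ?gt_eqF// /normal_fun /normal_peak !subr0 expr1n mul1r.
have pi0 : (0 < pi :> R)%R := pi_gt0 R.
rewrite [LHS]mulrCA -expRD [RHS]mulrA; congr (_ * _)%R.
  rewrite sg2 -mulrnAr sqrtrM ?invr_ge0 ?ltW// sqrtrV ?ltW// invfM invrK.
  by rewrite /sg mulrA mulVf ?mul1r// gt_eqF.
congr expR; rewrite sg2 !mulr2n; field.
by rewrite gt_eqF.
Qed.

(** Induction on the size of [J]: decoupling with a singleton block splits off one factor. *)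
Lemma independent_prod_integral (I : finType) (X : I -> {RV P >-> R}) (J : {set I})
    (h : I -> measurableTypeR R -> R) :
  mutually_independent X ->
  (forall i, measurable_fun setT (h i)) -> (forall i x, (0 <= h i x)%R) ->
  \int[P]_t (\prod_(i in J) h i (X i t))%:E = \prod_(i in J) \int[P]_t (h i (X i t))%:E.
Proof.
move=> iX mh h0; move: {2}#|J| (leqnn #|J|) => m; elim: m J => [|m IH] J Jm.
  have -> : J = finset.set0 by apply/eqP; rewrite -cards_eq0 -leqn0.
  rewrite big_set0; under eq_integral do rewrite big_set0.
  exact: probability_integral_cst.
have [->|[i iJ]] := set_0Vmem J.
  rewrite big_set0; under eq_integral do rewrite big_set0.
  exact: probability_integral_cst.
pose F (x : coord_type R I) := (\prod_(j in J) h j (x j))%:E.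
have mhX j : measurable_fun setT (fun t => h j (X j t)).
  have mXj : measurable_fun setT (X j : T -> measurableTypeR R) by exact: (measurable_funPT (X j)).
  exact: (measurableT_comp (mh j) mXj).
have mF : measurable_fun setT F.
  apply/measurable_EFinP; apply: measurable_prod_pred => j.
  exact: (measurableT_comp (mh j) (measurable_coord j)).
rewrite (decoupling iX [set i]%SET mF); last by move=> x; rewrite lee_fin prodr_ge0.
rewrite (big_setD1 i)//=.
transitivity (\int[P]_t ((h i (X i t))%:E * \int[P]_u (\prod_(j in (J :\ i)%SET) h j (X j u))%:E)).
  apply: eq_integral => t _; rewrite -ge0_integralZl//; last 3 first.
  - apply/measurable_EFinP.
    exact: measurable_prod_pred.
  - by move=> u _; rewrite lee_fin prodr_ge0.
  - by rewrite lee_fin.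
  apply: eq_integral => u _; rewrite /F (big_setD1 i)//= -EFinM; congr EFin.
  congr (_ * _)%R; first by rewrite /mix inE eqxx.
  by apply: eq_bigr => j; rewrite !inE => /andP[ji _]; rewrite /mix inE (negbTE ji).
rewrite ge0_integralZr//; last 3 first.
- exact/measurable_EFinP.
- by move=> x _; rewrite lee_fin.
- by apply: integral_ge0 => x _; rewrite lee_fin prodr_ge0.
congr (_ * _); rewrite IH// -ltnS (leq_trans _ Jm)//.
by rewrite [X in (_ < X)%N](cardsD1 i) iJ.
Qed.

End GaussianExpectations.

Lemma indic_box (R : realType) (I : finType) (U V : Type) (B : I -> set V) (g : U -> I -> V) t :
  (\1_[set t | forall k, B k (g t k)] t : R) = \prod_k \1_(B k) (g t k).
Proof.
rewrite indicE; case: (asboolP (forall k, B k (g t k))) => h.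
  rewrite mem_set// big1// => k _; rewrite indicE mem_set//.
rewrite memNset//; move/existsNP : h => [k Bk].
by rewrite (bigD1 k)//= indicE memNset// mul0r.
Qed.

(** * Orthogonal invariance of Gaussian matrices *)

Section GivensFamily.
Local Open Scope ereal_scope.
Context d (T : measurableType d) (R : realType) (P : probability T R).
Local Notation gauss := (@normal_prob R 0%R 1%R).

(** The probability of a box is the integral of a product of indicators. Decoupling separates the
    coordinates i, j from the others, and then i from j, which leaves the double integral of
    [gauss_rotation]. *)
Lemma gaussian_family_givens (I : finType) (X : I -> {RV P >-> R}) (i j : I) (c s : R) :
  gaussian_family X -> i != j -> s != 0%R -> (c ^+ 2 + s ^+ 2 = 1)%R ->
  exists2 X' : I -> {RV P >-> R}, gaussian_family X' &
    forall k t, X' k t = (if k == i then c * X i t + s * X j t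
                         else if k == j then - s * X i t + c * X j t else X k t)%R.
Proof.
move=> gX ij s0 cs; have [iX _] := gX.
pose f k t := (if k == i then c * X i t + s * X j t
                         else if k == j then - s * X i t + c * X j t else X k t)%R.
have mlin (a b : R) : measurable_fun setT (fun t => a * X i t + b * X j t)%R.
  by apply: measurable_funD; apply: measurable_funM.
have mf k : measurable_fun setT (f k).
  rewrite /f; case: (k == i); first exact: mlin.
  by case: (k == j); [exact: mlin|exact: (measurable_funPT (X k))].
exists (fun k => mkRV P (mf k)); last by [].
apply: gaussian_family_of_box => B mB.
pose K : {set I} := (~: [set i; j])%SET.
pose a (x y : measurableTypeR R) : R := (\1_(B i) (c * x + s * y) * \1_(B j) (- s * x + c * y))%R.
pose b (x : coord_type R I) : R := (\prod_(k in K) \1_(B k) (x k))%R.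
pose F (x : coord_type R I) := (a (x i) (x j) * b x)%:E.
have mind k : measurable_fun setT (\1_(B k) : measurableTypeR R -> R).
  by apply: measurable_indic; exact: mB.
have mlin2 (e g : R) : measurable_fun setT
    (fun p : measurableTypeR R * measurableTypeR R => (e * p.1 + g * p.2)%R : measurableTypeR R).
  by apply: measurable_funD; apply: measurable_funM.
have ma : measurable_fun setT (fun p : measurableTypeR R * measurableTypeR R => a p.1 p.2).
  apply: measurable_funM; first exact: (measurableT_comp (mind i) (mlin2 c s)).
  exact: (measurableT_comp (mind j) (mlin2 (- s)%R c)).
have a0 x y : (0 <= a x y)%R by rewrite mulr_ge0.
have b0 x : (0 <= b x)%R by rewrite prodr_ge0.
have mb : measurable_fun setT b.
  apply: measurable_prod_pred => k.
  exact: (measurableT_comp (mind k) (measurable_coord k)).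
have mF : measurable_fun setT F.
  apply/measurable_EFinP; apply: measurable_funM => //.
  have h : measurable_fun setT (fun x : coord_type R I => (x i : measurableTypeR R, x j : measurableTypeR R)).
    by apply/measurable_fun_pairP; split; exact: measurable_coord.
  exact: (measurableT_comp ma h).
have F0 x : 0 <= F x by rewrite lee_fin mulr_ge0.
have mS : measurable [set t | forall k, B k (mkRV P (mf k) t)].
  rewrite (_ : mkset _ = [set t | forall k, k \in [set: I]%SET -> B k (mkRV P (mf k) t)]); last first.
    by apply/seteqP; split => t /= h k *; apply: h; rewrite ?inE.
  exact: measurable_box.
have -> : P [set t | forall k, B k (mkRV P (mf k) t)] = \int[P]_t F (joint X t).
  rewrite -[LHS](_ : \int[P]_t (\1_([set t | forall k, B k (mkRV P (mf k) t)]) t)%:E = _); last first.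
    by rewrite integral_indic// setIT.
  apply: eq_integral => t _; congr EFin; rewrite indic_box /a /b.
  rewrite (bigD1 i)//= (bigD1 j) 1?eq_sym//= /f eqxx (negbTE (_ : j != i)) 1?eq_sym// eqxx mulrA.
  congr (_ * _)%R; apply: eq_big => [k|k /andP[ki kj]]; first by rewrite !inE negb_or.
  by rewrite /= /f (negbTE ki) (negbTE kj).
rewrite (decoupling iX [set i; j]%SET mF F0).
have b1 : \int[P]_u (b (joint X u))%:E = \prod_(k in K) gauss (B k).
  rewrite (independent_prod_integral (h := fun k => \1_(B k)) K iX)//.
  apply: eq_bigr => k _; rewrite -gauss_prob_indic//.
  by rewrite (gaussian_integral (f := fun x => (\1_(B k) x)%:E) k gX)//; exact/measurable_EFinP.
transitivity (\int[P]_t ((a (X i t) (X j t))%:E * \int[P]_u (b (joint X u))%:E)).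
  apply: eq_integral => t _; rewrite -ge0_integralZl//; last 3 first.
  - by apply/measurable_EFinP; exact: (measurableT_comp mb (measurable_joint X)).
  - by move=> u _; rewrite lee_fin.
  - by rewrite lee_fin.
  apply: eq_integral => u _; rewrite /F -EFinM; congr EFin; congr (_ * _)%R.
    by rewrite /mix !inE !eqxx orbT.
  by apply: eq_bigr => k; rewrite inE /mix => /negbTE ->.
rewrite b1.
have maX : measurable_fun setT (fun t => a (X i t) (X j t)).
  have h : measurable_fun setT (fun t => (X i t : measurableTypeR R, X j t : measurableTypeR R)).
    by apply/measurable_fun_pairP; split; [exact: (measurable_funPT (X i))|exact: (measurable_funPT (X j))].
  exact: (measurableT_comp ma h).
rewrite ge0_integralZr//; last 3 first.
- exact/measurable_EFinP.
- by move=> x _; rewrite lee_fin.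
- by apply: prode_ge0.
rewrite [RHS](bigD1 i)//= [in RHS](bigD1 j) 1?eq_sym//= muleA.
congr (_ * _); last by apply: eq_bigl => k; rewrite !inE negb_or.
pose Fa (x : coord_type R I) := (a (x i) (x j))%:E.
have mFa : measurable_fun setT Fa.
  apply/measurable_EFinP.
  have h : measurable_fun setT (fun x : coord_type R I => (x i : measurableTypeR R, x j : measurableTypeR R)).
    by apply/measurable_fun_pairP; split; exact: measurable_coord.
  exact: (measurableT_comp ma h).
rewrite -[LHS]/(\int[P]_t Fa (joint X t)) (decoupling iX [set i]%SET mFa); last first.
  by move=> x; rewrite lee_fin.
pose h (x : measurableTypeR R) := \int[gauss]_y (a x y)%:E.
have maE : measurable_fun setT (fun p : measurableTypeR R * measurableTypeR R => (a p.1 p.2)%:E).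
  exact/measurable_EFinP.
have mh : measurable_fun setT h.
  by apply: (measurable_fun_fubini_tonelli_F (m2 := gauss) _ maE) => p; rewrite lee_fin.
have h0 x : 0 <= h x by apply: integral_ge0 => y _; rewrite lee_fin.
transitivity (\int[P]_t h (X i t)).
  apply: eq_integral => t _; rewrite /h.
  have max : measurable_fun setT (fun y : measurableTypeR R => (a (X i t) y)%:E).
    exact: (measurableT_comp maE (pair1_measurable (X i t : measurableTypeR R))).
  rewrite -(gaussian_integral j gX max); last by move=> y; rewrite lee_fin.
  by apply: eq_integral => u _; rewrite /Fa /mix !inE eqxx eq_sym (negbTE ij).
rewrite (gaussian_integral i gX mh h0) /h.
pose fi (x : measurableTypeR R) := (\1_(B i) x : R)%:E.
pose fj (x : measurableTypeR R) := (\1_(B j) x : R)%:E.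
rewrite -!gauss_prob_indic// -(gauss_rotation (f := fi) (g := fj) s0 cs)//; last 4 first.
- exact/measurable_EFinP.
- exact/measurable_EFinP.
- by move=> x; rewrite lee_fin.
- by move=> x; rewrite lee_fin.
Qed.

Lemma gaussian_family_sign (I : finType) (X : I -> {RV P >-> R}) (e : I -> R) :
  gaussian_family X -> (forall i, e i = 1 \/ e i = -1)%R ->
  exists2 X' : I -> {RV P >-> R}, gaussian_family X' & forall k t, X' k t = (e k * X k t)%R.
Proof.
move=> gX e1.
have mf k : measurable_fun setT (fun t => e k * X k t)%R by exact: measurable_funM.
exists (fun k => mkRV P (mf k)); last by [].
apply: gaussian_family_of_box => B mB.
have mN (C : set R) : measurable C -> measurable (-%R @^-1` C).
  by move=> mC; have := @oppr_measurable R setT measurableT _ mC; rewrite setTI.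
have mB' k : measurable ((fun x => e k * x)%R @^-1` B k).
  case: (e1 k) => ->; first by rewrite (_ : _ @^-1` _ = B k)//; apply/seteqP; split => x /=; rewrite mul1r.
  by rewrite (_ : _ @^-1` _ = -%R @^-1` B k); [exact: mN|apply/seteqP; split => x /=; rewrite mulN1r].
rewrite (gaussian_family_box gX mB'); apply: eq_bigr => k _.
case: (e1 k) => ->; first by rewrite (_ : _ @^-1` _ = B k)//; apply/seteqP; split => x /=; rewrite mul1r.
rewrite (_ : _ @^-1` _ = -%R @^-1` B k); first exact: gauss_opp.
by apply/seteqP; split => x /=; rewrite mulN1r.
Qed.

End GivensFamily.

(** * Triangularization by Givens rotations *)

Section Givens.
Variable R : realType.

Definition givens n (a b : 'I_n) (c s : R) : 'M[R]_n :=
  \matrix_(i, j) if i == a then c * (j == a)%:R + s * (j == b)%:R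
                 else if i == b then - s * (j == a)%:R + c * (j == b)%:R
                 else (i == j)%:R.

Lemma givensE n p (a b : 'I_n) (c s : R) (M : 'M[R]_(n, p)) i j :
  (givens a b c s *m M) i j =
    if i == a then c * M a j + s * M b j
    else if i == b then - s * M a j + c * M b j else M i j.
Proof.
have delta k : \sum_x (x == k)%:R * M x j = M k j.
  rewrite (bigD1 k)//= eqxx mul1r big1 ?addr0// => x /negbTE ->.
  by rewrite mul0r.
have comb (e g : R) : \sum_x (e * (x == a)%:R + g * (x == b)%:R) * M x j = e * M a j + g * M b j.
  rewrite -(delta a) -(delta b) !mulr_sumr -big_split; apply: eq_bigr => x _.
  by rewrite mulrDl !mulrA.
rewrite mxE; under eq_bigr do rewrite mxE.
case: (i == a); first exact: comb.
case: (i == b); first exact: comb.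
by under eq_bigr do rewrite eq_sym; exact: delta.
Qed.

Lemma givens_orth n (a b : 'I_n) (c s : R) : a != b -> c ^+ 2 + s ^+ 2 = 1 ->
  orthonormal_cols (givens a b c s).
Proof.
move=> ab cs; rewrite /orthonormal_cols.
have ba : b != a by rewrite eq_sym.
have -> : (givens a b c s)^T = givens a b c (- s).
  apply/matrixP => i j; rewrite !mxE (eq_sym j i).
  case: (eqVneq i a) => [->|ia].
    rewrite (negbTE ab) (eq_sym a j); case: (eqVneq j a) => [->|ja].
      by rewrite (negbTE ab) !mulr0 !mulr1.
    by case: (j == b); rewrite /= !mulr0 ?mulr1 ?addr0 ?add0r.
  case: (eqVneq i b) => [->|ib].
    rewrite (eq_sym b j); case: (eqVneq j a) => [->|ja].
      by rewrite (negbTE ab) /= !mulr0 !mulr1 addr0 add0r opprK.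
    by case: (j == b); rewrite /= !mulr0 ?mulr1 ?addr0 ?add0r.
  case: (eqVneq j a) => [->|ja]; first by rewrite (negbTE ia) !mulr0 addr0.
  by case: (eqVneq j b) => [->|jb]; rewrite ?(negbTE ib) ?mulr0 ?addr0.
rewrite -[givens a b c s]mulmx1; apply/matrixP => i j.
have cs' : c * c + s * s = 1 by rewrite -!expr2.
rewrite !givensE eqxx (negbTE ba) eqxx; move: (1%:M : 'M[R]_n) => M.
case: (eqVneq i a) => [->|ia].
  have -> : c * (c * M a j + s * M b j) + - s * (- s * M a j + c * M b j) =
     (c * c + s * s) * M a j by ring.
  by rewrite cs' mul1r.
case: (eqVneq i b) => [->|ib //].
have -> : - - s * (c * M a j + s * M b j) + c * (- s * M a j + c * M b j) =
     (c * c + s * s) * M b j by ring.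
by rewrite cs' mul1r.
Qed.

(** A predicate rather than a group, so that invariance of laws passes to products by induction. The
    condition on [s] reflects the division by s in the change of variables. *)
Inductive givens_prod n : 'M[R]_n -> Prop :=
| givens_prod1 : givens_prod 1%:M
| givens_prodM a b c s H : a != b -> s != 0 -> c ^+ 2 + s ^+ 2 = 1 ->
    givens_prod H -> givens_prod (givens a b c s *m H).

Lemma givens_prod_orth n (H : 'M[R]_n) : givens_prod H -> orthonormal_cols H.
Proof.
elim=> [|a b c s {}H ab s0 cs _ IH]; first by rewrite /orthonormal_cols trmx1 mulmx1.
by rewrite /orthonormal_cols trmx_mul -mulmxA (mulmxA _^T (givens _ _ _ _)) givens_orth// mul1mx.
Qed.

(** Entries below the diagonal are cleared column by column, and downwards inside column q by
    rotating rows q and m. Columns already cleared survive, as both rows vanish there. *)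
Lemma givens_qr n p (M : 'M[R]_(n, p)) : exists2 H : 'M[R]_n, givens_prod H &
  forall (i : 'I_n) (j : 'I_p), (j < i)%N -> (H *m M) i j = 0.
Proof.
suff: forall q, (q <= p)%N -> exists2 H : 'M[R]_n, givens_prod H &
  forall (i : 'I_n) (j : 'I_p), (j < q)%N -> (j < i)%N -> (H *m M) i j = 0.
  move=> /(_ p (leqnn p))[H gH h]; exists H => // i j ji.
  by apply: h => //; exact: ltn_ord.
elim=> [_|q IH qp]; first by exists 1%:M => //; exact: givens_prod1.
have [H gH h] := IH (ltnW qp).
have [nq|qn] := leqP n q.
  exists H => // i j; rewrite ltnS => jq ji; apply: h => //.
  by rewrite (leq_trans ji)// (leq_trans (ltnW (ltn_ord i))).
pose jq := Ordinal qp; pose a := Ordinal qn.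
suff: forall m, (m <= n)%N -> exists2 H : 'M[R]_n, givens_prod H &
  (forall (i : 'I_n) (j : 'I_p), (j < q)%N -> (j < i)%N -> (H *m M) i j = 0) /\
  (forall i : 'I_n, (q < i < m)%N -> (H *m M) i jq = 0).
  move=> /(_ n (leqnn n))[H' gH' [h1 h2]]; exists H' => // i j.
  rewrite ltnS leq_eqVlt => /orP[/eqP jE ji|]; last exact: h1.
  have -> : j = jq by apply/val_inj.
  by apply: h2; rewrite -jE ji ltn_ord.
elim=> [_|m IHm mn]; first by exists H => //; split => // i; rewrite ltn0 andbF.
have [H' gH' [h1 h2]] := IHm (ltnW mn).
have [mq|qm] := leqP m q.
  exists H' => //; split => // i /andP[qi]; rewrite ltnS => im.
  by have := leq_trans im mq; rewrite leqNgt qi.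
pose b := Ordinal mn.
have ab : a != b by apply/eqP => /(congr1 val) /= e; rewrite e ltnn in qm.
set N := H' *m M in h1 h2.
(* A zero entry is left alone: its rotation would have s = 0, which [givens_prod] excludes. *)
have [y0|y0] := eqVneq (N b jq) 0.
  exists H' => //; split => // i /andP[qi]; rewrite ltnS leq_eqVlt => /orP[/eqP im|im].
    by have -> : i = b by apply/val_inj.
  by apply: h2; rewrite qi.
pose x := N a jq; pose y := N b jq.
have xy : 0 < x ^+ 2 + y ^+ 2.
  by rewrite ltr_wpDl ?sqr_ge0// lt_neqAle eq_sym sqrf_eq0 y0 sqr_ge0.
pose r := Num.sqrt (x ^+ 2 + y ^+ 2).
have r0 : r != 0 by rewrite gt_eqF// sqrtr_gt0.
have r2 : r ^+ 2 = x ^+ 2 + y ^+ 2 by rewrite sqr_sqrtr// ltW.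
exists (givens a b (x / r) (y / r) *m H').
  apply: givens_prodM => //; first by rewrite mulf_neq0// invr_eq0.
  by rewrite !expr_div_n -mulrDl -r2 divff// sqrf_eq0.
rewrite -mulmxA -/N; split => [i j jq' ji|i /andP[qi]].
  rewrite givensE; case: ifP => _; last case: ifP => _; last exact: h1.
    by rewrite !h1 ?mulr0 ?addr0//= ?(ltn_trans jq')//.
  by rewrite !h1 ?mulr0 ?addr0//= ?(ltn_trans jq')//.
rewrite ltnS givensE => im.
case: eqP => [ia|_]; first by rewrite ia ltnn in qi.
case: eqP => [ib|/eqP ib]; first by rewrite -/x -/y; field.
by apply: h2; rewrite qi ltn_neqAle im andbT.
Qed.

End Givens.

Section MatrixRotation.
Context d (T : measurableType d) (R : realType) (P : probability T R).

Lemma gaussian_mx_givens n l (G : 'I_n * 'I_l -> {RV P >-> R}) (a b : 'I_n) (c s : R) :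
  std_gaussian_entries G -> a != b -> s != 0 -> c ^+ 2 + s ^+ 2 = 1 ->
  exists2 G' : 'I_n * 'I_l -> {RV P >-> R}, std_gaussian_entries G' &
    forall t, random_mx G' t = givens a b c s *m random_mx G t.
Proof.
move=> gG ab s0 cs.
suff: forall S : seq 'I_l, uniq S ->
  exists2 G' : 'I_n * 'I_l -> {RV P >-> R}, std_gaussian_entries G' &
    forall t i j, G' (i, j) t = if j \in S then (givens a b c s *m random_mx G t) i j
                                else G (i, j) t.
  move=> /(_ (enum 'I_l) (enum_uniq _))[G' gG' h]; exists G' => // t.
  by apply/matrixP => i j; rewrite mxE h mem_enum.
elim=> [_|j0 S IH /= /andP[j0S uS]]; first by exists G.
have [G1 gG1 h1] := IH uS.
have ab0 : (a, j0) != (b, j0) by rewrite xpair_eqE negb_and ab.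
have [G2 gG2 h2] := gaussian_family_givens gG1 ab0 s0 cs.
exists G2 => // t i j; rewrite h2 !xpair_eqE inE.
have [->|jj0] := eqVneq j j0; last by rewrite !andbF h1.
rewrite !andbT /= givensE !mxE !h1 (negbTE j0S).
by case: eqP => // _; case: eqP.
Qed.

Lemma gaussian_mx_givens_prod n l (G : 'I_n * 'I_l -> {RV P >-> R}) (H : 'M[R]_n) :
  std_gaussian_entries G -> givens_prod H ->
  exists2 G' : 'I_n * 'I_l -> {RV P >-> R}, std_gaussian_entries G' &
    forall t, random_mx G' t = H *m random_mx G t.
Proof.
move=> gG; elim=> [|a b c s {}H ab s0 cs _ [G1 gG1 h1]].
  by exists G => // t; rewrite mul1mx.
have [G2 gG2 h2] := gaussian_mx_givens gG1 ab s0 cs.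
by exists G2 => // t; rewrite h2 h1 mulmxA.
Qed.

(** Once the rows above i are diagonal, column i has only its diagonal entry; it has unit norm, so
    D_ii is a sign, and the unit norm of row i leaves nothing for the rest of that row. *)
Lemma triangular_orthogonal n (D : 'M[R]_n) : orthonormal_cols D ->
  (forall i j : 'I_n, (j < i)%N -> D i j = 0) ->
  exists2 e : 'I_n -> R, (forall i, e i = 1 \/ e i = -1) &
    forall i j, D i j = e i * (i == j)%:R.
Proof.
move=> oD tri; have oD' : D *m D^T = 1%:M by apply: mulmx1C.
have col1 j : \sum_i D i j ^+ 2 = 1.
  have := congr1 (fun M : 'M[R]_n => M j j) oD; rewrite !mxE eqxx mulr1n => <-.
  by apply: eq_bigr => i _; rewrite !mxE expr2.
have row1 i : \sum_j D i j ^+ 2 = 1.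
  have := congr1 (fun M : 'M[R]_n => M i i) oD'; rewrite !mxE eqxx mulr1n => <-.
  by apply: eq_bigr => j _; rewrite !mxE expr2.
have diag m : forall i j : 'I_n, (i < m)%N -> i != j -> D i j = 0.
  elim: m => [//|m IH i j]; rewrite ltnS => im ij.
  have dii : D i i ^+ 2 = 1.
    rewrite -(col1 i) (bigD1 i)//= big1 ?addr0// => i' i'i.
    have [lt|gt|e] := ltngtP i' i; last by rewrite (val_inj e) eqxx in i'i.
      by rewrite IH ?expr0n// (leq_trans lt).
    by rewrite tri ?expr0n.
  have := row1 i; rewrite (bigD1 i)//= dii => /eqP; rewrite -subr_eq0 addrAC subrr add0r.
  rewrite psumr_eq0; last by move=> *; exact: sqr_ge0.
  move=> /allP/(_ j); rewrite mem_index_enum eq_sym ij => /(_ isT) /=.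
  by rewrite sqrf_eq0 => /eqP.
exists (fun i => D i i) => [i|i j].
  have := row1 i; rewrite (bigD1 i)//= big1 ?addr0; last first.
    by move=> j ji; rewrite (diag n)// ?expr0n// eq_sym.
  by move=> /eqP; rewrite sqrf_eq1 => /orP[]/eqP; [left|right].
by case: eqVneq => [->|ij]; rewrite ?mulr1// mulr0 (diag n).
Qed.

(** If H is a product of rotations that triangularizes U, then H U is a diagonal matrix of signs and
    U^T = (H U)^T H: rotations followed by sign changes, each of which preserves the law. *)
Lemma gaussian_mx_orthogonal n l (G : 'I_n * 'I_l -> {RV P >-> R}) (U : 'M[R]_n) :
  std_gaussian_entries G -> orthonormal_cols U ->
  exists2 G' : 'I_n * 'I_l -> {RV P >-> R}, std_gaussian_entries G' &
    forall t, random_mx G' t = U^T *m random_mx G t.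
Proof.
move=> gG oU; have [H gH tri] := givens_qr U.
have oH := givens_prod_orth gH.
have oD : orthonormal_cols (H *m U).
  by rewrite /orthonormal_cols trmx_mul -mulmxA (mulmxA H^T) oH mul1mx oU.
have [e e1 De] := triangular_orthogonal oD tri.
have [G1 gG1 h1] := gaussian_mx_givens_prod gG gH.
have [G2 gG2 h2] := gaussian_family_sign gG1 (fun i : 'I_n * 'I_l => e1 i.1).
exists G2 => // t.
have -> : U^T = (H *m U)^T *m H by rewrite trmx_mul -mulmxA oH mulmx1.
rewrite -mulmxA -h1; apply/matrixP => i j; rewrite [LHS]mxE h2 /= [RHS]mxE.
rewrite (bigD1 i)//= big1 ?addr0; last first.
  by move=> k ki; rewrite mxE De (negbTE ki) mulr0 mul0r.
by rewrite [_^T i i]mxE De eqxx mulr1 mxE.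
Qed.

End MatrixRotation.

(** * Inverse Gram matrices of Gaussian matrices *)

Section MeasurableMatrix.
Context d (T : measurableType d) (R : realType).

Definition mx_measurable m n (A : T -> 'M[R]_(m, n)) : Prop :=
  forall i j, measurable_fun setT (fun t => A t i j).

(** Writing 1 / f as f times the power -1 of f^2 reduces to the measurability of real powers; the
    factor f gives the value 0 at zeros. *)
Lemma measurable_invr (f : T -> R) :
  measurable_fun setT f -> measurable_fun setT (fun t => (f t)^-1).
Proof.
move=> mf; have -> : (fun t => (f t)^-1) = (fun t => f t * (f t ^+ 2) `^ (-1)).
  apply/funext => t; rewrite powR_inv1 ?sqr_ge0//.
  have [->|f0] := eqVneq (f t) 0; first by rewrite invr0 mul0r.
  by rewrite expr2 invfM mulrA mulfV// mul1r.
apply: measurable_funM => //.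
exact: (measurableT_comp (measurable_powR (-1)) (measurable_funX 2 mf)).
Qed.

Lemma measurable_sumT (I : Type) (s : seq I) (h : I -> T -> R) :
  (forall i, measurable_fun setT (h i)) ->
  measurable_fun setT (fun t => \sum_(i <- s) h i t).
Proof. by move=> mh; apply: (@measurable_sum _ _ _ setT I s h). Qed.

Lemma mx_measurable_mul m n p (A : T -> 'M[R]_(m, n)) (B : T -> 'M[R]_(n, p)) :
  mx_measurable A -> mx_measurable B -> mx_measurable (fun t => A t *m B t).
Proof.
move=> mA mB i j; under eq_fun do rewrite mxE.
by apply: measurable_sumT => k; exact: measurable_funM.
Qed.

Lemma mx_measurable_cst m n (A : 'M[R]_(m, n)) : mx_measurable (fun=> A).
Proof. by move=> i j; exact: measurable_cst. Qed.

Lemma mx_measurable_tr m n (A : T -> 'M[R]_(m, n)) :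
  mx_measurable A -> mx_measurable (fun t => (A t)^T).
Proof. by move=> mA i j; under eq_fun do rewrite mxE; exact: mA. Qed.

Lemma mx_measurable_add m n (A B : T -> 'M[R]_(m, n)) :
  mx_measurable A -> mx_measurable B -> mx_measurable (fun t => A t + B t).
Proof. by move=> mA mB i j; under eq_fun do rewrite mxE; exact: measurable_funD. Qed.

Lemma mx_measurable_sub m n p q (f : 'I_p -> 'I_m) (g : 'I_q -> 'I_n) (A : T -> 'M[R]_(m, n)) :
  mx_measurable A -> mx_measurable (fun t => mxsub f g (A t)).
Proof. by move=> mA i j; under eq_fun do rewrite mxE; exact: mA. Qed.

Lemma mx_measurable_scale m n (a : T -> R) (A : T -> 'M[R]_(m, n)) :
  measurable_fun setT a -> mx_measurable A -> mx_measurable (fun t => a t *: A t).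
Proof. by move=> ma mA i j; under eq_fun do rewrite mxE; exact: measurable_funM. Qed.

Lemma measurable_det n (A : T -> 'M[R]_n) :
  mx_measurable A -> measurable_fun setT (fun t => \det (A t)).
Proof.
move=> mA; rewrite /determinant; apply: measurable_sumT => s.
by apply: measurable_funM => //; apply: measurable_prod => i _.
Qed.

Lemma mx_measurable_adj n (A : T -> 'M[R]_n) :
  mx_measurable A -> mx_measurable (fun t => \adj (A t)).
Proof.
move=> mA i j; under eq_fun do rewrite mxE; rewrite /cofactor.
apply: measurable_funM => //; apply: measurable_det => a b.
by under eq_fun do rewrite !mxE; exact: mA.
Qed.

Lemma measurable_sqfrob m n (A : T -> 'M[R]_(m, n)) :
  mx_measurable A -> measurable_fun setT (fun t => sqfrob (A t)).
Proof.
move=> mA; under eq_fun do rewrite sqfrobE.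
by apply: measurable_sumT => i; apply: measurable_sumT => j; exact: measurable_funX.
Qed.

End MeasurableMatrix.

(* Division-based inverse: unlike invmx, it is visibly measurable in the
   entries (and it is 0, not M, at singular M). *)
Definition adj_inv (R : realType) n (M : 'M[R]_n) : 'M[R]_n := (\det M)^-1 *: \adj M.

Section GramInverse.
Variable R : realType.

Lemma adj_invE n (M : 'M[R]_n) : M \in unitmx -> adj_inv M = invmx M.
Proof. by move=> Mu; rewrite /adj_inv /invmx Mu. Qed.

Lemma adj_inv_singular n (M : 'M[R]_n) : M \notin unitmx -> adj_inv M = 0.
Proof. by rewrite unitmxE unitfE negbK => /eqP d0; rewrite /adj_inv d0 invr0 scale0r. Qed.

Lemma mx_measurable_adj_inv d (T : measurableType d) n (A : T -> 'M[R]_n) :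
  mx_measurable A -> mx_measurable (fun t => adj_inv (A t)).
Proof.
move=> mA; apply: mx_measurable_scale; last exact: mx_measurable_adj.
by apply: measurable_invr; exact: measurable_det.
Qed.

(** At [e = 0] this is the Gram matrix. A positive ridge serves to prove that singularity is a null
    event, which [adj_inv] hides at [e = 0] by returning 0. *)
Definition reg_gram k l (e : R) (O : 'M[R]_(k, l)) : 'M[R]_k := O *m O^T + e%:M.

Definition tail_sqr n p (v : 'cV[R]_n) : R := \sum_(a < n | (p <= a)%N) v a 0 ^+ 2.

Lemma tail_sqr_ge0 n p (v : 'cV[R]_n) : 0 <= tail_sqr p v.
Proof. by apply: sumr_ge0 => i _; exact: sqr_ge0. Qed.

Lemma reg_gram_tr k l e (O : 'M[R]_(k, l)) : (reg_gram e O)^T = reg_gram e O.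
Proof. by rewrite /reg_gram linearD /= trmx_mul trmxK tr_scalar_mx. Qed.

(** For the inverse V of W = O O^T + e, this is the diagonal of V = V W V. *)
Lemma reg_gram_adj_inv_diag k l e (O : 'M[R]_(k, l)) i : reg_gram e O \in unitmx ->
  adj_inv (reg_gram e O) i i =
    sqfrob (col i (O^T *m adj_inv (reg_gram e O))) + e * sqfrob (col i (adj_inv (reg_gram e O))).
Proof.
move=> Wu; rewrite adj_invE//; set W := reg_gram e O; set V := invmx W.
have VT : V^T = V by rewrite /V trmx_inv reg_gram_tr.
have : V = V *m W *m V by rewrite mulVmx// mul1mx.
rewrite {1}/W /reg_gram mulmxDr mulmxDl mul_mx_scalar -scalemxAl => VE.
have colsq m n (M : 'M[R]_(m, n)) j : sqfrob (col j M) = (M^T *m M) j j.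
  rewrite sqfrobE exchange_big big_ord1 mxE; apply: eq_bigr => a _.
  by rewrite !mxE expr2.
rewrite {1}VE mxE !colsq trmx_mul trmxK VT !mulmxA; congr (_ + _).
by rewrite mxE.
Qed.

Lemma reg_gram_adj_inv_ge0 k l e (O : 'M[R]_(k, l)) i : 0 <= e ->
  0 <= adj_inv (reg_gram e O) i i.
Proof.
move=> e0; have [Wu|Wn] := boolP (reg_gram e O \in unitmx).
  by rewrite reg_gram_adj_inv_diag// addr_ge0 ?mulr_ge0 ?sqfrob_ge0.
by rewrite adj_inv_singular// mxE.
Qed.

(* If H triangularizes the rows of O other than i, then v = H^T D H g (D keeps
   the coordinates >= p, g is row i) is orthogonal to the other rows, so
   O v = q e_i with q = |v|^2; test the inverse Gram matrix against v. *)
Lemma reg_gram_adj_inv_le k l p e (O : 'M[R]_(k, l)) (H : 'M[R]_l) i : 0 <= e ->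
  orthonormal_cols H ->
  (forall (a : 'I_l) (j : 'I_k), (p <= a)%N -> j != i -> (H *m O^T) a j = 0) ->
  tail_sqr p (H *m (row i O)^T) * adj_inv (reg_gram e O) i i <= 1.
Proof.
move=> e0 oH Hz.
have [Wu|Wn] := boolP (reg_gram e O \in unitmx); last first.
  by rewrite adj_inv_singular// mxE mulr0.
pose D : 'M[R]_l := diag_mx (\row_a (p <= a)%N%:R).
pose v := H^T *m (D *m (H *m (row i O)^T)).
set q := tail_sqr _ _; set Z := adj_inv _ i i.
have DE (w : 'cV[R]_l) a b : (D *m w) a b = (p <= a)%N%:R * w a b.
  by rewrite mul_diag_mx !mxE.
have qv : sqfrob v = q.
  rewrite /v sqfrob_isoL; last by rewrite /orthonormal_cols trmxK; exact: mulmx1C.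
  rewrite sqfrobE /q /tail_sqr [RHS]big_mkcond /=; apply: eq_bigr => a _.
  by rewrite big_ord1 DE; case: (p <= a)%N; rewrite ?mul1r// mul0r expr0n.
have Ov : O *m v = q *: delta_mx i 0.
  apply/colP => j; rewrite [RHS]mxE [delta_mx _ _ _ _]mxE eqxx andbT.
  have -> : (O *m v) j 0 = ((H *m O^T)^T *m (D *m (H *m (row i O)^T))) j 0.
    by rewrite /v trmx_mul trmxK !mulmxA.
  rewrite mxE; have [->|ji] := eqVneq j i; last first.
    rewrite mulr0 big1// => a _; rewrite DE mxE; case: (leqP p a) => pa; last by rewrite mul0r mulr0.
    by rewrite Hz// mul0r.
  rewrite mulr1 /q /tail_sqr [RHS]big_mkcond /=; apply: eq_bigr => a _.
  rewrite DE; have -> : (H *m O^T)^T i a = (H *m (row i O)^T) a 0.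
    by rewrite !mxE; apply: eq_bigr => b _; rewrite !mxE.
  by case: (p <= a)%N; rewrite ?mul1r ?mul0r ?mulr0 ?expr2.
pose y := col i (O^T *m adj_inv (reg_gram e O)).
have yle : sqfrob y <= Z.
  by rewrite /Z reg_gram_adj_inv_diag// lerDl mulr_ge0// sqfrob_ge0.
have yv : \tr (y^T *m v) = q * Z.
  have -> : y^T *m v = row i (adj_inv (reg_gram e O)) *m (O *m v).
    by rewrite /y tr_col trmx_mul trmxK adj_invE// trmx_inv reg_gram_tr row_mul mulmxA.
  rewrite Ov -scalemxAr linearZ /=; congr (_ * _).
  by rewrite -colE /mxtrace big_ord1 [LHS]mxE [LHS]mxE.
have := mxtrace_CauchySchwarz y v; rewrite yv qv => CS.
have Z0 : 0 <= Z := reg_gram_adj_inv_ge0 O i e0.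
have q0 : 0 <= q := tail_sqr_ge0 _ _.
have [qZ0|qZ0] := eqVneq (q * Z) 0; first by rewrite qZ0.
have qZp : 0 < q * Z by rewrite lt_neqAle eq_sym qZ0 mulr_ge0.
rewrite -(ler_pM2l qZp) mulr1 -expr2 (le_trans CS)// mulrC.
by rewrite ler_wpM2l.
Qed.

(* If v is in the kernel of the Gram matrix and N is the regularized inverse,
   then v_i = e <N e_i, v>. *)
Lemma singular_gram_large k l e (O : 'M[R]_(k, l)) : 0 < e ->
  reg_gram 0 O \notin unitmx -> reg_gram e O \in unitmx /\
  exists i, (k%:R * e)^-1 <= adj_inv (reg_gram e O) i i.
Proof.
move=> e0 Wn.
have Wu : reg_gram e O \in unitmx.
  rewrite -row_free_unit -kermx_eq0; apply/eqP/row_matrixP => i; rewrite row0.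
  have : row i (kermx (reg_gram e O)) *m reg_gram e O = 0.
    by rewrite -row_mul mulmx_ker row0.
  move: (row i _) => v h; apply/sqfrob_eq0/eqP; rewrite eq_le sqfrob_ge0 andbT.
  have : \tr (v *m reg_gram e O *m v^T) = 0 by rewrite h mul0mx mxtrace0.
  rewrite /reg_gram mulmxDr mulmxDl linearD /= mul_mx_scalar -scalemxAl linearZ /= => E.
  have : 0 <= \tr (v *m (O *m O^T) *m v^T).
    by have := sqfrob_ge0 (O^T *m v^T); rewrite /sqfrob trmx_mul !trmxK !mulmxA.
  have -> : sqfrob v = \tr (v *m v^T) by rewrite -sqfrobT /sqfrob trmxK.
  move=> E'.
  have : e * \tr (v *m v^T) <= 0 by rewrite -E lerDr.
  by rewrite pmulr_rle0.
split => //.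
have [v v0 vW] : exists2 v : 'rV[R]_k, v != 0 & v *m reg_gram 0 O = 0.
  move: Wn; rewrite -row_free_unit -kermx_eq0 => /rowV0Pn[v /sub_kermxP vW v0].
  by exists v.
set V := adj_inv (reg_gram e O).
have vV : v = e *: (v *m V).
  have : v *m reg_gram e O = e *: v.
    have -> : reg_gram e O = reg_gram 0 O + e%:M by rewrite /reg_gram raddf0 addr0.
    by rewrite mulmxDr vW add0r mul_mx_scalar.
  move=> /(congr1 (fun M => M *m V)); rewrite /V adj_invE// mulmxK// => {1}->.
  by rewrite -scalemxAl.
have coord i : v 0 i ^+ 2 <= e * (V i i * sqfrob v).
  have ei : v 0 i = e * \tr ((v^T)^T *m col i V).
    rewrite {1}vV mxE trmxK; congr (_ * _).
    rewrite /mxtrace big_ord1 !mxE; apply: eq_bigr => j _; by rewrite !mxE.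
  rewrite ei exprMn; have := mxtrace_CauchySchwarz v^T (col i V); rewrite sqfrobT => CS.
  have eV : e * sqfrob (col i V) <= V i i.
    by rewrite [leRHS]reg_gram_adj_inv_diag// lerDr sqfrob_ge0.
  rewrite expr2 -mulrA ler_pM2l//; apply: (le_trans (ler_wpM2l (ltW e0) CS)).
  by rewrite mulrCA mulrC ler_wpM2r// sqfrob_ge0.
have vp : 0 < sqfrob v.
  by rewrite lt_neqAle sqfrob_ge0 andbT eq_sym; apply: contraNneq v0 => /sqfrob_eq0 ->.
(* If every V_ii were below 1 / (k e), [coord] would give v_i^2 < |v|^2 / k for all i, and summing
   would give |v|^2 < |v|^2. *)
apply/existsP; apply: contraT; rewrite negb_exists => /forallP small.
have k0 : (0 < k)%N.
  by case: k O Wn Wu v v0 vW V vV coord vp small => // O0 _ _ v; rewrite [v]thinmx0 eqxx.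
have : sqfrob v < sqfrob v; last by rewrite ltxx.
rewrite {1}sqfrobE big_ord1.
apply: (@lt_le_trans _ _ (\sum_(i < k) k%:R^-1 * sqfrob v)); last first.
  by rewrite sumr_const card_ord -mulrnAl -[_ *+ k]mulr_natl divff ?mul1r// pnatr_eq0 -lt0n.
apply: ltr_sum; first by apply/hasP; exists (Ordinal k0) => //; rewrite mem_index_enum.
move=> i _; apply: (le_lt_trans (coord i)); rewrite mulrA ltr_pM2r//.
have := small i; rewrite -ltNge invfM => h.
by rewrite mulrC -ltr_pdivlMr.
Qed.

End GramInverse.

(** * Linear and quadratic functions of a Gaussian vector *)

Section GaussianVector.
Local Open Scope ereal_scope.
Context d (T : measurableType d) (R : realType) (P : probability T R).
Local Notation gauss := (@normal_prob R 0%R 1%R).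

Definition random_col l (X : 'I_l -> {RV P >-> R}) (t : T) : 'cV[R]_l := \col_a X a t.

Lemma gaussian_col_givens_prod l (X : 'I_l -> {RV P >-> R}) (H : 'M[R]_l) :
  gaussian_family X -> givens_prod H ->
  exists2 X' : 'I_l -> {RV P >-> R}, gaussian_family X' &
    forall t, random_col X' t = H *m random_col X t.
Proof.
move=> gX gH.
have inj1 : injective (fun ab : 'I_l * 'I_1 => ab.1).
  by move=> [a b] [a' b'] /= ->; rewrite (ord1 b) (ord1 b').
have gG : std_gaussian_entries (X \o (fun ab : 'I_l * 'I_1 => ab.1)) := gaussian_family_inj inj1 gX.
have [G' gG' h] := gaussian_mx_givens_prod gG gH.
have inj2 : injective (fun a : 'I_l => (a, ord0 : 'I_1)) by move=> a a' [].
exists (G' \o (fun a => (a, ord0))); first exact: (gaussian_family_inj inj2).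
move=> t; have -> : random_col X t = random_mx (X \o (fun ab : 'I_l * 'I_1 => ab.1)) t.
  by apply/matrixP => a b; rewrite !mxE.
by rewrite -h; apply/colP => a; rewrite !mxE.
Qed.

(** Rotations that triangularize the column [u] carry it to plus or minus the first basis vector,
    and the inner product to a signed coordinate of the rotated Gaussian vector. *)
Lemma gaussian_unit_vector l (X : 'I_l -> {RV P >-> R}) (u : 'cV[R]_l)
    (h : measurableTypeR R -> \bar R) :
  gaussian_family X -> sqfrob u = 1%R -> measurable_fun setT h -> (forall x, 0 <= h x) ->
  \int[P]_t h (\sum_a u a ord0 * X a t)%R = \int[gauss]_x h x.
Proof.
move=> gX u1 mh h0.
have [H gH tri] := givens_qr u; have oH := givens_prod_orth gH.
have l0 : (0 < l)%N.
  case: l X u gX u1 H gH tri oH => // X u _; rewrite sqfrobE big_ord0 => /eqP.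
  by rewrite eq_sym oner_eq0.
pose a0 := Ordinal l0.
have [X' gX' XE] := gaussian_col_givens_prod gX gH.
have z a : a != a0 -> (H *m u) a ord0 = 0%R.
  by move=> aa; rewrite tri// lt0n; apply: contraNneq aa => E; apply/eqP/val_inj.
have w1 : ((H *m u) a0 ord0 = 1 \/ (H *m u) a0 ord0 = -1)%R.
  have : sqfrob (H *m u) = 1%R by rewrite sqfrob_isoL.
  rewrite sqfrobE (bigD1 a0)//= big_ord1 big1 ?addr0.
    by move/eqP; rewrite sqrf_eq1 => /orP[]/eqP; [left|right].
  by move=> a aa; rewrite big_ord1 z// expr0n.
have [X'' gX'' XE2] := gaussian_family_sign gX' (fun _ : 'I_l => w1).
rewrite -(gaussian_integral a0 gX'' mh h0); apply: eq_integral => t _; congr h.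
have -> : (\sum_a u a ord0 * X a t)%R = ((H *m u)^T *m (H *m random_col X t))%R ord0 ord0.
  rewrite trmx_mul -mulmxA (mulmxA H^T) oH mul1mx mxE.
  by apply: eq_bigr => a _; rewrite !mxE.
rewrite -XE mxE (bigD1 a0)//= big1 ?addr0; first by rewrite [_^T _ _]mxE [random_col _ _ _ _]mxE XE2.
by move=> a aa; rewrite [_^T _ _]mxE z// mul0r.
Qed.

(** The Laplace transform of a chi-square variable with l - p degrees of freedom. *)
Lemma gaussian_tail_sqr_exp l p (X : 'I_l -> {RV P >-> R}) (H : 'M[R]_l) (th : R) :
  gaussian_family X -> givens_prod H -> (0 < 1 + 2 * th)%R ->
  \int[P]_t (expR (- (th * tail_sqr p (H *m random_col X t))))%:E =
  ((Num.sqrt (1 + 2 * th))^-1 ^+ (l - p))%:E.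
Proof.
move=> gX gH th0; have [X' gX' XE] := gaussian_col_givens_prod gX gH.
pose J : {set 'I_l} := finset (fun a : 'I_l => (p <= a)%N).
pose h (_ : 'I_l) (x : measurableTypeR R) : R := expR (- (th * x ^+ 2)).
have mh a : measurable_fun setT (h a).
  apply: measurableT_comp => //; apply: measurableT_comp => //.
  by apply: measurable_funM => //; exact: measurable_funX.
have h0 a x : (0 <= h a x)%R by exact: expR_ge0.
transitivity (\int[P]_t (\prod_(a in J) h a (X' a t))%:E).
  apply: eq_integral => t _; congr EFin; rewrite /h -expR_sum sumrN; congr (expR (- _)%R).
  rewrite -XE /tail_sqr -mulr_sumr; congr (_ * _)%R.
  by apply: eq_big => [a|a _]; rewrite ?inE// mxE.
rewrite independent_prod_integral//; last by case: gX'.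
have cE a : \int[P]_t (h a (X' a t))%:E = ((Num.sqrt (1 + 2 * th))^-1)%:E.
  rewrite -gauss_integral_exp_sqr//.
  rewrite -(gaussian_integral (f := fun x => (h a x)%:E) a gX')//.
    exact/measurable_EFinP.
  by move=> x; rewrite lee_fin.
rewrite (eq_bigr (fun=> ((Num.sqrt (1 + 2 * th))^-1)%:E)); last by move=> a _; exact: cE.
rewrite prodEFin prodr_const; congr ((_ ^+ _)%:E).
transitivity (\sum_(p <= i < l) 1)%N; last by rewrite sum_nat_const_nat muln1.
by rewrite big_geq_mkord -sum1_card; apply: eq_bigl => a; rewrite inE.
Qed.

End GaussianVector.

Section CoordinateMatrix.
Variables (R : realType) (n l : nat).

Definition coord_mx (x : coord_type R ('I_n * 'I_l)%type) : 'M[R]_(n, l) :=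
  \matrix_(i, j) x (i, j).

Lemma mx_measurable_coord : mx_measurable coord_mx.
Proof.
move=> i j; have -> : (fun x => coord_mx x i j) = (fun x => x (i, j)).
  by apply/funext => x; rewrite mxE.
exact: (measurable_coord (i, j)).
Qed.

Lemma mx_measurable_reg_gram d (T : measurableType d) (e : R) (O : T -> 'M[R]_(n, l)) :
  mx_measurable O -> mx_measurable (fun t => reg_gram e (O t)).
Proof.
move=> mO; apply: mx_measurable_add; last exact: mx_measurable_cst.
by apply: mx_measurable_mul => //; exact: mx_measurable_tr.
Qed.

End CoordinateMatrix.

Lemma measurable_tail_sqr_col d (T : measurableType d) (R : realType) (P : probability T R)
    l p (X : 'I_l -> {RV P >-> R}) (H : 'M[R]_l) :
  measurable_fun setT (fun t => tail_sqr p (H *m random_col X t)).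
Proof.
have mX : mx_measurable (random_col X).
  move=> a b; have -> : (fun t => random_col X t a b) = X a by apply/funext => t; rewrite mxE.
  exact: measurable_funPT.
have mHX := mx_measurable_mul (mx_measurable_cst (T := T) H) mX.
have -> : (fun t => tail_sqr p (H *m random_col X t)) =
    (fun t => \sum_(a < l) if (p <= a)%N then (H *m random_col X t) a 0 ^+ 2 else 0).
  by apply/funext => t; rewrite /tail_sqr big_mkcond.
apply: measurable_sumT => a; case: (p <= a)%N; last exact: measurable_cst.
by apply: measurable_funX; exact: mHX.
Qed.

(** * Diagonal entries of the inverse Gram matrix *)

Section GramDiagonal.
Local Open Scope ereal_scope.
Context d (T : measurableType d) (R : realType) (P : probability T R).

Variables (k l : nat) (G : 'I_k * 'I_l -> {RV P >-> R}).
Hypotheses (gG : std_gaussian_entries G).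

Definition gram_diag (e : R) (i : 'I_k) (O : 'M[R]_(k, l)) : R :=
  adj_inv (reg_gram e O) i i.

Lemma measurable_gram_diag e i :
  measurable_fun setT (fun x => gram_diag e i (coord_mx x) : measurableTypeR R).
Proof.
apply: mx_measurable_adj_inv; apply: mx_measurable_reg_gram.
exact: mx_measurable_coord.
Qed.

(** The rows other than i are frozen and triangularized by [H]. There are k - 1 of them, so they
    vanish in the coordinates from [k.-1] on, where row i contributes q with q z <= 1. The pair
    [phi], [psi] lets one argument serve the tail (an indicator below an exponential) and the mean
    (the identity below a series of exponentials). *)
Lemma gram_diag_integral_le (e : R) (i : 'I_k) (phi psi : measurableTypeR R -> \bar R) (c : \bar R) :
  (0 <= e)%R -> measurable_fun setT phi -> (forall z, 0 <= phi z) ->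
  (forall z q : R, (0 <= z)%R -> (0 <= q)%R -> (q * z <= 1)%R -> phi z <= psi q) ->
  (forall (X : 'I_l -> {RV P >-> R}) (H : 'M[R]_l), gaussian_family X -> givens_prod H ->
    \int[P]_t psi (tail_sqr k.-1 (H *m random_col X t)) <= c) ->
  \int[P]_t phi (gram_diag e i (random_mx G t)) <= c.
Proof.
move=> e0 mphi phi0 phipsi hc.
pose J : {set 'I_k * 'I_l} := finset (fun ab : 'I_k * 'I_l => ab.1 != i).
pose F x := phi (gram_diag e i (coord_mx x)).
have mF : measurable_fun setT F.
  exact: (measurableT_comp mphi (measurable_gram_diag e i)).
rewrite -[leLHS]/(\int[P]_t F (joint G t)).
apply: (ge0_decoupling_le (proj1 gG) (J := J) mF) => [x|t]; first exact: phi0.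
pose X : 'I_l -> {RV P >-> R} := G \o (fun b => (i, b)).
have gX : gaussian_family X by apply: gaussian_family_inj gG => b b' [].
pose O0 := random_mx G t.
have [H gH tri] := givens_qr (row' i O0)^T.
apply: le_trans (hc X H gX gH); apply: ge0_le_lower_integral => u; first exact: phi0.
rewrite /F; set O := coord_mx _.
have Orow j : j != i -> row j O = row j O0.
  by move=> ji; apply/rowP => b; rewrite !mxE /mix inE /= ji.
have Oi : (row i O)^T = random_col X u.
  by apply/colP => b; rewrite !mxE /mix inE /= eqxx.
apply: phipsi; first exact: reg_gram_adj_inv_ge0.
  exact: tail_sqr_ge0.
rewrite -Oi; apply: reg_gram_adj_inv_le => //; first exact: givens_prod_orth.
move=> a j ka ji; have [j' jE|jE] := unliftP i j; last by rewrite jE eqxx in ji.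
have -> : (H *m O^T)%R a j = (H *m (row' i O0)^T)%R a j'.
  rewrite !mxE; apply: eq_bigr => b _; congr (_ * _)%R.
  by have /rowP/(_ b) := Orow j ji; rewrite !mxE -jE.
by apply: tri; exact: leq_trans (ltn_ord j') ka.
Qed.

Hypotheses (k0 : (0 < k)%N) (kl : (k <= l)%N).
Let m := (l - k.-1)%N.

Lemma gram_df : m%:R = (l%:R - k%:R + 1)%R :> R.
Proof. by rewrite /m natrB ?(leq_trans (leq_pred _))// -[in RHS](prednK k0) -natr1 opprD addrA subrK. Qed.

Let m0 : (0 < m%:R :> R)%R.
Proof. by rewrite ltr0n subn_gt0 prednK. Qed.

Lemma powR_half (x : R) j : (0 <= x)%R -> (Num.sqrt x ^+ j = x `^ (j%:R / 2))%R.
Proof. by move=> x0; rewrite -powR12_sqrt// -powR_mulrn ?powR_ge0// -powRrM mulrC. Qed.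

Lemma measurable_gram_diag_rv e i :
  measurable_fun setT (fun t => gram_diag e i (random_mx G t) : measurableTypeR R).
Proof. exact: (measurableT_comp (measurable_gram_diag e i) (measurable_joint G)). Qed.

(** Chernoff for the event q <= 1 / z, with q chi-square: the bound is exp (th / z) (1 + 2 th)^(- m
    / 2). *)
Lemma gram_diag_tail (e : R) (i : 'I_k) (z : R) : (0 <= e)%R -> (0 < z)%R ->
  P [set t | (z <= gram_diag e i (random_mx G t))%R] <=
    ((expR 1 / (m%:R * z)) `^ (m%:R / 2))%:E.
Proof.
move=> e0 z0.
pose A : set (measurableTypeR R) := [set` `[z, +oo[]%R.
have mA : measurable A by exact: measurable_itv.
pose phi (y : measurableTypeR R) : \bar R := (\1_A y)%:E.
have mphi : measurable_fun setT phi by apply/measurable_EFinP; exact: measurable_indic.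
pose S := (fun t => gram_diag e i (random_mx G t)) @^-1` A.
have mS : measurable S.
  by have := measurable_gram_diag_rv e i measurableT mA; rewrite setTI.
have SE : [set t | (z <= gram_diag e i (random_mx G t))%R] = S.
  by apply/seteqP; split => t; rewrite /S /A /= in_itv /= andbT.
rewrite SE.
(* For m z < 1 the right-hand side is at least 1, while the [th] chosen below would be negative. *)
have [mz|mz] := ltP (m%:R * z)%R 1%R.
  apply: (le_trans (probability_le1 P mS)).
  rewrite lee_fin -[leLHS](congr1 (fun f => f (m%:R / 2)%R) (@powR1 R)).
  rewrite ge0_ler_powR ?nnegrE ?divr_ge0 ?expR_ge0 ?(ltW (mulr_gt0 _ _))//.
  rewrite ler_pdivlMr ?mulr_gt0// mul1r (le_trans (ltW mz))// -[leLHS]expR0 ler_expR.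
  exact: ler01.
(* The minimizer of the Chernoff bound, 1 + 2 th = m z. Then th / z = m / 2 - 1 / (2 z), of which
   only m / 2 is kept. *)
pose th : R := ((m%:R * z - 1) / 2)%R.
have th0 : (0 <= th)%R by rewrite divr_ge0// subr_ge0.
have th1 : (1 + 2 * th = m%:R * z)%R by rewrite /th; field.
pose psi (q : measurableTypeR R) : \bar R := (expR (th / z) * expR (- (th * q)))%:E.
have -> : P S = \int[P]_t phi (gram_diag e i (random_mx G t)).
  by rewrite -[LHS](_ : \int[P]_t (\1_S t)%:E = _)// integral_indic// setIT.
pose c : R := (expR (th / z) * (Num.sqrt (1 + 2 * th))^-1 ^+ m)%R.
apply: (@le_trans _ _ c%:E).
  apply: (@gram_diag_integral_le e i phi psi c%:E) => //.
  - by move=> y; rewrite lee_fin.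
  - move=> y q y0 q0 qy; rewrite /phi /psi lee_fin indicE.
    case: (boolP (y \in A)) => [|_]; last by rewrite mulr_ge0// expR_ge0.
    rewrite inE /A /= in_itv /= andbT => zy.
    rewrite -expRD -[leLHS]expR0 ler_expR subr_ge0 ler_wpM2l//.
    rewrite -[leRHS]mul1r ler_pdivlMr// (le_trans _ qy)//.
    by rewrite ler_wpM2l.
  - move=> X H gX gH; rewrite /psi; under eq_integral do rewrite EFinM.
    rewrite ge0_integralZl//; last first.
      apply/measurable_EFinP; apply: measurableT_comp => //; apply: measurableT_comp => //.
      by apply: measurable_funM => //; exact: measurable_tail_sqr_col.
    by rewrite gaussian_tail_sqr_exp// th1 mulr_gt0.
rewrite lee_fin /c th1 -sqrtrV ?mulr_ge0 ?ler0n ?(ltW z0)// powR_half ?invr_ge0 ?mulr_ge0 ?ler0n ?(ltW z0)//.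
rewrite powRM ?expR_ge0 ?invr_ge0 ?mulr_ge0 ?ler0n ?(ltW z0)// ler_wpM2r ?powR_ge0//.
rewrite -expRM mul1r ler_expR ler_pdivrMr// /th.
lra.
Qed.

End GramDiagonal.

(** * Riemann sums and counting inequalities *)

Section RealSums.
Variable R : realType.

Lemma bernoulli_ineq (x : R) n : 0 <= x -> 1 + n%:R * (x - 1) <= x ^+ n.
Proof.
move=> x0; elim: n => [|n IH]; first by rewrite mul0r addr0 expr0.
rewrite exprS; apply: le_trans (ler_wpM2l x0 IH).
rewrite -natr1 -subr_ge0.
have -> : x * (1 + n%:R * (x - 1)) - (1 + (n%:R + 1) * (x - 1)) = n%:R * (x - 1) ^+ 2 by ring.
by rewrite mulr_ge0// sqr_ge0.
Qed.

(** The integral of s^-(r+3) against s ds over [u, v] is bounded below by the value at v; the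
    right-hand side is that integral. In terms of x = v / u it reduces to Bernoulli's inequality. *)
Lemma inv_power_telescope (u v : R) r : 0 < u -> u <= v ->
  (v ^+ 2 - u ^+ 2) / 2 * v^-1 ^+ r.+3 <= (u^-1 ^+ r.+1 - v^-1 ^+ r.+1) / r.+1%:R.
Proof.
move=> u0 uv; have v0 : 0 < v := lt_le_trans u0 uv.
have v0' : v != 0 by rewrite gt_eqF.
have u0' : u != 0 by rewrite gt_eqF.
pose x := v / u; have x1 : 1 <= x by rewrite ler_pdivlMr// mul1r.
have r0 : 0 < r.+1%:R :> R by rewrite ltr0n.
have -> : u^-1 ^+ r.+1 = x ^+ r.+1 * v^-1 ^+ r.+1.
  by rewrite -exprMn /x mulrAC divff// mul1r.
have -> : x ^+ r.+1 * v^-1 ^+ r.+1 - v^-1 ^+ r.+1 = (x ^+ r.+1 - 1) * v^-1 ^+ r.+1 by ring.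
rewrite [leRHS]mulrAC.
have -> : (v ^+ 2 - u ^+ 2) / 2 * v^-1 ^+ r.+3 = (v ^+ 2 - u ^+ 2) / 2 * v^-1 ^+ 2 * v^-1 ^+ r.+1.
  by rewrite -[r.+3]/(2 + r.+1)%N exprD mulrA.
rewrite ler_wpM2r ?exprn_ge0 ?invr_ge0 ?(ltW v0)//.
apply: (@le_trans _ _ (x - 1)); last first.
  rewrite ler_pdivlMr// mulrC lerBrDl; apply: bernoulli_ineq.
  exact: le_trans ler01 x1.
have -> : (v ^+ 2 - u ^+ 2) / 2 * v^-1 ^+ 2 = (x - 1) * ((x + 1) / (2 * x ^+ 2)).
  by rewrite /x; field; rewrite u0' v0'.
rewrite ler_piMr ?subr_ge0// ler_pdivrMr; last first.
  by rewrite mulr_gt0// exprn_gt0// (lt_le_trans ltr01 x1).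
rewrite mul1r; nra.
Qed.

(** A Riemann sum of the integral of (1 + 2 x)^(-(r+3)/2) over the half line, which is 1 / (r + 1).
    Its first term h is kept apart and the others telescope in s_j = sqrt (1 + 2 h j). *)
Lemma inv_sqrt_power_sum (h : R) r N : 0 < h ->
  \sum_(0 <= j < N) h * (Num.sqrt (1 + 2 * (h * j%:R)))^-1 ^+ r.+3 <= h + r.+1%:R^-1.
Proof.
move=> h0; have r0 : 0 < r.+1%:R :> R by rewrite ltr0n.
pose s j := Num.sqrt (1 + 2 * (h * j%:R)).
have arg0 j : 0 < 1 + 2 * (h * j%:R) by rewrite ltr_wpDr// !mulr_ge0// ltW.
have s0 j : 0 < s j by rewrite sqrtr_gt0.
have sle j : s j <= s j.+1.
  by rewrite ler_wsqrtr// lerD2l ler_pM2l// ler_pM2l// ler_nat.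
have sdiff j : (s j.+1 ^+ 2 - s j ^+ 2) / 2 = h.
  by rewrite !sqr_sqrtr ?ltW// -natr1; field.
case: N => [|N]; first by rewrite big_geq// addr_ge0 ?invr_ge0 ?ltW.
suff: \sum_(0 <= j < N.+1) h * (s j)^-1 ^+ r.+3 <= h + (1 - (s N)^-1 ^+ r.+1) / r.+1%:R.
  move=> /le_trans; apply; rewrite lerD2l ler_pdivrMr// mulVf ?gt_eqF//.
  by rewrite gerBl exprn_ge0// invr_ge0 ltW.
elim: N => [|N IH].
  by rewrite big_nat1 /s mulr0 mulr0 addr0 sqrtr1 invr1 !expr1n subrr mul0r addr0 mulr1.
rewrite big_nat_recr//=; apply: (le_trans (lerD IH (lexx _))).
rewrite -addrA lerD2l -{1}(sdiff N).
apply: (le_trans (lerD (lexx _) (inv_power_telescope r (s0 N) (sle N)))).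
by rewrite -mulrDl addrA subrK.
Qed.

(* Left Riemann sum of [exp (- q x)] over the half line:
   (1 - exp (- h q)) z <= h q z <= h. *)
Lemma exp_series_ge (h z q : R) : 0 < h -> 0 <= z -> 0 <= q -> q * z <= 1 ->
  (z%:E <= \sum_(j <oo) (h * expR (- (h * j%:R * q)))%:E)%E.
Proof.
move=> h0 z0 q0 qz.
pose x := expR (- (h * q)).
have x0 : 0 < x by exact: expR_gt0.
have x1 : x <= 1 by rewrite expR_le1 oppr_le0 mulr_ge0// ltW.
have xE j : expR (- (h * j%:R * q)) = x ^+ j.
  by rewrite /x -expRM_natl; congr expR; ring.
have part N : (z * (1 - x ^+ N) <= \sum_(0 <= j < N) h * x ^+ j).
  have -> : z * (1 - x ^+ N) = \sum_(0 <= j < N) (z * (1 - x)) * x ^+ j.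
    by rewrite -mulr_sumr -mulrA big_mkord -(opprB x) -(opprB (x ^+ N)) subrX1 mulNr.
  apply: ler_sum => j _; rewrite ler_wpM2r ?exprn_ge0 ?(ltW x0)//.
  have := expR_ge1Dx (- (h * q)); rewrite -/x => hx.
  have : 1 - x <= h * q by rewrite lerBlDr -lerBlDl; lra.
  move=> /(ler_wpM2l z0)/le_trans; apply.
  by rewrite mulrCA -[leRHS]mulr1 ler_wpM2l ?(ltW h0)// mulrC.
have ge N : ((\sum_(0 <= j < N) h * x ^+ j)%:E <= \sum_(j <oo) (h * expR (- (h * j%:R * q)))%:E)%E.
  apply: le_trans (nneseries_lim_ge N _).
    by rewrite -sumEFin lee_sum// => j _; rewrite xE.
  by move=> j _ _; rewrite lee_fin mulr_ge0 ?expR_ge0// ltW.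
have [x_lt1|x_ge1] := ltP x 1.
  apply/lee_addgt0Pr => e e0.
  have : (fun N => z * x ^+ N) @ \oo --> (z * 0).
    apply: cvgM; first exact: cvg_cst.
    by apply: cvg_expr; rewrite gtr0_norm.
  rewrite mulr0 => /cvgr0_norm_lt/(_ e e0)[N _ /(_ N (leqnn N))] /= Ne.
  apply: (@le_trans _ _ ((\sum_(0 <= j < N) h * x ^+ j)%:E + e%:E)%E); last by rewrite leeD2r.
  rewrite -EFinD lee_fin; have := part N; rewrite mulrBr mulr1 => P.
  by have := ler_norm (z * x ^+ N); lra.
(* Here q = 0 and all terms equal h: finitely many of them already exceed z. *)
have xx : x = 1 by apply/eqP; rewrite eq_le x1.
have [N Nz] : exists N : nat, z / h <= N%:R.
  by exists (Num.bound (z / h)); rewrite ltW// archi_boundP// divr_ge0// ltW.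
apply: le_trans (ge N); rewrite lee_fin xx.
under eq_bigr do rewrite expr1n mulr1.
by rewrite sumr_const_nat subn0 -mulr_natl -ler_pdivrMr.
Qed.

End RealSums.

Section CountingSums.
Variable R : realType.

(** The index j = 0 makes up for rounding: for y >= 0 the count is the smaller of N and floor y +
    1. *)
Lemma le_count_below (y : R) N : y <= N%:R -> y <= \sum_(j < N) (j%:R <= y)%R%:R.
Proof.
elim: N => [|N IH] yN; first by rewrite big_ord0.
have [yN'|Ny] := leP y N%:R.
  by rewrite big_ord_recr /=; apply: (le_trans (IH yN')); rewrite lerDl ler0n.
apply: (le_trans yN); rewrite (eq_bigr (fun=> 1)).
  by rewrite sumr_const card_ord.
by move=> j _; rewrite (_ : _ <= y)// (le_trans _ (ltW Ny))// ler_nat -ltnS.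
Qed.

(** Telescoping of 1 / v <= 2 (v - u), which holds because 2 (v - u) v = 1 + (v - u)^2 when v^2 =
    u^2 + 1. *)
Lemma sum_inv_sqrt_le N : \sum_(0 <= j < N) (Num.sqrt j.+1%:R)^-1 <= 2 * Num.sqrt N%:R :> R.
Proof.
elim: N => [|N IH]; first by rewrite big_geq// mulr_ge0// sqrtr_ge0.
rewrite big_nat_recr//=; apply: (le_trans (lerD IH (lexx _))).
set u : R := Num.sqrt N%:R; set v : R := Num.sqrt N.+1%:R.
have u0 : 0 <= u by exact: sqrtr_ge0.
have v0 : 0 < v by rewrite sqrtr_gt0 ltr0n.
have u2 : u ^+ 2 = N%:R by rewrite sqr_sqrtr.
have v2 : v ^+ 2 = u ^+ 2 + 1 by rewrite u2 sqr_sqrtr// natr1.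
rewrite -lerBrDl -div1r ler_pdivrMr//.
have -> : (2 * v - 2 * u) * v = 1 + (v - u) ^+ 2 by lra.
by rewrite lerDl sqr_ge0.
Qed.

End CountingSums.

(** * Mean and tail of the trace of the inverse Gram matrix *)

Section GramMoments.
Local Open Scope ereal_scope.
Context d (T : measurableType d) (R : realType) (P : probability T R).

(** Markov's inequality for the number of events [E i] that occur. *)
Lemma probability_count_le (I : finType) (S : set T) (E : I -> set T) (w : R) :
  measurable S -> (forall i, measurable (E i)) -> (0 <= w)%R ->
  (forall t, S t -> (w <= \sum_i \1_(E i) t)%R) ->
  w%:E * P S <= \sum_i P (E i).
Proof.
move=> mS mE w0 h.
have -> : w%:E * P S = \int[P]_t (w%:E * (\1_S t)%:E).
  rewrite ge0_integralZl//; last exact/measurable_EFinP/measurable_indic.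
  by rewrite integral_indic// setIT.
have -> : \sum_i P (E i) = \int[P]_t (\sum_i (\1_(E i) t)%:E).
  rewrite ge0_integral_sum//; last by move=> i; exact/measurable_EFinP/measurable_indic.
  by apply: eq_bigr => i _; rewrite integral_indic// setIT.
apply: ge0_le_lower_integral => t.
  by rewrite mule_ge0// lee_fin.
rewrite sumEFin -EFinM lee_fin [\1_S t]indicE.
case: (boolP (t \in S)) => [|_]; first by rewrite inE mulr1; exact: h.
by rewrite mulr0 sumr_ge0.
Qed.

Variables (k l : nat) (G : 'I_k * 'I_l -> {RV P >-> R}).
Hypotheses (gG : std_gaussian_entries G).

(** The inverse of q is the integral of exp (- q x) over x > 0; discretized with step h, it is a
    series whose terms have known expectations. With m = r + 3 degrees of freedom the limit is 1 /
    (m - 2). *)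
Lemma gram_diag_mean (e : R) (i : 'I_k) r : (0 <= e)%R -> (l - k.-1 = r.+3)%N ->
  \int[P]_t (gram_diag e i (random_mx G t))%:E <= (r.+1%:R^-1)%:E.
Proof.
move=> e0 mE; apply/lee_addgt0Pr => h h0.
(* The absolute value makes [phi] nonnegative on the whole line; the diagonal entries themselves are
   nonnegative. *)
pose phi (z : measurableTypeR R) : \bar R := (`|z|%R)%:E.
pose psi (q : measurableTypeR R) : \bar R := \sum_(j <oo) (h * expR (- (h * j%:R * q)))%:E.
have -> : \int[P]_t (gram_diag e i (random_mx G t))%:E =
    \int[P]_t phi (gram_diag e i (random_mx G t)).
  apply: eq_integral => t _; rewrite /phi ger0_norm//.
  exact: reg_gram_adj_inv_ge0.
apply: (@gram_diag_integral_le _ _ _ _ _ _ G gG e i phi psi _ e0).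
- by apply/measurable_EFinP; exact: normr_measurable.
- by move=> z; rewrite lee_fin.
- by move=> z q z0 q0 qz; rewrite /phi ger0_norm//; exact: exp_series_ge.
move=> X H gX gH; rewrite /psi.
have term0 j q : 0 <= (h * expR (- (h * j%:R * q)))%:E.
  by rewrite lee_fin mulr_ge0 ?expR_ge0// ltW.
have mterm j : measurable_fun setT (fun t => expR (- (h * j%:R * tail_sqr k.-1 (H *m random_col X t)))%R).
  apply: measurableT_comp => //; apply: measurableT_comp => //.
  by apply: measurable_funM => //; exact: measurable_tail_sqr_col.
rewrite integral_nneseries//; last first.
  by move=> j; apply/measurable_EFinP; apply: measurable_funM.
have -> : \sum_(j <oo) \int[P]_t (h * expR (- (h * j%:R * tail_sqr k.-1 (H *m random_col X t))))%:E
    = \sum_(j <oo) (h * (Num.sqrt (1 + 2 * (h * j%:R)))^-1 ^+ r.+3)%:E.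
  apply: eq_eseriesr => j _; under eq_integral do rewrite EFinM.
  rewrite ge0_integralZl//; [|exact/measurable_EFinP|by rewrite lee_fin ltW].
  rewrite gaussian_tail_sqr_exp// ?mE//.
  by rewrite ltr_wpDr// !mulr_ge0// ltW.
apply: lime_le.
  apply: is_cvg_nneseries => j _ _; rewrite lee_fin mulr_ge0 ?(ltW h0)//.
apply: nearW => N; rewrite sumEFin -EFinD lee_fin addrC.
exact: inv_sqrt_power_sum.
Qed.

Hypotheses (k0 : (0 < k)%N) (kl : (k <= l)%N).
Let m := (l - k.-1)%N.

Let m0 : (0 < m%:R :> R)%R.
Proof. by rewrite ltr0n subn_gt0 prednK. Qed.

Lemma measurable_gram_event e i z :
  measurable [set t | (z <= gram_diag e i (random_mx G t))%R].
Proof.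
have := measurable_gram_diag_rv G e i measurableT (measurable_itv `[z, +oo[).
rewrite setTI; congr (measurable _); apply/seteqP; split => t /=; rewrite in_itv /= andbT//.
Qed.

(** A union bound over the events Z_i >= x would cost a factor k. Counting the pairs (i, j) for
    which Z_i passes the j-th of N + 1 thresholds, Markov's inequality gives 2 sqrt k B + k / (N +
    1), and N is arbitrary. *)
Lemma gram_trace_tail (x : R) : (0 < x)%R ->
  P [set t | (k%:R * x <= \sum_i gram_diag 0 i (random_mx G t))%R] <=
    (2 * Num.sqrt k%:R * (expR 1 / (m%:R * x)) `^ (m%:R / 2))%:E.
Proof.
move=> x0; set B := (_ `^ _)%R.
have B0 : (0 <= B)%R by exact: powR_ge0.
have kR0 : (0 < k%:R :> R)%R by rewrite ltr0n.
pose Z i t := gram_diag 0 i (random_mx G t).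
have Z0 i t : (0 <= Z i t)%R by exact: reg_gram_adj_inv_ge0.
set S := [set t | _].
have mS : measurable S.
  have : measurable_fun setT (fun t => \sum_i Z i t)%R.
    by apply: measurable_sumT => i; exact: measurable_gram_diag_rv.
  move=> /(_ measurableT _ (measurable_itv `[(k%:R * x)%R, +oo[)); rewrite setTI.
  by congr (measurable _); apply/seteqP; split => t /=; rewrite in_itv /= andbT.
apply/lee_addgt0Pr => h h0.
have [N hN] : exists N, (k%:R / N.+1%:R <= h)%R.
  exists (Num.bound (k%:R / h)); rewrite ler_pdivrMr// mulrC -ler_pdivrMr//.
  rewrite (@le_trans _ _ (Num.bound (k%:R / h))%:R)// ?ler_nat// ltW//.
  by rewrite archi_boundP// divr_ge0// ltW.
(* Passing threshold j means j <= (N + 1) (Z_i / x)^m / k, so row i passes at least that many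
   thresholds, up to N + 1. *)
pose a j : R := (x * (j%:R * k%:R / N.+1%:R) `^ m%:R^-1)%R.
pose E (ij : 'I_k * 'I_N.+1) := [set t | (a ij.2 <= Z ij.1 t)%R].
have mE ij : measurable (E ij) by exact: measurable_gram_event.
have count t : S t -> (N.+1%:R <= \sum_ij \1_(E ij) t :> R)%R.
  move=> St.
  rewrite -(pair_bigA _ (fun i j => \1_(E (i, j)) t)) /=.
  pose y i := Num.min N.+1%:R (N.+1%:R * (Z i t / x) ^+ m / k%:R)%R.
  have y0 i : (0 <= y i)%R.
    by rewrite le_min ler0n /= divr_ge0// mulr_ge0// exprn_ge0// divr_ge0// ltW.
  have yle i : (y i <= \sum_(j < N.+1) \1_(E (i, j)) t)%R.
    have /le_count_below/le_trans : (y i <= N.+1%:R)%R by rewrite ge_min lexx.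
    apply; apply: ler_sum => j _; rewrite indicE.
    have [jy|_] := boolP (j%:R <= y i)%R; last by rewrite ler0n.
    rewrite (_ : t \in E (i, j))//; apply/mem_set; rewrite /E /= /a.
    rewrite mulrC -ler_pdivlMr//.
    have -> : (Z i t / x = ((Z i t / x) ^+ m) `^ m%:R^-1)%R.
      by rewrite -powR_mulrn ?divr_ge0 ?(ltW x0)// -powRrM mulfV ?gt_eqF// powRr1 ?divr_ge0 ?(ltW x0).
    apply: ge0_ler_powR; rewrite ?invr_ge0 ?nnegrE ?exprn_ge0 ?divr_ge0 ?mulr_ge0 ?ler0n ?(ltW x0)//.
    rewrite ler_pdivrMr// -ler_pdivlMr// [X in (X / _)%R]mulrC.
    by apply: (le_trans jy); rewrite ge_min [X in _ || X]lexx orbT.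
  have {yle} : (\sum_i y i <= \sum_i \sum_(j < N.+1) \1_(E (i, j)) t)%R by exact: ler_sum.
  move=> /(le_trans _); apply.
  (* A saturated row supplies all N + 1 pairs. Otherwise no minimum is capped, and Bernoulli's
     inequality bounds the sum of the (Z_i / x)^m below by k. *)
  have [[i yi]|big] := pselect (exists i, y i = N.+1%:R).
    by rewrite (bigD1 i)//= yi lerDl sumr_ge0.
  apply: (@le_trans _ _ (\sum_i N.+1%:R / k%:R * (1 + m%:R * (Z i t / x - 1)))%R).
    rewrite -mulr_sumr big_split /= -mulr_sumr sumrB -mulr_suml.
    rewrite !sumr_const card_ord -mulrA -[leLHS]mulr1 ler_pM2l//.
    rewrite ler_pdivlMl// mulr1 lerDl mulr_ge0// subr_ge0 ler_pdivlMr//.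
  apply: ler_sum => i _; apply: (@le_trans _ _ (N.+1%:R * (Z i t / x) ^+ m / k%:R)%R).
    rewrite [leRHS]mulrAC ler_wpM2l ?divr_ge0//; apply: bernoulli_ineq.
    by rewrite divr_ge0// ltW.
  have : y i != N.+1%:R by apply/eqP => yi; apply: big; exists i.
  by rewrite /y minElt; case: ifP; rewrite ?eqxx.
have := probability_count_le mS mE (ler0n _ _) count.
(* The m-th powers turn the tail exponent m / 2 into 1 / 2 whatever m is, so the sum over j grows
   like sqrt N. The threshold at j = 0 is 0 and only has the trivial bound. *)
have PE i j : P (E (i, j)) <= (if j == 0%N :> nat then 1%R else
     B * Num.sqrt (N.+1%:R / k%:R) * (Num.sqrt j%:R)^-1)%R%:E.
  case: ifPn => [_|j0]; first exact: probability_le1.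
  have b0 : (0 < j%:R * k%:R / N.+1%:R :> R)%R.
    by rewrite divr_gt0// mulr_gt0// ltr0n lt0n.
  apply: le_trans (gram_diag_tail gG k0 kl i (lexx 0%R) _) _; rewrite /a.
    by rewrite mulr_gt0// powR_gt0.
  rewrite lee_fin.
  have -> : (expR 1 / (m%:R * (x * (j%:R * k%:R / N.+1%:R) `^ m%:R^-1)) =
      expR 1 / (m%:R * x) * (j%:R * k%:R / N.+1%:R) `^ (- m%:R^-1))%R.
    by rewrite powRN mulrA invfM mulrA.
  rewrite powRM ?divr_ge0 ?powR_ge0 ?expR_ge0 ?mulr_ge0 ?ler0n ?(ltW x0)// -/B.
  rewrite -[leRHS]mulrA ler_wpM2l// -powRrM.
  have -> : (- m%:R^-1 * (m%:R / 2) = - 2^-1 :> R)%R by rewrite mulNr mulKf// gt_eqF.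
  rewrite powRN powR12_sqrt ?(ltW b0)// -!sqrtrV// ?(ltW b0)// -sqrtrM ?divr_ge0//.
  rewrite ler_wsqrtr// !invfM invrK. by rewrite mulrC mulrA [leLHS]mulrAC.
have sumE : \sum_ij P (E ij) <=
    (k%:R * (1 + B * Num.sqrt (N.+1%:R / k%:R) * (2 * Num.sqrt N.+1%:R)))%:E.
  rewrite -(pair_bigA _ (fun i j => P (E (i, j)))) /= EFinM.
  rewrite [X in X * _](_ : _ = \sum_(i < k) 1); last first.
    by rewrite sumEFin sumr_const card_ord.
  rewrite ge0_sume_distrl// lee_sum// => i _; rewrite mul1e.
  apply: le_trans (lee_sum _ (fun j _ => PE i j)) _.
  rewrite sumEFin lee_fin big_ord_recl /= lerD2l.
  rewrite -mulr_sumr ler_wpM2l ?mulr_ge0 ?sqrtr_ge0//.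
  rewrite -(big_mkord xpredT (fun j => (Num.sqrt j.+1%:R)^-1))%R.
  by apply: (le_trans (sum_inv_sqrt_le _ N)); rewrite ler_pM2l// ler_wsqrtr// ler_nat.
move=> /le_trans/(_ sumE).
rewrite -lee_pdivlMl// -EFinM => /le_trans; apply.
rewrite -EFinD lee_fin mulrDr mulr1 mulrDr.
rewrite addrC lerD//; last by rewrite mulrC.
rewrite sqrtrM// sqrtrV//.
set u := Num.sqrt N.+1%:R; set v := Num.sqrt k%:R.
have -> : N.+1%:R = (u ^+ 2)%R by rewrite sqr_sqrtr.
have -> : k%:R = (v ^+ 2)%R by rewrite sqr_sqrtr.
have u0 : u != 0%R by rewrite gt_eqF// sqrtr_gt0 ltr0n.
have v0 : v != 0%R by rewrite gt_eqF// sqrtr_gt0.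
rewrite le_eqVlt; apply/orP; left; apply/eqP; field.
by rewrite u0 v0.
Qed.

Lemma mx_measurable_random n' l' (G' : 'I_n' * 'I_l' -> {RV P >-> R}) :
  mx_measurable (random_mx G').
Proof.
move=> i j; have -> : (fun t => random_mx G' t i j) = G' (i, j).
  by apply/funext => t; rewrite mxE.
exact: measurable_funPT.
Qed.

Lemma measurable_singular_gram :
  measurable [set t | reg_gram 0 (random_mx G t) \notin unitmx].
Proof.
have := measurable_det (mx_measurable_reg_gram 0%R (mx_measurable_random G)).
move=> /(_ measurableT _ (measurable_set1 0%R)); rewrite setTI.
by congr (measurable _); apply/seteqP; split => t /=; rewrite unitmxE unitfE negbK => /eqP.
Qed.

(** By [singular_gram_large], a singular Gram matrix forces an entry of size 1 / (k e) in the
    inverse with ridge e, for every e > 0; the tail bound makes this event of probability of order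
    e^(m/2). *)
Lemma singular_gram_null : P [set t | reg_gram 0 (random_mx G t) \notin unitmx] = 0.
Proof.
have kR0 : (0 < k%:R :> R)%R by rewrite ltr0n.
apply/eqP; rewrite eq_le measure_ge0 andbT; apply/lee_addgt0Pr => h h0; rewrite add0e.
pose c : R := (expR 1 / (m%:R * k%:R^-1))%R.
have c0 : (0 < c)%R by rewrite divr_gt0 ?expR_gt0// divr_gt0.
have hk : (0 < h / k%:R)%R by rewrite divr_gt0.
(* Chosen so that the tail bound (c e)^(m/2) equals h / k for each of the k entries. *)
pose e : R := ((h / k%:R) `^ (2 / m%:R) / c)%R.
have e0 : (0 < e)%R by rewrite divr_gt0// powR_gt0.
pose z : R := ((k%:R * e)^-1)%R; have z0 : (0 < z)%R by rewrite invr_gt0 mulr_gt0.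
rewrite -[leLHS]mul1e.
apply: le_trans (@probability_count_le 'I_k _ (fun i => [set t | (z <= gram_diag e i (random_mx G t))%R])
  1 measurable_singular_gram _ ler01 _) _.
- by move=> i; exact: measurable_gram_event.
- move=> t /(singular_gram_large e0)[_ [i zi]].
  by rewrite (bigD1 i)//= indicE mem_set// lerDl sumr_ge0.
apply: (@le_trans _ _ (\sum_(i < k) (h / k%:R)%:E)); last first.
  by rewrite sumEFin sumr_const card_ord lee_fin -[(_ *+ k)%R]mulr_natl mulrC divfK ?gt_eqF.
apply: lee_sum => i _; apply: le_trans (gram_diag_tail gG k0 kl i (ltW e0) z0) _.
have -> : (expR 1 / (m%:R * z) = c * e)%R.
  by rewrite /c /z; field; rewrite !gt_eqF.
rewrite /e mulrC divfK ?gt_eqF// -powRrM.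
have -> : (2 / m%:R * (m%:R / 2) = 1 :> R)%R by field; rewrite gt_eqF.
by rewrite powRr1 ?(ltW hk).
Qed.

End GramMoments.

(** * Products with a Gaussian matrix *)

Section GaussianQuadratic.
Local Open Scope ereal_scope.
Variable R : realType.
Local Notation gauss := (@normal_prob R 0%R 1%R).

(** The exponent 3/8 makes 1 - 2 (3/8) the square of 1/2. *)
Lemma gauss_exp_sqr : \int[gauss]_x (expR (3 / 8 * x ^+ 2))%:E = 2%:E.
Proof.
have th0 : (0 < 1 + 2 * (- (3 / 8)) :> R)%R by lra.
have := gauss_integral_exp_sqr th0.
have -> : (1 + 2 * (- (3 / 8)) = (2^-1) ^+ 2 :> R)%R by lra.
rewrite sqrtr_sqr ger0_norm// invrK => <-.
by apply: eq_integral => x _; rewrite mulNr opprK.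
Qed.

(** Integrating 1 + th x^2 <= exp (th x^2) bounds the mean by ((1 - 2 th)^(-1/2) - 1) / th, which
    tends to 1 with th -> 0. *)
Lemma gauss_sqr_mean : \int[gauss]_x (x ^+ 2)%:E <= 1.
Proof.
apply/lee_addgt0Pr => h h0.
(* The bound 1/4 keeps 1 - 2 th positive and the square-root estimate valid; h / 4 makes its excess
   4 th at most h. *)
pose th : R := Num.min (4^-1)%R (h / 4)%R.
have th0 : (0 < th)%R by rewrite /th lt_min; apply/andP; split; lra.
have th4 : (th <= 4^-1)%R by rewrite /th ge_min lexx.
have thh : (4 * th <= h)%R by rewrite mulrC -ler_pdivlMr// /th ge_min lexx orbT.
have b0 : (0 < 1 + 2 * (- th))%R by lra.
pose f (x : measurableTypeR R) : \bar R := (x ^+ 2)%:E.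
have mf : measurable_fun setT f by apply/measurable_EFinP; exact: measurable_funX.
have f0 x : 0 <= f x by rewrite lee_fin sqr_ge0.
rewrite -[leLHS]/(\int[gauss]_x f x).
have : 1 + th%:E * \int[gauss]_x f x <= ((Num.sqrt (1 + 2 * (- th)))^-1)%:E.
  rewrite -gauss_integral_exp_sqr// -ge0_integralZl//; last by rewrite lee_fin ltW.
  rewrite -[X in X + _](probability_integral_cst gauss) -ge0_integralD//; last 2 first.
    by move=> x _; rewrite mule_ge0// lee_fin ltW.
    by apply: emeasurable_funM.
  apply: ge0_le_lower_integral => x; rewrite -EFinM -EFinD lee_fin.
    by rewrite addr_ge0// mulr_ge0 ?sqr_ge0// ltW.
  by rewrite mulNr opprK; exact: expR_ge1Dx.
have bnd : ((Num.sqrt (1 + 2 * (- th)))^-1 <= 1 + th * (1 + h))%R.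
  rewrite -div1r ler_pdivrMr ?sqrtr_gt0//.
  apply: (@le_trans _ _ ((1 + th * (1 + 4 * th)) * Num.sqrt (1 + 2 * - th))%R); last first.
    by rewrite ler_wpM2r ?sqrtr_ge0// lerD2l ler_pM2l// lerD2l.
  set w := (1 + th * (1 + 4 * th))%R.
  have w0 : (0 <= w)%R by rewrite /w; nra.
  rewrite -[X in (X * _)%R]ger0_norm// -sqrtr_sqr -sqrtrM ?sqr_ge0// -[leLHS]sqrtr1 ler_wsqrtr//.
  rewrite -subr_ge0.
  have -> : (w ^+ 2 * (1 + 2 * - th) - 1 = th ^+ 2 * (5 - 10 * th - 32 * th ^+ 3))%R by rewrite /w; ring.
  rewrite mulr_ge0 ?sqr_ge0//.
  have : (th ^+ 3 <= 4^-1 * 4^-1 ^+ 2)%R.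
    by rewrite exprS ler_pM ?sqr_ge0 ?(ltW th0)// ler_sqr ?nnegrE ?(ltW th0).
  lra.
move=> /le_trans/(_ (_ : _ <= (1 + th * (1 + h))%:E)).
rewrite lee_fin => /(_ bnd).
rewrite EFinD leeD2lE// EFinM lee_pmul2l//.
Qed.

Context d (T : measurableType d) (P : probability T R) (p l : nat).
Variable X : 'I_p * 'I_l -> {RV P >-> R}.
Hypothesis gX : std_gaussian_entries X.

Lemma gaussian_row_quadratic i (v : 'cV[R]_l) (h : measurableTypeR R -> \bar R) :
  sqfrob v != 0%R -> measurable_fun setT h -> (forall x, 0 <= h x) ->
  \int[P]_t h ((\sum_a v a ord0 * X (i, a) t) ^+ 2 / sqfrob v)%R = \int[gauss]_x h (x ^+ 2)%R.
Proof.
move=> v0 mh h0.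
have vp : (0 < sqfrob v)%R by rewrite lt_neqAle eq_sym v0 sqfrob_ge0.
pose u := (Num.sqrt (sqfrob v))^-1 *: v.
have u1 : sqfrob u = 1%R by rewrite sqfrobZ exprVn sqr_sqrtr ?ltW// mulVf.
have gXi : gaussian_family (X \o (fun a => (i, a))).
  by apply: gaussian_family_inj gX => a b [].
rewrite -(gaussian_unit_vector (h := fun x => h (x ^+ 2)%R) gXi u1)//; last first.
  by apply: (measurableT_comp mh); exact: measurable_funX.
apply: eq_integral => t _; congr h.
have -> : (\sum_a u a ord0 * (X \o (fun a => (i, a))) a t =
    (Num.sqrt (sqfrob v))^-1 * \sum_a v a ord0 * X (i, a) t)%R.
  by rewrite mulr_sumr; apply: eq_bigr => a _; rewrite mxE mulrA.
by rewrite exprMn exprVn sqr_sqrtr ?ltW// mulrC.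
Qed.

Variables (q : nat) (D : 'rV[R]_p) (M : 'M[R]_(l, q)).

Definition row_form i j t : R := (\sum_a M a j * X (i, a) t) ^+ 2.

Lemma measurable_row_form i j : measurable_fun setT (row_form i j).
Proof.
apply: measurable_funX; apply: measurable_sumT => a.
by apply: measurable_funM => //; exact: measurable_funPT.
Qed.

Lemma row_form_sqfrob t :
  sqfrob (diag_mx D *m random_mx X t *m M) = (\sum_i \sum_j D ord0 i ^+ 2 * row_form i j t)%R.
Proof.
rewrite sqfrobE; apply: eq_bigr => i _; apply: eq_bigr => j _.
rewrite -mulmxA mul_diag_mx mxE exprMn; congr (_ * _ ^+ 2)%R.
by rewrite mxE; apply: eq_bigr => a _; rewrite mxE mulrC.
Qed.

Lemma sqfrob_colE : sqfrob M = (\sum_j sqfrob (col j M))%R.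
Proof.
rewrite sqfrobE exchange_big; apply: eq_bigr => j _; rewrite sqfrobE.
by apply: eq_bigr => a _; rewrite big_ord1 mxE.
Qed.

Lemma sqfrob_diagE : sqfrob (diag_mx D) = (\sum_i D ord0 i ^+ 2)%R.
Proof.
rewrite sqfrobE; apply: eq_bigr => i _; rewrite (bigD1 i)//= mxE eqxx big1 ?addr0//.
by move=> j ji; rewrite mxE eq_sym (negbTE ji) mulr0n expr0n.
Qed.

Lemma row_form_col i j t :
  row_form i j t = ((\sum_a (col j M) a ord0 * X (i, a) t) ^+ 2)%R.
Proof. by congr (_ ^+ 2)%R; apply: eq_bigr => a _; rewrite mxE. Qed.

Lemma row_form_col0 i j t : sqfrob (col j M) = 0%R -> row_form i j t = 0%R.
Proof.
move=> /sqfrob_eq0 c0; rewrite row_form_col c0 big1 ?expr0n// => a _.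
by rewrite mxE mul0r.
Qed.

Lemma row_form_mean i j : \int[P]_t (row_form i j t)%:E <= (sqfrob (col j M))%:E.
Proof.
have [c0|c0] := eqVneq (sqfrob (col j M)) 0%R.
  under eq_integral do rewrite (row_form_col0 _ _ c0).
  by rewrite integral0 c0.
have cp : (0 < sqfrob (col j M))%R by rewrite lt_neqAle eq_sym c0 sqfrob_ge0.
pose h (x : measurableTypeR R) : \bar R := (`|x|%R)%:E.
have mh : measurable_fun setT h by apply/measurable_EFinP; exact: normr_measurable.
have h0 x : 0 <= h x by rewrite lee_fin.
have := gaussian_row_quadratic i c0 mh h0.
have -> : \int[gauss]_x h (x ^+ 2)%R = \int[gauss]_x (x ^+ 2)%:E.
  by apply: eq_integral => x _; rewrite /h ger0_norm// sqr_ge0.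
have -> : \int[P]_t (row_form i j t)%:E =
    (sqfrob (col j M))%:E * \int[P]_t h ((\sum_a col j M a ord0 * X (i, a) t) ^+ 2 / sqfrob (col j M))%R.
  rewrite -ge0_integralZl//; [|..|by rewrite lee_fin ltW].
    apply: eq_integral => t _; rewrite row_form_col /h ger0_norm ?divr_ge0 ?sqr_ge0 ?(ltW cp)//.
    by rewrite -EFinM mulrC divfK.
  apply: (measurableT_comp mh); apply: measurable_funM => //.
  by have := measurable_row_form i j; congr (measurable_fun _ _); apply/funext => t; rewrite row_form_col.
move=> ->; rewrite -[leRHS]mule1 lee_pmul2l ?lte_fin//; exact: gauss_sqr_mean.
Qed.

Lemma gaussian_product_mean :
  \int[P]_t (sqfrob (diag_mx D *m random_mx X t *m M))%:E <=
    (sqfrob (diag_mx D) * sqfrob M)%:E.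
Proof.
have m1 i j : measurable_fun setT (fun t => (D ord0 i ^+ 2 * row_form i j t)%:E).
  by apply/measurable_EFinP; apply: measurable_funM => //; exact: measurable_row_form.
have p1 i j t : 0 <= (D ord0 i ^+ 2 * row_form i j t)%:E.
  by rewrite lee_fin mulr_ge0// sqr_ge0.
under eq_integral do rewrite row_form_sqfrob -sumEFin.
rewrite ge0_integral_sum//; last first.
  - by move=> i t _; rewrite -sumEFin sume_ge0.
  - by move=> i; apply/measurable_EFinP; apply: measurable_sumT => j; have /measurable_EFinP := m1 i j.
rewrite sqfrob_diagE mulr_suml -sumEFin; apply: lee_sum => i _.
under eq_integral do rewrite -sumEFin.
rewrite ge0_integral_sum// sqfrob_colE mulr_sumr -sumEFin; apply: lee_sum => j _.
under eq_integral do rewrite EFinM.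
rewrite ge0_integralZl//; [|exact/measurable_EFinP/measurable_row_form|..].
- by rewrite [leRHS]EFinM lee_wpmul2l ?lee_fin ?sqr_ge0//; exact: row_form_mean.
- by move=> t _; rewrite lee_fin sqr_ge0.
- by rewrite lee_fin sqr_ge0.
Qed.

(* Jensen for the convex combination, with weights D_i^2 |M_j|^2, of the
   chi-square variables (row i . M_j)^2 / |M_j|^2; only convexity is used, not
   their dependence. *)
Lemma gaussian_product_exp : let V := (sqfrob (diag_mx D) * sqfrob M)%R in (0 < V)%R ->
  \int[P]_t (expR (3 / 8 * (sqfrob (diag_mx D *m random_mx X t *m M) / V)))%:E <= 2%:E.
Proof.
move=> V V0.
pose w i j := (D ord0 i ^+ 2 * sqfrob (col j M) / V)%R.
have w0 i j : (0 <= w i j)%R by apply: divr_ge0 (ltW V0); apply: mulr_ge0; [exact: sqr_ge0|exact: sqfrob_ge0].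
have wsum : (\sum_i \sum_j w i j = 1)%R.
  transitivity (\sum_i D ord0 i ^+ 2 / V * sqfrob M)%R.
    apply: eq_bigr => i _; rewrite sqfrob_colE mulr_sumr; apply: eq_bigr => j _.
    by rewrite /w mulrAC.
  by rewrite -mulr_suml -mulr_suml -sqfrob_diagE mulrAC divff// gt_eqF.
pose y i j t := (3 / 8 * (row_form i j t / sqfrob (col j M)))%R.
have my i j : measurable_fun setT (fun t => expR (y i j t)).
  apply: measurableT_comp => //; apply: measurable_funM => //; apply: measurable_funM => //.
  exact: measurable_row_form.
have jensen t : (expR (3 / 8 * (sqfrob (diag_mx D *m random_mx X t *m M) / V)) <=
    \sum_i \sum_j w i j * expR (y i j t))%R.
  set z := (3 / 8 * _)%R.
  have zE : (z = \sum_i \sum_j w i j * y i j t)%R.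
    rewrite /z row_form_sqfrob mulr_suml mulr_sumr; apply: eq_bigr => i _.
    rewrite mulr_suml mulr_sumr; apply: eq_bigr => j _.
    have [c0|c0] := eqVneq (sqfrob (col j M)) 0%R.
      by rewrite (row_form_col0 _ _ c0) /w c0 !(mulr0, mul0r).
    by rewrite /w /y; field; rewrite c0 gt_eqF.
  (* The tangent of the exponential at the mean z: its linear part cancels in the weighted sum. *)
  have -> : (expR z = \sum_i \sum_j w i j * (expR z * (1 + y i j t - z)))%R.
    transitivity (expR z * (\sum_i \sum_j w i j + \sum_i \sum_j w i j * y i j t - z * \sum_i \sum_j w i j))%R.
      by rewrite -zE wsum mulr1 addrK mulr1.
    rewrite mulr_sumr -big_split -sumrB mulr_sumr; apply: eq_bigr => i _ /=.
    rewrite mulr_sumr -big_split -sumrB mulr_sumr; apply: eq_bigr => j _ /=.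
    by ring.
  apply: ler_sum => i _; apply: ler_sum => j _; apply: ler_wpM2l => //.
  have -> : expR (y i j t) = (expR z * expR (y i j t - z))%R by rewrite -expRD addrC subrK.
  by rewrite ler_pM2l ?expR_gt0// -addrA; exact: expR_ge1Dx.
have term i j : \int[P]_t (w i j * expR (y i j t))%:E <= (w i j * 2)%:E.
  have [c0|c0] := eqVneq (sqfrob (col j M)) 0%R.
    have -> : w i j = 0%R by rewrite /w c0 mulr0 mul0r.
    under eq_integral do rewrite mul0r.
    by rewrite integral0 mul0r.
  under eq_integral do rewrite EFinM.
  rewrite ge0_integralZl//; [|exact/measurable_EFinP|by rewrite lee_fin].
  rewrite [leRHS]EFinM lee_wpmul2l ?lee_fin// -gauss_exp_sqr.
  pose h (x : measurableTypeR R) : \bar R := (expR (3 / 8 * x))%:E.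
  have mh : measurable_fun setT h.
    by apply/measurable_EFinP; apply: measurableT_comp => //; exact: measurable_funM.
  rewrite -(gaussian_row_quadratic (h := h) i c0 mh)//; last first.
    by move=> x; rewrite lee_fin expR_ge0.
  apply: ge0_le_lower_integral => t; first by rewrite lee_fin expR_ge0.
  by rewrite /y row_form_col.
have p1 i j t : 0 <= (w i j * expR (y i j t))%:E by rewrite lee_fin mulr_ge0// expR_ge0.
have m1 i j : measurable_fun setT (fun t => (w i j * expR (y i j t))%:E).
  by apply/measurable_EFinP; exact: measurable_funM.
apply: (@le_trans _ _ (\int[P]_t \sum_i \sum_j (w i j * expR (y i j t))%:E)).
  apply: ge0_le_lower_integral => t; first by rewrite lee_fin expR_ge0.
  apply: (@le_trans _ _ (\sum_i \sum_j w i j * expR (y i j t))%:E); first by rewrite lee_fin.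
  by rewrite -sumEFin lee_sum// => i _; rewrite -sumEFin.
rewrite ge0_integral_sum//; last first.
  - by move=> i t _; rewrite sume_ge0.
  - by move=> i; apply: emeasurable_sum.
have -> : 2%:E = \sum_i \sum_j (w i j * 2)%:E.
  under eq_bigr do rewrite sumEFin -mulr_suml.
  by rewrite sumEFin -mulr_suml wsum mul1r.
apply: lee_sum => i _; rewrite ge0_integral_sum//.
by apply: lee_sum => j _; exact: term.
Qed.

End GaussianQuadratic.

(** * The numerical budget of the failure probability *)

Section FailureProbability.
Variable R : realType.

Lemma sin_le (x : R) : 0 < x -> sin x <= x.
Proof.
move=> x0; have [|y _] := @MVT R sin cos 0 x x0 (fun y _ => is_derive_sin y).
  by apply: continuous_subspaceT => y; exact: continuous_sin.
by rewrite sin0 !subr0 => ->; rewrite ler_piMl ?cos_le1// ltW.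
Qed.

(** With q = pi / 4, cos (pi / 2) = 0 and the double-angle formulas give sin^2 q = 1/2, while sin q
    <= q. *)
Lemma pi_sqr_ge8 : 8 <= pi ^+ 2 :> R.
Proof.
pose q : R := pi / 4; have q0 : 0 < q by rewrite divr_gt0// pi_gt0.
have h : pi / 2 = q *+ 2 :> R by rewrite /q mulr2n; field.
have := cos_pihalf R; rewrite h cos_mulr2n cos2sin2 => e.
have sq : sin q ^+ 2 <= q ^+ 2.
  rewrite ler_sqr ?nnegrE ?(ltW q0)//; first exact: sin_le.
  apply: sin_ge0_pi; rewrite (ltW q0) /q /= ler_pdivrMr// ler_peMr ?pi_ge0//.
  by rewrite ler1n.
have -> : pi ^+ 2 = 16 * q ^+ 2 by rewrite /q; field.
move: e; rewrite mulr2n => e; lra.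
Qed.

(** Since exp (- ln (2 / delta)) = delta / 2, the second term is 2 e^(-3/4) (delta / 2)^(3/2). After
    division by delta, with e^(-3/8) <= 8/11 from exp (3/8) >= 11/8, the total is at most 0.6 + 0.53
    times 0.71, which is below 1. *)
Lemma failure_bound (delta : R) : 0 < delta < 1 ->
  delta / Num.sqrt pi + 2 * expR (- (3 / 8 * (2 + 4 * ln (2 / delta)))) <= delta.
Proof.
move=> /andP[d0 d1]; set t := ln (2 / delta).
have et : expR (- t) = delta / 2 by rewrite expRN /t lnK ?posrE ?divr_gt0// invf_div.
have -> : - (3 / 8 * (2 + 4 * t)) = - (3 / 8) + - (3 / 8) + (- t + - (t / 2)) by field.
rewrite !expRD et.
set s := expR (- (t / 2)); set a := expR (- (3 / 8)).
have a0 : 0 < a by exact: expR_gt0.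
have s0 : 0 < s by exact: expR_gt0.
have s2 : s ^+ 2 = delta / 2 by rewrite expr2 -expRD -et; congr expR; field.
have s1 : s <= 71 / 100.
  have : s ^+ 2 <= (71 / 100) ^+ 2 by rewrite s2; lra.
  rewrite ler_sqr ?nnegrE ?(ltW s0)//; lra.
have a1 : a <= 8 / 11.
  have := expR_ge1Dx (3 / 8 : R); rewrite -[expR (3 / 8)]invrK -expRN -/a => ha.
  have aV : a * a^-1 = 1 by rewrite divff// gt_eqF.
  by move: (a^-1) aV ha => b aV ha; nra.
have p1 : (Num.sqrt pi)^-1 <= 6 / 10 :> R.
  have p8 := pi_sqr_ge8; have p0 := pi_gt0 R.
  have p28 : 28 / 10 <= pi :> R by nra.
  rewrite -sqrtrV ?(ltW p0)// -[leRHS]ger0_norm; last by lra.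
  rewrite -sqrtr_sqr ler_wsqrtr// -div1r ler_pdivrMr//; lra.
have : a * a <= 8 / 11 * (8 / 11) by rewrite ler_pM// ltW.
move=> aa.
have : a * a * s <= 8 / 11 * (8 / 11) * (71 / 100) by rewrite ler_pM ?mulr_ge0// ltW.
move=> aas.
have -> : delta / Num.sqrt pi + 2 * (a * a * (delta / 2 * s)) =
  delta * ((Num.sqrt pi)^-1 + a * a * s) by field; rewrite gt_eqF// sqrtr_gt0 pi_gt0.
rewrite -[leRHS]mulr1 ler_pM2l//; lra.
Qed.

End FailureProbability.

Lemma sqfrob0 (R : realType) m n : sqfrob (0 : 'M[R]_(m, n)) = 0.
Proof. by rewrite /sqfrob mulmx0 mxtrace0. Qed.

(** * Mean and tail of the sketching error *)

Section Sketch.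
Local Open Scope ereal_scope.
Context d (T : measurableType d) (R : realType) (P : probability T R).
Variables (n k l : nat) (le_kn : (k <= n)%N) (le_kl : (k <= l)%N) (k0 : (0 < k)%N).

Definition head_rows (O : 'M[R]_(n, l)) : 'M[R]_(k, l) := mxsub (widen_ord le_kn) id O.
Definition tail_rows (O : 'M[R]_(n, l)) : 'M[R]_(n - k, l) := mxsub (tail_ord le_kn) id O.
(** The Moore-Penrose inverse of a matrix with independent rows, written with [adj_inv] to be
    measurable. It is 0 for dependent rows, so that [sqfrob_gram_pinv] has no exception. *)
Definition gram_pinv (O : 'M[R]_(k, l)) : 'M[R]_(l, k) := O^T *m adj_inv (reg_gram 0 O).

Variable D : 'rV[R]_(n - k).

Definition sketch_sqr (O : 'M[R]_(n, l)) : R :=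
  sqfrob (diag_mx D *m tail_rows O *m gram_pinv (head_rows O)).

Definition sketch_scale (O : 'M[R]_(n, l)) : R :=
  (sqfrob (diag_mx D) * sqfrob (gram_pinv (head_rows O)))%R.

Lemma sketch_sqr_ge0 O : (0 <= sketch_sqr O)%R. Proof. exact: sqfrob_ge0. Qed.

Lemma sketch_scale_ge0 O : (0 <= sketch_scale O)%R.
Proof. by rewrite mulr_ge0 ?sqfrob_ge0. Qed.

Lemma sqfrob_gram_pinv O : sqfrob (gram_pinv O) = (\sum_i gram_diag 0 i O)%R.
Proof.
rewrite sqfrob_colE; apply: eq_bigr => i _; rewrite /gram_pinv /gram_diag.
have [u|nu] := boolP (reg_gram 0 O \in unitmx).
  by rewrite [RHS]reg_gram_adj_inv_diag// mul0r addr0.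
by rewrite adj_inv_singular// mulmx0 mxE col0 sqfrob0.
Qed.

Section Measurability.
Context d' (T' : measurableType d') (O : T' -> 'M[R]_(n, l)).
Hypothesis mO : mx_measurable O.

Lemma mx_measurable_gram_pinv : mx_measurable (fun t => gram_pinv (head_rows (O t))).
Proof.
have mH : mx_measurable (fun t => head_rows (O t)) by exact: mx_measurable_sub.
apply: mx_measurable_mul; first exact: mx_measurable_tr.
by apply: mx_measurable_adj_inv; exact: mx_measurable_reg_gram.
Qed.

Lemma measurable_sketch_sqr : measurable_fun setT (fun t => sketch_sqr (O t)).
Proof.
apply: measurable_sqfrob; apply: mx_measurable_mul; last exact: mx_measurable_gram_pinv.
by apply: mx_measurable_mul; [exact: mx_measurable_cst|exact: mx_measurable_sub].
Qed.

Lemma measurable_sketch_scale : measurable_fun setT (fun t => sketch_scale (O t)).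
Proof. by apply: measurable_funM => //; apply: measurable_sqfrob; exact: mx_measurable_gram_pinv. Qed.

End Measurability.

Variable G : 'I_n * 'I_l -> {RV P >-> R}.
Hypothesis gG : std_gaussian_entries G.

Lemma gaussian_head_rows : exists2 G1 : 'I_k * 'I_l -> {RV P >-> R},
  std_gaussian_entries G1 & forall t, head_rows (random_mx G t) = random_mx G1 t.
Proof.
exists (G \o (fun ij => (widen_ord le_kn ij.1, ij.2))).
  by apply: gaussian_family_inj gG => -[i j] [i' j'] /= [ii' ->]; congr (_, _); exact: val_inj.
by move=> t; apply/matrixP => i j; rewrite !mxE.
Qed.

Lemma gaussian_tail_rows : exists2 G2 : 'I_(n - k) * 'I_l -> {RV P >-> R},
  std_gaussian_entries G2 & forall t, tail_rows (random_mx G t) = random_mx G2 t.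
Proof.
exists (G \o (fun ij => (tail_ord le_kn ij.1, ij.2))).
  apply: gaussian_family_inj gG => -[i j] [i' j'] /= [ii' ->]; congr (_, _).
  by apply: val_inj; exact: addnI ii'.
by move=> t; apply/matrixP => i j; rewrite !mxE.
Qed.

Let J : {set 'I_n * 'I_l} := finset (fun ij : 'I_n * 'I_l => (ij.1 < k)%N).

Let head_mix t u : head_rows (coord_mx (mix J (joint G t) (joint G u))) = head_rows (random_mx G t).
Proof. by apply/matrixP => i j; rewrite !mxE /mix inE /= ltn_ord. Qed.

Let tail_mix t u : tail_rows (coord_mx (mix J (joint G t) (joint G u))) = tail_rows (random_mx G u).
Proof. by apply/matrixP => i j; rewrite !mxE /mix inE /= ltnNge leq_addr. Qed.

Lemma sketch_mean r : (l - k.-1 = r.+3)%N ->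
  \int[P]_t (sketch_sqr (random_mx G t))%:E <= (sqfrob (diag_mx D) * (k%:R / r.+1%:R))%:E.
Proof.
move=> rE; have [G1 gG1 G1E] := gaussian_head_rows; have [G2 gG2 G2E] := gaussian_tail_rows.
pose F x := (sketch_sqr (coord_mx x))%:E.
have mF : measurable_fun setT F.
  by apply/measurable_EFinP; apply: measurable_sketch_sqr; exact: mx_measurable_coord.
rewrite -[leLHS]/(\int[P]_t F (joint G t)).
rewrite (decoupling (proj1 gG) J mF); last by move=> x; rewrite lee_fin sketch_sqr_ge0.
apply: (@le_trans _ _ (\int[P]_t ((sqfrob (diag_mx D))%:E * \sum_i (gram_diag 0 i (random_mx G1 t))%:E))).
  apply: ge0_le_lower_integral => t; first by apply: integral_ge0 => u _; rewrite lee_fin sketch_sqr_ge0.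
  rewrite sumEFin -EFinM -sqfrob_gram_pinv -G1E.
  apply: le_trans (gaussian_product_mean gG2 D (gram_pinv (head_rows (random_mx G t)))).
  rewrite le_eqVlt; apply/orP; left; apply/eqP; apply: eq_integral => u _.
  by rewrite /F /sketch_sqr head_mix tail_mix G2E.
have mg i : measurable_fun setT (fun t => (gram_diag 0 i (random_mx G1 t))%:E).
  by apply/measurable_EFinP; exact: measurable_gram_diag_rv.
have g0 i t : 0 <= (gram_diag 0 i (random_mx G1 t))%:E.
  by rewrite lee_fin; exact: reg_gram_adj_inv_ge0.
rewrite ge0_integralZl//; last 3 first.
- exact: emeasurable_sum.
- by move=> t _; rewrite sume_ge0.
- by rewrite lee_fin sqfrob_ge0.
rewrite EFinM lee_wpmul2l ?lee_fin ?sqfrob_ge0// ge0_integral_sum//.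
apply: (@le_trans _ _ (\sum_(i < k) (r.+1%:R^-1)%:E)).
  by apply: lee_sum => i _; exact: gram_diag_mean.
by rewrite sumEFin sumr_const card_ord lee_fin mulr_natl.
Qed.

Lemma measurable_sketch_event y :
  measurable [set t | (y * sketch_scale (random_mx G t) < sketch_sqr (random_mx G t))%R].
Proof.
have mG := mx_measurable_random G.
have := measurable_fun_ltr (measurable_funM (measurable_cst y) (measurable_sketch_scale mG))
  (measurable_sketch_sqr mG).
by move=> /(_ measurableT [set true]); rewrite setTI; apply.
Qed.

Lemma sketch_tail (y : R) :
  P [set t | (y * sketch_scale (random_mx G t) < sketch_sqr (random_mx G t))%R] <=
    (2 * expR (- (3 / 8 * y)))%:E.
Proof.
have [G1 gG1 G1E] := gaussian_head_rows; have [G2 gG2 G2E] := gaussian_tail_rows.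
pose A : set (coord_type R ('I_n * 'I_l)%type) :=
  [set x | (y * sketch_scale (coord_mx x) < sketch_sqr (coord_mx x))%R].
have mA : measurable A.
  have mG := @mx_measurable_coord R n l.
  have := measurable_fun_ltr (measurable_funM (measurable_cst y) (measurable_sketch_scale mG))
    (measurable_sketch_sqr mG).
  by move=> /(_ measurableT [set true]); rewrite setTI; apply.
pose F x := (\1_A x : R)%:E.
have mF : measurable_fun setT F by apply/measurable_EFinP; exact: measurable_indic.
set S := [set t | _]; have mS : measurable S := measurable_sketch_event y.
have -> : P S = \int[P]_t F (joint G t).
  by rewrite -[LHS](_ : \int[P]_t (\1_S t)%:E = _)// integral_indic// setIT.
apply: (ge0_decoupling_le (proj1 gG) (J := J) mF) => [x|t]; first by rewrite lee_fin.
set V := sketch_scale (random_mx G t).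
have VE u : sketch_scale (coord_mx (mix J (joint G t) (joint G u))) = V.
  by rewrite /sketch_scale head_mix.
pose Y u := sqfrob (diag_mx D *m random_mx G2 u *m gram_pinv (head_rows (random_mx G t))).
have YE u : sketch_sqr (coord_mx (mix J (joint G t) (joint G u))) = Y u.
  by rewrite /sketch_sqr head_mix tail_mix G2E.
have mY : measurable_fun setT Y.
  apply: measurable_sqfrob; apply: mx_measurable_mul; last exact: mx_measurable_cst.
  by apply: mx_measurable_mul; [exact: mx_measurable_cst|exact: mx_measurable_random].
(* With V = 0 both sides of the event vanish, and its strict inequality fails. *)
have [V0|V0] := eqVneq V 0%R.
  have Y0 u : Y u = 0%R.
    move/eqP: V0; rewrite mulf_eq0 => /orP[]/eqP/sqfrob_eq0 E.
      by rewrite /Y E !mul0mx sqfrob0.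
    by rewrite /Y E mulmx0 sqfrob0.
  rewrite integral0_eq; first by rewrite lee_fin mulr_ge0// expR_ge0.
  move=> u _; rewrite /F indicE memNset// /A /= VE YE V0 Y0 mulr0 ltxx//.
have Vp : (0 < V)%R by rewrite lt_neqAle eq_sym V0 sketch_scale_ge0.
pose E u := (expR (3 / 8 * (Y u / V)))%:E.
have mE : measurable_fun setT E.
  apply/measurable_EFinP; apply: measurableT_comp => //; apply: measurable_funM => //.
  exact: measurable_funM.
apply: (@le_trans _ _ (\int[P]_u ((expR (- (3 / 8 * y)))%:E * E u))).
  apply: ge0_le_lower_integral => u; first by rewrite lee_fin.
  rewrite /F indicE /E -EFinM lee_fin -expRD.
  case: (boolP (_ \in A)) => [|_]; last by rewrite expR_ge0.
  rewrite inE /A /= VE YE -ltr_pdivlMr// => yV.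
  rewrite -[leLHS]expR0 ler_expR; move: (Y u / V)%R yV => z; lra.
rewrite ge0_integralZl//; last by move=> u _; rewrite lee_fin expR_ge0.
rewrite [(2 * _)%R]mulrC [leRHS]EFinM lee_wpmul2l ?lee_fin ?expR_ge0//.
exact: (gaussian_product_exp gG2 Vp).
Qed.

End Sketch.

(** * Krylov-aware approximation *)

Section ExtendedBounds.
Variable R : realType.

Lemma poly_approx_error_ge0 m (f : R -> R) (a b : R) : a <= b ->
  (0 <= poly_approx_error m f a b)%E.
Proof.
move=> ab; apply/ereal_infP => _ [p _ <-].
apply: (@le_trans _ _ `|f a - p.[a]|%:E); first by rewrite lee_fin.
by apply: ereal_sup_ubound; exists a => //=; rewrite in_itv /= lexx.
Qed.

(** After division by c the claim is a lower bound for an infimum over p, with [e] the sup norm of f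
    - p; where that norm is infinite there is nothing to prove. *)
Lemma approx_error_bound m (f : R -> R) (a b x c q : R) : 0 < c -> a <= b ->
  (forall (e : R) (p : {poly R}), (size p <= m.+1)%N -> 0 <= e ->
     (forall y, a <= y <= b -> `|f y - p.[y]| <= e) -> x <= c * e + q) ->
  (x%:E <= c%:E * poly_approx_error m f a b + q%:E)%E.
Proof.
move=> c0 ab h.
suff: (((x - q) / c)%:E <= poly_approx_error m f a b)%E.
  move=> hx; rewrite -leeBlDr// -EFinB -lee_pdivrMl//.
  by rewrite -EFinM mulrC.
apply/ereal_infP => _ [p /= sp <-].
have sup y : a <= y <= b -> (`|f y - p.[y]|%:E <= sup_norm a b (fun x => f x - p.[x])%R)%E.
  by move=> yab; apply: ereal_sup_ubound; exists y => //=; rewrite in_itv.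
move: (sup_norm _ _ _) sup => [e| |] sup; rewrite ?leey//; last first.
  by have := sup a; rewrite lexx ab => /(_ isT).
rewrite lee_fin ler_pdivrMr// lerBlDr mulrC; apply: (h e p) => //.
by apply: le_trans (normr_ge0 _) (sup a _); rewrite lexx ab.
Qed.

Lemma head_ratio_ge0 (n k : nat) (le_kn : (k <= n)%N) (lam : 'rV[R]_n) (f : R -> R)
    (g : {poly R}) : 0 <= head_ratio le_kn f lam g.
Proof. by rewrite /head_ratio; elim/big_ind: _ => // x y x0 y0; rewrite le_max x0. Qed.

(** The constant polynomial 1 is admissible and makes the infimum finite; it need not be attained,
    so [g j] comes within 1 / (j + 1). *)
Lemma energy_approx (n k s : nat) (le_kn : (k <= n)%N) (lam : 'rV[R]_n) (f : R -> R) :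
  (0 < s)%N -> exists (E : R) (g : nat -> {poly R}),
    [/\ 0 <= E, energy le_kn lam f s = E%:E &
    forall j, [/\ (size (g j) <= s)%N, forall i, (g j).[eigs_head le_kn lam 0 i] != 0 &
      tail_norm le_kn lam (horner (g j)) ^+ 2 * head_ratio le_kn f lam (g j) <=
        E + j.+1%:R^-1]].
Proof.
move=> s0; have en0 : (0 <= energy le_kn lam f s)%E.
  apply/ereal_infP => _ [g _ <-]; rewrite /energy_at; case: ifP => _; first exact: leey.
  by rewrite lee_fin mulr_ge0 ?sqr_ge0//; exact: head_ratio_ge0.
have enfin : energy le_kn lam f s \is a fin_num.
  rewrite ge0_fin_numE//; apply: (@le_lt_trans _ _ (energy_at le_kn lam f 1)).
    by apply: ereal_inf_lbound; exists 1 => //; rewrite /polys /= size_poly1.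
  rewrite /energy_at; case: ifP => [/existsP[i]|_]; last by rewrite ltry.
  by rewrite hornerC oner_eq0.
set E := fine (energy le_kn lam f s).
suff /choice[g gP] : forall j : nat, exists g : {poly R},
    [/\ (size g <= s)%N, forall i, g.[eigs_head le_kn lam 0 i] != 0 &
      tail_norm le_kn lam (horner g) ^+ 2 * head_ratio le_kn f lam g <= E + j.+1%:R^-1].
  by exists E, g; rewrite /E fineK//; split=> //; exact: fine_ge0.
move=> j; have h0 : 0 < j.+1%:R^-1 :> R by rewrite invr_gt0.
have [_ [g sg <-]] := lb_ereal_inf_adherent h0 enfin.
rewrite /energy_at; case: ifPn => [_|/existsPn g0]; first by rewrite ltNge leey.
rewrite -/(energy _ _ _ _) -(fineK enfin) -EFinD lte_fin => lt.
exists g; split; last exact: ltW.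
  by move: sg; rewrite /polys /= prednK.
by move=> i; exact: g0.
Qed.

(** Each tail union contains some [A n], and continuity from above passes the bound to the
    intersection. The good events are not nested, since each belongs to its own polynomial. *)
Lemma limsup_probability d (T : measurableType d) (P : probability T R) (a : \bar R)
    (A : (set T) ^nat) : (forall j, measurable (A j)) -> (forall j, a <= P (A j))%E ->
  (a <= P (lim_sup_set A))%E.
Proof.
move=> mA aA; have mU n : measurable (\bigcup_(j in [set j | (n <= j)%N]) A j).
  exact: bigcup_measurable.
have cvg := @lim_sup_set_cvg _ _ _ P A mA (le_lt_trans (probability_le1 P (mU 0%N)) (ltry 1)).
rewrite -(cvg_lim _ cvg)//; apply: lime_ge; first by apply/cvg_ex; eexists; exact: cvg.
apply: nearW => n; apply: le_trans (aA n) _; apply: le_measure; rewrite ?inE//.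
by apply: bigcup_sup => /=.
Qed.

Lemma measurable_lim_sup_set d (T : measurableType d) (A : (set T) ^nat) :
  (forall j, measurable (A j)) -> measurable (lim_sup_set A).
Proof.
by move=> mA; apply: bigcap_measurable => // n _; exact: bigcup_measurable.
Qed.

(* Only infinitely many indices are assumed: a point of a limsup event gives no more. *)
Lemma sqrt_bound_limit (x c z K E : R) (a : \bar R) : 0 < c -> (0 <= a)%E ->
  0 <= z -> 0 <= K -> 0 <= E ->
  (forall N, exists2 j, (N <= j)%N &
    (x%:E <= c%:E * a + (Num.sqrt (z + K * (E + j.+1%:R^-1)))%:E)%E) ->
  (x%:E <= c%:E * a + sqrte (z%:E + K%:E * E%:E))%E.
Proof.
move=> c0; case: a => [a| |] // a0 z0 K0 E0 h; last first.
  by rewrite gt0_muley ?lte_fin// -EFinM -EFinD /= leey.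
rewrite -!EFinM -!EFinD lee_fin.
have {}h N : exists2 j, (N <= j)%N & x <= c * a + Num.sqrt (z + K * (E + j.+1%:R^-1)).
  by have [j Nj] := h N; rewrite -EFinM -EFinD lee_fin; exists j.
set w := z + K * E; have w0 : 0 <= w by rewrite addr_ge0 ?mulr_ge0.
rewrite -lerBlDl; set y := x - c * a.
have {}h N : exists2 j, (N <= j)%N & y <= Num.sqrt (w + K * j.+1%:R^-1).
  by have [j Nj hj] := h N; exists j => //; rewrite lerBlDl /w -addrA -mulrDr.
rewrite leNgt; apply/negP => lt.
have y0 : 0 <= y := le_trans (sqrtr_ge0 _) (ltW lt).
have gap : 0 < y ^+ 2 - w.
  by rewrite subr_gt0 -[w in w < _]sqr_sqrtr// ltr_sqr ?nnegrE ?sqrtr_ge0.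
have [j Nj hj] := h (Num.bound (K / (y ^+ 2 - w))).
have : y ^+ 2 <= w + K * j.+1%:R^-1.
  rewrite -[leRHS]sqr_sqrtr ?ler_sqr ?nnegrE ?sqrtr_ge0//.
  by rewrite addr_ge0 ?mulr_ge0 ?invr_ge0.
rewrite leNgt -ltrBrDl ltr_pdivrMr//; apply/negP/negPn.
rewrite mulrC -ltr_pdivrMr//; apply: (lt_le_trans (archi_boundP _)).
  by rewrite divr_ge0// ltW.
by rewrite ler_nat (leq_trans Nj).
Qed.

End ExtendedBounds.

(** * Both error bounds for the algorithm *)

Section KrylovAware.
Variable R : realType.
Variables (n k l s r : nat) (k_ge1 : (1 <= k)%N) (le_kn : (k <= n)%N) (le_kl : (k <= l)%N)
  (s_ge1 : (1 <= s)%N).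
Variables (A : 'M[R]_n) (A_sym : A^T = A) (f : R -> R)
  (U : 'M[R]_n) (lam : 'rV[R]_n) (A_eig : eigendecomposition A U lam)
  (lam_sorted : forall i j : 'I_n, (i <= j)%N -> `|f (lam 0 j)| <= `|f (lam 0 i)|)
  (lmin lmax : R) (lminP : smallest_eigenvalue A lmin) (lmaxP : largest_eigenvalue A lmax).

Local Notation approx := (poly_approx_error (2 * r + 1) f lmin lmax).
Local Notation c := (4 * Num.sqrt (l * s)%:R : R).
Local Notation tail_sq := (tail_norm le_kn lam f ^+ 2).
Local Notation tail_eigs g := (map_mx (horner g) (eigs_tail le_kn lam)).

Let c_gt0 : 0 < c.
Proof. by rewrite mulr_gt0// sqrtr_gt0 ltr0n muln_gt0 (leq_trans k_ge1 le_kl). Qed.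

Let eig_itv i : lmin <= lam 0 i <= lmax.
Proof.
have ev := eigendecomposition_eigenvalue i A_eig.
by apply/andP; split; [case: lminP => _; exact|case: lmaxP => _; exact].
Qed.

Let lmin_max : lmin <= lmax.
Proof. by have /andP[] := eig_itv (widen_ord le_kn (Ordinal k_ge1)); exact: le_trans. Qed.

Lemma alg_error_le (Om : 'M[R]_(n, l)) (B : 'M[R]_n) (g : {poly R}) :
  alg_output A f s r k Om B -> (size g <= s)%N ->
  (forall i, g.[eigs_head le_kn lam 0 i] != 0) ->
  reg_gram 0 (head_rows le_kn (U^T *m Om)) \in unitmx ->
  ((frobenius (matfun f U lam - B))%:E <= c%:E * approx +
    (Num.sqrt (tail_sq + 5 * (sketch_sqr le_kn (tail_eigs g) (U^T *m Om) *
       head_ratio le_kn f lam g)))%:E)%E.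
Proof.
move=> algB sg g0.
have -> : head_rows le_kn (U^T *m Om) = (head_cols le_kn U)^T *m Om.
  by apply/matrixP => i j; rewrite !mxE; apply: eq_bigr => a _; rewrite !mxE.
have gE : reg_gram 0 ((head_cols le_kn U)^T *m Om) =
    (head_cols le_kn U)^T *m Om *m ((head_cols le_kn U)^T *m Om)^T.
  by rewrite /reg_gram raddf0 addr0.
rewrite gE => Wu; apply: approx_error_bound => // e p sp e0 fp.
apply: (le_trans (deterministic_bound s_ge1 A_sym A_eig lam_sorted algB sp e0 eig_itv fp sg g0 Wu)).
rewrite lerD2l ler_wsqrtr// lerD2l ler_pM2l// le_eqVlt; apply/orP; left; apply/eqP.
rewrite /sketch_sqr /sketch_error /gram_pinv /right_pinv; congr (sqfrob (_ *m _ *m _) * _).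
  by apply/matrixP => i j; rewrite !mxE; apply: eq_bigr => a _; rewrite !mxE.
have -> : head_rows le_kn (U^T *m Om) = (head_cols le_kn U)^T *m Om.
  by apply/matrixP => i j; rewrite !mxE; apply: eq_bigr => a _; rewrite !mxE.
by rewrite gE adj_invE.
Qed.

Context d (T : measurableType d) (P : probability T R).
Variables (G : 'I_n * 'I_l -> {RV P >-> R}) (G_gauss : std_gaussian_entries G)
  (ALG : T -> 'M[R]_n) (ALG_out : forall t, alg_output A f s r k (random_mx G t) (ALG t)).

Lemma alg_error_probability (delta : R) : 0 < delta < 1 ->
  holds_with_prob P (1 - delta)
    [set t | ((frobenius (matfun f U lam - ALG t))%:E <= c%:E * approx
       + sqrte (tail_sq%:E + (5 * Cdelta delta k l)%:E * energy le_kn lam f s))%E].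
Proof.
move=> d01; have /andP[d0 d1] := d01.
have [G' gG' GE] := gaussian_mx_orthogonal G_gauss (proj1 A_eig).
have [G1 gG1 G1E] := gaussian_head_rows le_kn gG'.
have [E [g [E0 EE gP]]] := energy_approx le_kn lam f s_ge1.
pose O t := random_mx G' t.
pose m : R := (l - k.-1)%:R.
have mE : m = l%:R - k%:R + 1 by exact: gram_df.
have m0 : 0 < m by rewrite ltr0n subn_gt0 prednK.
have kR0 : 0 < k%:R :> R by rewrite ltr0n.
pose W : R := 2 * Num.sqrt (pi * k%:R) / delta.
have W0 : 0 < W by rewrite divr_gt0// mulr_gt0// sqrtr_gt0 mulr_gt0// pi_gt0.
(* Solves (e / (m x))^(m/2) = 1 / W, so that the trace tail 2 sqrt k / W is delta / sqrt pi. *)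
pose x : R := expR 1 / m * W `^ (2 / m).
have x0 : 0 < x by rewrite mulr_gt0 ?powR_gt0// divr_gt0// expR_gt0.
have kx0 : 0 <= k%:R * x := ltW (mulr_gt0 kR0 x0).
(* Twice the factor 2 log (2 / delta) + 1 of [Cdelta]; by [failure_bound], 2 exp (- 3 y / 8) fits in
   what delta / sqrt pi leaves of delta. *)
pose y : R := 2 + 4 * ln (2 / delta).
have y0 : 0 <= y by rewrite addr_ge0// mulr_ge0// ln_ge0// ler_pdivlMr//; lra.
have CE : Cdelta delta k l = y * (k%:R * x).
  by rewrite /Cdelta /y /x /W -mE; field; rewrite gt_eqF.
(* Of the three bad events, only [B3 j] depends on the polynomial. *)
pose B1 := [set t | reg_gram 0 (random_mx G1 t) \notin unitmx].
pose B2 := [set t | k%:R * x <= \sum_i gram_diag 0 i (random_mx G1 t)].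
pose D j : 'rV[R]_(n - k) := tail_eigs (g j).
pose B3 j := [set t | y * sketch_scale le_kn (D j) (O t) < sketch_sqr le_kn (D j) (O t)].
have mB1 : measurable B1 := measurable_singular_gram G1.
have mB2 : measurable B2.
  have : measurable_fun setT (fun t => \sum_i gram_diag 0 i (random_mx G1 t)).
    by apply: measurable_sumT => i; exact: measurable_gram_diag_rv.
  move=> /(_ measurableT _ (measurable_itv `[(k%:R * x)%R, +oo[)); rewrite setTI.
  by congr (measurable _); apply/seteqP; split => t /=; rewrite in_itv /= andbT.
have mB3 j : measurable (B3 j) := measurable_sketch_event le_kn (D j) G' y.
pose A' j := ~` (B1 `|` B2 `|` B3 j).
have mA' j : measurable (A' j) by apply: measurableC; do 2 apply: measurableU => //.
exists (lim_sup_set A'); split.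
- exact: measurable_lim_sup_set.
- apply: limsup_probability => // j; rewrite probability_setC; last by do 2 apply: measurableU => //.
  rewrite EFinB leeB//.
  have U12 := @measureU2 _ _ _ P _ _ mB1 mB2.
  have U3 := @measureU2 _ _ _ P _ _ (measurableU _ _ mB1 mB2) (mB3 j).
  have PB1 : (P B1 <= 0)%E by rewrite /B1 singular_gram_null.
  have PB2 := gram_trace_tail gG1 k_ge1 le_kl x0.
  have PB3 := sketch_tail le_kn (D j) gG' y.
  apply: (le_trans U3); apply: (le_trans (leeD (le_trans U12 (leeD PB1 PB2)) PB3)).
  rewrite add0e -EFinD lee_fin; apply: le_trans (failure_bound d01); rewrite lerD2r.
  have -> : expR 1 / (m * x) = W `^ (- (2 / m)).
    by rewrite /x powRN; field; rewrite !gt_eqF ?expR_gt0 ?powR_gt0.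
  rewrite -/m -powRrM.
  have -> : - (2 / m) * (m / 2) = -1 by field; rewrite gt_eqF.
  rewrite powR_inv1 ?(ltW W0)// /W sqrtrM ?pi_ge0// le_eqVlt; apply/orP; left; apply/eqP.
  by field; rewrite !gt_eqF ?sqrtr_gt0 ?pi_gt0.
move=> t At /=; rewrite EE; apply: sqrt_bound_limit => //.
- exact: poly_approx_error_ge0.
- exact: sqr_ge0.
- by rewrite CE; apply: mulr_ge0 => //; exact: mulr_ge0.
move=> N; have [j /= Nj] := At N I; rewrite /A' /B1 /B2 /B3 => nB.
exists j => //; have [sg g0 gE] := gP j.
have gu : reg_gram 0 (random_mx G1 t) \in unitmx.
  by apply: contrapT => /negP h; apply: nB; left; left.
have tr : \sum_i gram_diag 0 i (random_mx G1 t) < k%:R * x.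
  by rewrite ltNge; apply/negP => h; apply: nB; left; right.
have sk : sketch_sqr le_kn (D j) (O t) <= y * sketch_scale le_kn (D j) (O t).
  by rewrite leNgt; apply/negP => h; apply: nB; right.
have := alg_error_le (ALG_out t) sg g0; rewrite -GE G1E => /(_ gu)/le_trans; apply.
rewrite leeD2l// lee_fin ler_wsqrtr// lerD2l -mulrA ler_pM2l//.
have hr0 : 0 <= head_ratio le_kn f lam (g j) by exact: head_ratio_ge0.
apply: (@le_trans _ _ (y * (sqfrob (diag_mx (D j)) * (k%:R * x)) * head_ratio le_kn f lam (g j))).
  apply: ler_wpM2r => //; apply: (le_trans sk); apply: ler_wpM2l => //.
  apply: ler_wpM2l; first exact: sqfrob_ge0.
  by rewrite sqfrob_gram_pinv G1E ltW.
rewrite CE; move: gE; rewrite tail_normE -/(D j) => gE.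
rewrite [leLHS](_ : _ = y * (k%:R * x) * (sqfrob (diag_mx (D j)) * head_ratio le_kn f lam (g j))); last by ring.
by apply: ler_wpM2l => //; exact: mulr_ge0.
Qed.

Lemma alg_error_expectation : (2 <= l - k)%N ->
  ('E_P[fun t => frobenius (matfun f U lam - ALG t)] <= c%:E * approx +
    sqrte (tail_sq%:E + (5 * k%:R / (l%:R - k%:R - 1))%:E * energy le_kn lam f s))%E.
Proof.
move=> lk2; have [q qE] : exists q, (l - k.-1 = q.+3)%N.
  by exists (l - k - 2)%N; move: k_ge1 le_kl lk2; lia.
have qR : l%:R - k%:R - 1 = q.+1%:R :> R.
  have -> : l = (q.+1 + k + 1)%N by move: k_ge1 le_kl lk2 qE; lia.
  by rewrite !natrD; ring.
rewrite qR; have [G' gG' GE] := gaussian_mx_orthogonal G_gauss (proj1 A_eig).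
have [G1 gG1 G1E] := gaussian_head_rows le_kn gG'.
have [E [g [E0 -> gP]]] := energy_approx le_kn lam f s_ge1.
have kR0 : 0 < k%:R :> R by rewrite ltr0n.
pose K : R := 5 * k%:R / q.+1%:R; have K0 : 0 < K by rewrite divr_gt0// mulr_gt0.
have a0 : (0 <= approx)%E by exact: poly_approx_error_ge0.
pose I := 'E_P[fun t => frobenius (matfun f U lam - ALG t)]%E.
have I0 : (0 <= I)%E.
  by rewrite /I unlock; apply: integral_ge0 => t _; rewrite lee_fin frobenius_ge0.
(* An infinite approximation error makes the claim trivial. Otherwise [bnd 0] shows that the
   expectation is finite, and [sqrt_bound_limit] can be applied to its real value. *)
suff bnd j : approx != +oo%E -> (I <= c%:E * approx + (Num.sqrt (tail_sq + K * (E + j.+1%:R^-1)))%:E)%E.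
  have [aoo|afin] := eqVneq approx +oo%E.
    by rewrite aoo gt0_muley ?lte_fin// -EFinM -EFinD /= leey.
  have Ifin : I \is a fin_num.
    rewrite ge0_fin_numE//; apply: le_lt_trans (bnd 0%N afin) _.
    have af : approx \is a fin_num by rewrite ge0_fin_numE// ltey.
    by rewrite -(fineK af) -EFinM -EFinD ltry.
  rewrite -/I -/K -(fineK Ifin); apply: sqrt_bound_limit => //; [exact: sqr_ge0|exact: ltW|].
  by move=> N; exists N => //; rewrite fineK//; exact: bnd.
rewrite -ltey -ge0_fin_numE// => af; set b := c * fine approx.
have bE : (c%:E * approx = b%:E)%E by rewrite -(fineK af) -EFinM.
rewrite bE -EFinD.
have b0 : 0 <= b by rewrite mulr_ge0 ?(ltW c_gt0)// fine_ge0.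
(* The slack 1 / (j + 1) keeps [w] positive even if tail and energy vanish, so that the square root
   has a tangent there. *)
set w := tail_sq + _; have w0 : 0 < w.
  by rewrite ltr_wpDl ?sqr_ge0// mulr_gt0// ltr_wpDl// invr_gt0.
have [sg g0 gE] := gP j; set rho := head_ratio le_kn f lam (g j) in gE.
have rho0 : 0 <= rho by exact: head_ratio_ge0.
pose D : 'rV[R]_(n - k) := tail_eigs (g j).
pose Y t := sketch_sqr le_kn D (random_mx G' t).
have Y0 t : 0 <= Y t by exact: sketch_sqr_ge0.
have mY : measurable_fun setT (fun t => (Y t)%:E).
  by apply/measurable_EFinP; apply: measurable_sketch_sqr; exact: mx_measurable_random.
pose B1 := [set t | reg_gram 0 (random_mx G1 t) \notin unitmx].
have mB1 : measurable B1 := measurable_singular_gram G1.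
have sw : 0 < Num.sqrt w by rewrite sqrtr_gt0.
(* sqrt z <= (z + w) / (2 sqrt w), the tangent at w, in place of Jensen *)
have tangent z : 0 <= z -> Num.sqrt z <= (w + z) / (2 * Num.sqrt w).
  move=> z0; rewrite ler_pdivlMr ?mulr_gt0//.
  rewrite -[X in _ <= X + _](sqr_sqrtr (ltW w0)) -[X in _ <= _ + X](sqr_sqrtr z0).
  by have := sqr_ge0 (Num.sqrt z - Num.sqrt w); lra.
pose a1 := b + (w + tail_sq) / (2 * Num.sqrt w).
pose a2 := 5 * rho / (2 * Num.sqrt w).
have a10 : 0 <= a1.
  by rewrite addr_ge0// divr_ge0 ?mulr_ge0 ?(ltW sw)// addr_ge0 ?sqr_ge0 ?(ltW w0).
have a20 : 0 <= a2 by rewrite divr_ge0 ?mulr_ge0 ?(ltW sw).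
have mind : measurable_fun setT (fun t => (\1_B1 t : R)%:E).
  exact/measurable_EFinP/measurable_indic.
(* On singular Gram matrices no bound is available and the majorant is +oo; that event is null, and
   +oo times 0 is 0. *)
apply: (@le_trans _ _ (\int[P]_t (a1%:E + (a2%:E * (Y t)%:E + +oo * (\1_B1 t)%:E)))%E).
  rewrite /I unlock; apply: ge0_le_lower_integral => t; first by rewrite lee_fin frobenius_ge0.
  rewrite indicE; have [tB|] := boolP (t \in B1).
    by rewrite mule1 addeC -EFinM -addeA /= leey.
  rewrite notin_setE /B1 /= => /negP; rewrite negbK => gu.
  rewrite mule0 adde0 -EFinM -EFinD.
  have := alg_error_le (ALG_out t) sg g0; rewrite -GE G1E => /(_ gu)/le_trans; apply.
  rewrite bE -EFinD lee_fin /a1 -addrA lerD2l -/rho -/D -/(Y t).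
  apply: le_trans (tangent _ _) _; first by rewrite addr_ge0 ?sqr_ge0// !mulr_ge0.
  by rewrite /a2 le_eqVlt; apply/orP; left; apply/eqP; field; rewrite gt_eqF.
rewrite ge0_integralD//; last 2 first.
- by move=> t _; rewrite adde_ge0// mule_ge0// lee_fin.
- by apply: emeasurable_funD; apply: emeasurable_funM.
rewrite probability_integral_cst ge0_integralD//; last 3 first.
- by move=> t _; rewrite mule_ge0// lee_fin.
- exact: emeasurable_funM.
- exact: emeasurable_funM.
rewrite ge0_integralZl//; last by move=> t _; rewrite lee_fin.
rewrite ge0_integralZl//.
rewrite integral_indic// setIT [X in (+oo * X)%E](singular_gram_null gG1 k_ge1 le_kl) mule0 adde0.
apply: le_trans (leeD (lexx _) (lee_wpmul2l _ (sketch_mean le_kn D gG' qE))) _.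
  by rewrite lee_fin.
rewrite -EFinM -EFinD lee_fin /a1 -addrA lerD2l.
(* Averaging brings the argument of the tangent to at most [w], where the tangent equals sqrt w. *)
rewrite [leRHS](_ : _ = (w + w) / (2 * Num.sqrt w)); last first.
  by rewrite -[in RHS](sqr_sqrtr (ltW w0)) sqrtr_sqr ger0_norm; [field; rewrite gt_eqF|exact: ltW].
have -> : a2 * (sqfrob (diag_mx D) * (k%:R / q.+1%:R)) =
    5 * rho * (sqfrob (diag_mx D) * (k%:R / q.+1%:R)) / (2 * Num.sqrt w).
  by rewrite /a2 mulrAC.
rewrite -mulrDl ler_pM2r ?invr_gt0 ?mulr_gt0// -addrA lerD2l /w lerD2l.
have -> : 5 * rho * (sqfrob (diag_mx D) * (k%:R / q.+1%:R)) = K * (sqfrob (diag_mx D) * rho).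
  by rewrite /K; ring.
by rewrite ler_pM2l// -tail_normE.
Qed.

End KrylovAware.

Theorem theorem3p5 (R : realType) (n k l s r : nat)
  (k_ge1 : (1 <= k)%N) (le_kn : (k <= n)%N) (le_kl : (k <= l)%N)
  (s_ge1 : (1 <= s)%N)
  (A : 'M[R]_n) (A_sym : A^T = A) (f : R -> R)
  (U : 'M[R]_n) (lam : 'rV[R]_n) (A_eig : eigendecomposition A U lam)
  (lam_sorted : forall i j : 'I_n,
     (i <= j)%N -> `|f (lam 0 j)| <= `|f (lam 0 i)|)
  (lmin lmax : R)
  (lminP : smallest_eigenvalue A lmin) (lmaxP : largest_eigenvalue A lmax)
  (d : measure_display) (T : measurableType d) (P : probability T R)
  (G : 'I_n * 'I_l -> {RV P >-> R}) (G_gauss : std_gaussian_entries G)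
  (ALG : T -> 'M[R]_n)
  (ALG_out : forall t, alg_output A f s r k (random_mx G t) (ALG t)) :
  (forall delta : R, 0 < delta < 1 ->
     holds_with_prob P (1 - delta)
       [set t | ((frobenius (matfun f U lam - ALG t))%:E <=
         (4 * Num.sqrt (l * s)%:R)%:E
           * poly_approx_error (2 * r + 1) f lmin lmax
         + sqrte ((tail_norm le_kn lam f ^+ 2)%:E
                  + (5 * Cdelta delta k l)%:E * energy le_kn lam f s))%E]) /\
  ((2 <= l - k)%N ->
     ('E_P[fun t => frobenius (matfun f U lam - ALG t)] <=
         (4 * Num.sqrt (l * s)%:R)%:E
           * poly_approx_error (2 * r + 1) f lmin lmax
         + sqrte ((tail_norm le_kn lam f ^+ 2)%:E
                  + (5 * k%:R / (l%:R - k%:R - 1))%:E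
                    * energy le_kn lam f s))%E).
Proof.
split=> [delta d01|lk2].
  exact: (alg_error_probability k_ge1 le_kn le_kl s_ge1 A_sym A_eig lam_sorted lminP lmaxP G_gauss ALG_out d01).
exact: (alg_error_expectation k_ge1 le_kn le_kl s_ge1 A_sym A_eig lam_sorted lminP lmaxP G_gauss ALG_out lk2).
Qed.
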